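(* Let $W=W(x)$ be radially symmetric and nonincreasing with respect to $|x|$. If for some $K\in\mathbb N$, $\alpha>0$ and a Fourier mode $n\in\mathbb Z^d$, $n\ne0$, the dispersion relation $$-\varrho_0g_0g_1\widehat W_n|q_n|^2I_n(\alpha;\lambda)=1$$ has a root $\lambda\in\mathbb C$ with $\operatorname{Re}\lambda\ge0$, then $$-2\varrho_0\frac{g_1}{g_0}\widehat W_{\mathbf 1}>1,$$ where $\mathbf 1$ is any unit vector in $\mathbb Z^d$.
   Context: $d\ge1$, $K\ge1$ are integers; $\Omega=(0,1)^d$ is the torus, identified with $[-1/2,1/2]^d$ with opposite faces glued. $\varrho_0>0$ is fixed, $G:\mathbb R^+\to\mathbb R^+$ is bounded, positive, decreasing, $g_0:=G(\varrho_0)>0$, $g_1:=G'(\varrho_0)<0$. The kernel $W$ is nonnegative and bounded, regarded as a compactly supported function on $\mathbb R^d$ with support in $[-1/2,1/2]^d$, extended periodically to $\Omega$, and normalized by $\int_\Omega W=1$. $q_n:=2\pi n$, $\widehat W_n:=\int_\Omega W(x)e^{-iq_n\cdot x}dx\in\mathbb R$. For $\alpha>0$, $$I_n(\alpha;\lambda):=\int_0^\infty e^{-\lambda t}\,C_K(t)^2\exp\Big(-\frac{|q_n|^2}{2}V_\alpha(t)\Big)dt,\qquad C_K(t):=\frac1{(K-1)!}\int_0^te^{-\alpha s}s^{K-1}\,ds,$$ and $V_\alpha(t):=\operatorname{Var}\big(\int_0^tY_s^1\,ds\big)$, where $(Y_s)_{s\ge0}$ is the stationary $\mathbb R^K$-valued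 Ornstein--Uhlenbeck process $dY_s=AY_s\,ds+g_0e_K\,dB_s$, $B$ a one-dimensional Brownian motion, $e_K=(0,\dots,0,1)^T$, $A_{kk}=-\alpha$, $A_{k,k+1}=1$, all other entries of $A\in\mathbb R^{K\times K}$ zero, and $Y_0$ independent of $B$ with the invariant law $\mathcal N(0,\Sigma)$, $\Sigma=g_0^2\int_0^\infty e^{tA}e_Ke_K^Te^{tA^T}dt$. *)

(* Defs.v *)
From HB Require Import structures.
From mathcomp Require Import all_boot all_order all_algebra.
From mathcomp Require Import all_classical all_reals all_analysis.
From mathcomp Require Import complex.
Import Order.TTheory GRing.Theory Num.Theory.
Import numFieldNormedType.Exports.

Set Implicit Arguments.
Unset Strict Implicit.
Unset Printing Implicit Defensive.

Local Open Scope classical_set_scope.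
Local Open Scope complex_scope.
Local Open Scope ring_scope.

Section lebesgue_nd.
Variable R : realType.

Definition tuple_cons d (p : measurableTypeR R * d.-tuple R) :
  d.+1.-tuple R := [tuple of p.1 :: p.2].

Lemma measurable_tuple_cons d : measurable_fun setT (@tuple_cons d).
Proof. by apply: measurable_cons; [exact: measurable_fst|exact: measurable_snd]. Qed.

Section step.
Variables (d : nat) (mu : {sigma_finite_measure set (d.-tuple R) -> \bar R}).

Definition lebesgue_step : set (d.+1.-tuple R) -> \bar R :=
  pushforward (lebesgue_measure \x mu)%E (@tuple_cons d).

Let m := measure_function_pushforward__canonical__measure_function_Measure
  (lebesgue_measure \x mu)%E (@measurable_tuple_cons d).

Let step0 : lebesgue_step set0 = 0%E.
Proof. exact: (measure0 m). Qed.

Let step_ge0 A : (0 <= lebesgue_step A)%E.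
Proof. exact: (measure_ge0 m). Qed.

Let step_sigma_additive : semi_sigma_additive lebesgue_step.
Proof. exact: (@measure_semi_sigma_additive _ _ _ m). Qed.

HB.instance Definition _ :=
  isMeasure.Build _ _ _ lebesgue_step step0 step_ge0 step_sigma_additive.

Let step_sigma_finite : sigma_finite setT lebesgue_step.
Proof.
have /sigma_finiteP[F [FT ndF Foo]] := sigma_finiteT (@lebesgue_measure R).
have /sigma_finiteP[H [HT ndH Hoo]] := sigma_finiteT mu.
pose uncons (t : d.+1.-tuple R) : measurableTypeR R * d.-tuple R :=
  (thead t, [tuple of behead t]).
have consK : cancel (@tuple_cons d) uncons.
  by move=> [x t]; congr pair; apply/val_inj.
have muncons : measurable_fun setT uncons.
  apply/measurable_fun_pair; last exact: measurable_behead.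
  exact: measurable_tnth.
exists (fun i => uncons @^-1` (F i `*` H i)).
  rewrite -preimage_bigcup (_ : \bigcup_i _ = setT) ?preimage_setT//.
  rewrite -subTset => -[x y] _.
  have [i _ Fx] : (\bigcup_i F i) x by rewrite -FT.
  have [j _ Hy] : (\bigcup_i H i) y by rewrite -HT.
  exists (maxn i j) => //; split.
    by move: x Fx; exact/subsetPset/ndF/leq_maxl.
  by move: y Hy; exact/subsetPset/ndH/leq_maxr.
move=> i; have [mF Fi] := Foo i; have [mH Hi] := Hoo i; split.
  rewrite -[X in measurable X]setTI; apply: muncons => //.
  exact: measurableX.
rewrite /lebesgue_step /pushforward -comp_preimage.
rewrite (_ : uncons \o @tuple_cons d = id); last first.
  by apply/funext => p /=; rewrite consK.
by rewrite preimage_id product_measure1E// lte_mul_pinfty// ge0_fin_numE.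
Qed.

HB.instance Definition _ :=
  Measure_isSigmaFinite.Build _ _ _ lebesgue_step step_sigma_finite.

End step.

(* Lebesgue measure on R^d, points of R^d being d-tuples. *)
Fixpoint lebesgue_nd d : {sigma_finite_measure set (d.-tuple R) -> \bar R} :=
  if d is d'.+1 then lebesgue_step (lebesgue_nd d') else \d_[tuple].

End lebesgue_nd.

Section euclidean.
Variable R : realType.

Definition dotp d (x y : d.-tuple R) : R := \sum_(i < d) tnth x i * tnth y i.

(* The library norm on vectors is the sup norm. *)
Definition enorm d (x : d.-tuple R) : R := Num.sqrt (dotp x x).

(* The torus, as the cube [-1/2, 1/2]^d; the gluing of opposite faces only
   matters on a Lebesgue-null set. *)
Definition Omega d : set (d.-tuple R) :=
  [set x | forall i, `|tnth x i| <= 1 / 2].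

Definition of_lattice d (n : 'rV[int]_d) : d.-tuple R :=
  [tuple (n 0 i)%:~R | i < d].

Definition wave_vector d (n : 'rV[int]_d) : d.-tuple R :=
  [tuple 2 * pi * (n 0 i)%:~R | i < d].

End euclidean.
Arguments of_lattice {R d} n.
Arguments wave_vector {R d} n.

Section complex_analysis.
Variable R : realType.

Definition cexp (z : R[i]) : R[i] :=
  (expR (complex.Re z))%:C * (cos (complex.Im z) +i* sin (complex.Im z)).

Definition Cintegral dT (T : measurableType dT)
    (mu : {measure set T -> \bar R}) (D : set T) (f : T -> R[i]) : R[i] :=
  (\int[mu]_(x in D) complex.Re (f x)) +i* (\int[mu]_(x in D) complex.Im (f x)).

End complex_analysis.

Section kernel.
Variables (R : realType) (d : nat).
Implicit Type W : d.-tuple R -> R.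

Record torus_kernel W : Prop := {
  kernel_measurable : measurable_fun setT W;
  kernel_ge0 : forall x, 0 <= W x;
  kernel_bounded : exists M, forall x, W x <= M;
  kernel_support : forall x, ~ Omega x -> W x = 0;
  kernel_mass : (\int[lebesgue_nd R d]_(x in @Omega R d) W x = 1)%R }.

(* Only the values on the cube are constrained, so that both a radial profile
   on R^d and a radial profile on the torus (cut off at the cube) qualify. *)
Definition radially_nonincreasing W : Prop :=
  exists2 w : R -> R,
    (forall r s : R, 0 <= r -> r <= s -> w s <= w r) &
    (forall x, Omega x -> W x = w (enorm x)).

(* Complex-valued by definition; it is real as soon as W is even. Recall that
   in the order of R[i], 1 < z means Im z = 0 and 1 < Re z. *)
Definition Fourier_coef W (n : 'rV[int]_d) : R[i] :=
  Cintegral (lebesgue_nd R d) (@Omega R d)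
    (fun x => (W x)%:C * cexp (0 +i* - dotp (wave_vector n) x)).

End kernel.

Section probability.
Variables (R : realType) (dT : measure_display) (T : measurableType dT).
Variable P : probability T R.

(* The library's normal_prob m 0 is not the Dirac mass at m. *)
Definition gaussian (m v : R) (A : set R) : \bar R :=
  if v == 0 then \d_m A else normal_prob m (Num.sqrt v) A.

Definition has_law (X : T -> R) (nu : set R -> \bar R) : Prop :=
  forall A : set R, measurable A -> P (X @^-1` A) = nu A.

Definition gaussian_vector K (X : T -> 'cV[R]_K) (m : 'cV[R]_K)
    (S : 'M[R]_K) : Prop :=
  forall u : 'rV[R]_K,
    has_law (fun x => (u *m X x) 0 0)
      (gaussian ((u *m m) 0 0) ((u *m S *m u^T) 0 0)).

Definition sigma_of (I : Type) (D : set I) (X : I -> T -> R) : set (set T) :=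
  <<s [set E | exists i (A : set R),
         [/\ D i, measurable A & E = X i @^-1` A] ] >>.

Definition independent (F G : set (set T)) : Prop :=
  forall A B, F A -> G B -> P (A `&` B) = (P A * P B)%E.

Record brownian_motion (B : R -> T -> R) : Prop := {
  bm_measurable : forall t : R, 0 <= t -> measurable_fun setT (B t);
  bm_start : {ae P, forall x, B 0 x = 0};
  bm_continuous :
    {ae P, forall x, {within `[0, +oo[, continuous (fun t => B t x)}};
  bm_gaussian : forall s t : R, 0 <= s -> s <= t ->
    has_law (fun x => B t x - B s x) (gaussian 0 (t - s));
  bm_independent : forall (m : nat) (t : nat -> R) (A : nat -> set R),
    0 <= t 0%N -> (forall i, t i <= t i.+1) -> (forall i, measurable (A i)) ->
    P (\bigcap_(i in `I_m) [set x | A i (B (t i.+1) x - B (t i) x)]) =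
    (\prod_(i < m) P [set x | A i (B (t i.+1) x - B (t i) x)%R])%E }.

End probability.

Section ornstein_uhlenbeck.
Variables (R : realType) (K : nat).

Definition drift (alpha : R) : 'M[R]_K :=
  \matrix_(k, l) (if k == l then - alpha
                  else if val l == (val k).+1 then 1 else 0).

Definition e_last : 'cV[R]_K := \col_k (k.+1 == K)%:R.

Definition mexp (M : 'M[R]_K) : 'M[R]_K :=
  \matrix_(i, j) limn (series (fun k => (M ^+ k) i j / k`!%:R)).

Definition invariant_cov (alpha g0 : R) : 'M[R]_K :=
  g0 ^+ 2 *: \matrix_(i, j) \int[lebesgue_measure]_(t in `[0, +oo[)
    (mexp (t *: drift alpha) *m e_last *m e_last^T
       *m mexp (t *: (drift alpha)^T)) i j.

(* The noise is additive, so dY = A Y ds + g0 e_K dB is a pathwise integral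
   equation. *)
Record stationary_OU (dT : measure_display) (T : measurableType dT)
    (P : probability T R) (alpha g0 : R)
    (B : R -> T -> R) (Y : R -> T -> 'cV[R]_K) : Prop := {
  ou_brownian : brownian_motion P B;
  ou_measurable : forall (t : R) k, 0 <= t ->
    measurable_fun setT (fun x => Y t x k 0);
  ou_continuous : {ae P, forall x, forall k,
    {within `[0, +oo[, continuous (fun t => Y t x k 0)}};
  ou_equation : {ae P, forall x, forall t : R, 0 <= t ->
    Y t x = Y 0 x
      + \col_k \int[lebesgue_measure]_(s in `[0, t]) (drift alpha *m Y s x) k 0
      + (g0 * B t x) *: e_last};
  ou_initial : gaussian_vector P (Y 0) 0 (invariant_cov alpha g0);
  ou_independent :
    independent P (sigma_of setT (fun k x => Y 0 x k 0))
                  (sigma_of [set t | 0 <= t] B) }.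

(* Variance of the time integral of the first coordinate of Y. *)
Definition OU_variance (K_gt0 : (0 < K)%N)
    (dT : measure_display) (T : measurableType dT) (P : probability T R)
    (Y : R -> T -> 'cV[R]_K) (t : R) : R :=
  fine ('V_P[fun x =>
    (\int[lebesgue_measure]_(s in `[0, t]) Y s x (Ordinal K_gt0) 0)%R]).

Definition gain (alpha t : R) : R :=
  (K.-1)`!%:R^-1 *
  \int[lebesgue_measure]_(s in `[0, t]) (expR (- alpha * s) * s ^+ K.-1).

(* V plays the role of t |-> V_alpha(t), and q2 that of |q_n|^2. *)
Definition response_integral (alpha q2 : R) (V : R -> R) (lambda : R[i]) : R[i] :=
  Cintegral (@lebesgue_measure R) `[0, +oo[
    (fun t => cexp (- lambda * t%:C) *
       (gain alpha t ^+ 2 * expR (- (q2 / 2) * V t))%:C).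

End ornstein_uhlenbeck.

(* Main.v *)
(** Variation of constants writes int_0^t Y^1 as c(t) Y_0 plus a Wiener integral
with kernel g0 C_K(t - s), so V(t) = c(t) Sigma c(t)^T + g0^2 U(t) with
U(t) = int_0^t C_K^2, and the first term is positive for t > 0.  Hence, with
q = |q_n|^2, the integrand of I_n is strictly dominated by
U'(t) exp (- q g0^2 U(t) / 2), whose integral telescopes to at most
2 / (q g0^2); this gives |Re I_n| < 2 / (q g0^2) when Re lambda >= 0.
On the kernel side |W_n| <= W_1 for the Fourier coefficients: integrating out
all coordinates but one with n_i <> 0 leaves an even function that is
nonincreasing on [0, 1/2], and integrating the cosine reduces the comparison
to |sin (m x)| <= |m sin x|. *)
Require Import Defs.
From HB Require Import structures.
From mathcomp Require Import all_boot all_order all_algebra.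
From mathcomp Require Import all_classical all_reals all_analysis.
From mathcomp Require Import measurable_realfun complex.
From mathcomp Require Import ring lra.
Import Order.TTheory GRing.Theory Num.Theory.
Import numFieldNormedType.Exports.

Set Implicit Arguments.
Unset Strict Implicit.

Local Open Scope classical_set_scope.
Local Open Scope complex_scope.
Local Open Scope ring_scope.

(** The root may be complex, so the signs of W_n and Re I_n are not known and absolute values are
    compared. As W_n is real, the real part of the dispersion relation is 1 = -rho0 g0 g1 W_n q Re
    I_n, where q cancels against the bound 2 / (q g0^2). Strictness in the conclusion comes from the
    random initial value Y_0: the noise alone would give only a bound with <=. The variance is found
    without a stochastic integral. Integration by parts, path by path, moves the noise from dB to B,
    and the resulting Riemann integral is a limit of finite linear combinations of values of B.
    Their second moments follow from E[B_s B_t] = min(s, t), which is also the Gram matrix of the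
    indicators of [0, s]. The limit holds only almost surely, on a space that need not be complete,
    so functions not known to be measurable must be integrated. On the kernel side the profile is a
    function of the squared radius: fixing one coordinate then merely shifts it, which permits
    induction on the dimension. Since the unit vector in the conclusion is arbitrary, invariance
    under exchange of axes is needed too. *)

Section real_derivatives.
Variable R : realType.
Implicit Types (f g : R -> R) (x c : R).

(** The rules of this section are stated for functions written pointwise, so that the derivative of
    an explicit expression can be assembled as a proof term. *)
Lemma is_derive_addf f g x a b : is_derive x 1 f a -> is_derive x 1 g b ->
  is_derive x 1 (fun y => f y + g y) (a + b).
Proof. by move=> fa gb; exact: is_deriveD. Qed.

Lemma is_derive_subf f g x a b : is_derive x 1 f a -> is_derive x 1 g b ->
  is_derive x 1 (fun y => f y - g y) (a - b).
Proof. by move=> fa gb; exact: is_deriveB. Qed.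

Lemma is_derive_mulf f g x a b : is_derive x 1 f a -> is_derive x 1 g b ->
  is_derive x 1 (fun y => f y * g y) (f x * b + g x * a).
Proof. by move=> fa gb; exact: is_deriveM. Qed.

Lemma is_derive_scalef f c x a : is_derive x 1 f a ->
  is_derive x 1 (fun y => c * f y) (c * a).
Proof. by move=> fa; exact: is_deriveZ. Qed.

Lemma is_derive_compf f g x a b : is_derive (g x) 1 f a -> is_derive x 1 g b ->
  is_derive x 1 (fun y => f (g y)) (a * b).
Proof. by move=> fa gb; exact: is_derive1_comp. Qed.

Lemma is_derive_idf x : is_derive x 1 (fun y : R => y) 1.
Proof. exact: is_derive_id. Qed.

Lemma is_derive_cstf c x : is_derive x 1 (fun=> c : R) 0.
Proof. exact: is_derive_cst. Qed.

Lemma is_derive_csubl c x : is_derive x 1 (fun y : R => c - y) (-1).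
Proof. by have := is_derive_subf (is_derive_cstf c x) (is_derive_idf x); rewrite sub0r. Qed.

Lemma is_derive_mull c x : is_derive x 1 (fun y : R => c * y) c.
Proof. by have := is_derive_scalef c (is_derive_idf x); rewrite mulr1. Qed.

Lemma is_derive_continuous f x a : is_derive x 1 f a -> {for x, continuous f}.
Proof. by move=> [df _]; exact/differentiable_continuous/derivable1_diffP. Qed.

Lemma continuous_sumf (I : Type) (r : seq I) (f : I -> R -> R) :
  (forall i, continuous (f i)) -> continuous (fun x => \sum_(i <- r) f i x).
Proof.
move=> cf; elim: r => [|i r IH] x.
  by under eq_fun do rewrite big_nil; exact: cvg_cst.
under eq_fun do rewrite big_cons.
by apply: cvgD; [exact: cf|exact: IH].
Qed.

End real_derivatives.

(** * Integrals over compact intervals, and an inequality for nonincreasing weights *)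

Section real_integrals.
Variable R : realType.
Implicit Types (f g h : R -> R) (a b x y : R).
Notation mu := (@lebesgue_measure R).

Lemma bounded_itv_integrable (i : interval R) f (a b M : R) :
  [set` i] `<=` `[a, b] -> measurable_fun [set` i] f ->
  (forall x, [set` i] x -> `|f x| <= M) -> mu.-integrable [set` i] (EFin \o f).
Proof.
move=> iab mf fM; apply: measurable_bounded_integrable => //.
  apply: (@le_lt_trans _ _ (mu `[a, b])).
    by apply: le_measure; rewrite ?inE.
  by rewrite lebesgue_measure_itv /=; case: ifP => // _; rewrite -EFinB ltry.
exists M; split; first exact: num_real.
by move=> r Mr x ix; apply: (le_trans (fM _ ix)); exact: ltW.
Qed.

Lemma continuous_itv_integrable f a b : continuous f ->
  mu.-integrable `[a, b] (EFin \o f).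
Proof.
move=> cf; apply: continuous_compact_integrable; first exact: segment_compact.
exact: continuous_subspaceT.
Qed.

Lemma Rintegral_FTC2 F f a b : a <= b ->
  (forall x, a <= x <= b -> is_derive x 1 F (f x)) -> continuous f -> \int[mu]_(x in `[a, b])
    f x = F b - F a.
Proof.
rewrite le_eqVlt => /predU1P[->|ab] dF cf.
  by rewrite set_itv1 Rintegral_set1 subrr.
rewrite /Rintegral (@continuous_FTC2 _ f F a b) //.
- exact: continuous_subspaceT.
- have itvW x : x \in `]a, b[ -> a <= x <= b.
    by rewrite in_itv/= => /andP[ax xb]; rewrite !ltW.
  have cF x : a <= x <= b -> {for x, continuous F}.
    by move=> /dF; exact: is_derive_continuous.
  split.
  + by move=> x /itvW /dF[].
  + by apply/cvg_at_right_filter/cF; rewrite lexx ltW.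
  + by apply/cvg_at_left_filter/cF; rewrite lexx ltW.
- by move=> x; rewrite in_itv/= => /andP[ax xb]; rewrite derive1E; have [|_ ->] := dF x;
    rewrite ?ltW.
Qed.

(** The derivative is two-sided, hence [a < x]. Primitives used on [0, t] are therefore based at -1
    below, so that 0 is an interior point. *)
Lemma is_derive_Rintegral f a x : continuous f -> a < x ->
  is_derive x 1 (fun y => \int[mu]_(t in `[a, y]) f t) (f x).
Proof.
move=> cf ax; have xx1 : x < x + 1 by rewrite ltrDl.
have [df dE] := continuous_FTC1_closed xx1 (@continuous_itv_integrable f a (x + 1) cf) ax (cf
  x).
by apply: DeriveDef => //; rewrite -derive1E.
Qed.

Lemma Rintegral_itv_split f a b x : a <= x -> x <= b ->
  mu.-integrable `[a, b] (EFin \o f) ->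
  \int[mu]_(t in `[a, b]) f t =
  \int[mu]_(t in `[a, x]) f t + \int[mu]_(t in `[x, b]) f t.
Proof.
move=> ax xb intf.
have := Rintegral_itvB intf (x := x); rewrite !bnd_simp => /(_ ax xb) H.
rewrite -[X in _ + X]Rintegral_itv_obnd_cbnd -?H; first by rewrite addrC subrK.
apply: integrableS intf => //; apply: subset_itv; rewrite bnd_simp//.
Qed.

(** For smooth [g], integration by parts gives - int g' K >= 0. Here [g] is only monotone, so the
    parts formula is replaced by a quantity [Phi] whose loss over a short interval is controlled,
    and the losses are summed over finer and finer grids. *)
Lemma noninc_weighted_ge0 (g k K : R -> R) (b M : R) : 0 <= b ->
  measurable_fun setT g -> (forall x y, 0 <= x -> x <= y -> g y <= g x) ->
  continuous k -> (forall x, `|k x| <= M) ->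
  (forall x, is_derive x 1 K (k x)) -> (forall x, 0 <= x <= b -> 0 <= K x) ->
  K 0 = 0 -> K b = 0 ->
  0 <= \int[mu]_(x in `[0, b]) (g x * k x).
Proof.
move=> b0 mg gni ck kM dK K_ge0 K0 Kb.
have mk : measurable_fun setT k by exact: continuous_measurable_fun.
have M0 : 0 <= M by exact: le_trans (kM 0).
have intgk x y : 0 <= x -> mu.-integrable `[x, y] (EFin \o (fun t => g t * k t)).
  move=> x0; apply: (@bounded_itv_integrable _ _ x y ((`|g x| + `|g y|) * M)) => //.
    by apply: measurable_funTS; exact: measurable_funM.
  move=> t /=; rewrite in_itv/= => /andP[xt ty]; rewrite normrM ler_pM//.
  rewrite ler_norml; apply/andP; split.
    rewrite (le_trans _ (gni _ _ (le_trans x0 xt) ty))//.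
    have := ler_norm (- g y); rewrite normrN; have := normr_ge0 (g x); lra.
  rewrite (le_trans (gni _ _ x0 xt))//.
  have := ler_norm (g x); have := normr_ge0 (g y); lra.
pose Phi x := \int[mu]_(t in `[0, x]) (g t * k t) - g x * K x.
(* The change of [Phi] is the integral of (g - g y) k over [x, y] plus (g x - g y) K x. The second
   term is nonnegative, and the first is at most M (y - x) (g x - g y) in absolute value. *)
have PhiD x y : 0 <= x -> x <= y -> y <= b ->
    - (M * (y - x) * (g x - g y)) <= Phi y - Phi x.
  move=> x0 xy yb; rewrite /Phi (@Rintegral_itv_split _ 0 y x)//; last exact: intgk.
  have gb t : [set` `[x, y]] t -> `|(g t - g y) * k t| <= (g x - g y) * M.
    rewrite /= in_itv/= => /andP[xt ty]; rewrite normrM ler_pM//.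
    have h1 := gni _ _ (le_trans x0 xt) ty; have h2 := gni _ _ x0 xt.
    by rewrite ger0_norm; lra.
  have mgk : measurable_fun [set` `[x, y]] (fun t => (g t - g y) * k t).
    by apply: measurable_funTS; apply: measurable_funM => //; exact: measurable_funB.
  have ig : mu.-integrable `[x, y] (EFin \o (fun t => (g t - g y) * k t)).
    exact: (@bounded_itv_integrable _ _ x y _ _ mgk gb).
  have -> : \int[mu]_(t in `[x, y]) (g t * k t) =
      \int[mu]_(t in `[x, y]) ((g t - g y) * k t) + g y * (K y - K x).
    rewrite -(Rintegral_FTC2 xy (fun t _ => dK t) ck) -RintegralZl//;
      last exact: continuous_itv_integrable.
    rewrite -RintegralD//.
    - by apply: eq_Rintegral => t _; ring.
    - by apply: continuous_itv_integrable => t; apply: continuousM; [exact: cvg_cst|exact: ck].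
  have : `|\int[mu]_(t in `[x, y]) ((g t - g y) * k t)| <= M * (y - x) * (g x - g y).
    apply: (le_trans (le_normr_Rintegral _ ig)) => //.
    apply: (@le_trans _ _ (\int[mu]_(t in `[x, y]) ((g x - g y) * M))).
      apply: le_Rintegral => //.
      - by have /= := integrable_norm ig.
      - exact/continuous_itv_integrable/cst_continuous.
    rewrite Rintegral_cst//=.
    rewrite lebesgue_measure_itv/= lte_fin.
    by case: ltP => xy'/=; [lra|have -> : x = y; lra].
  rewrite ler_norml => /andP[+ _].
  have := K_ge0 x; rewrite x0 (le_trans xy yb) => /(_ isT) Kx0.
  have : 0 <= (g x - g y) * K x by rewrite mulr_ge0// subr_ge0 gni.
  move: (\int[mu]_(t in `[x, y]) ((g t - g y) * k t)).
  move: (\int[mu]_(t in `[0, x]) (g t * k t)) => A I.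
  lra.
have Phi0 : Phi 0 = 0.
  by rewrite /Phi K0 mulr0 subr0 set_itv1 Rintegral_set1.
have Phib : Phi b = \int[mu]_(x in `[0, b]) (g x * k x) by rewrite /Phi Kb mulr0 subr0.
rewrite -Phib; pose D := M * b * (g 0 - g b).
(* On a uniform grid the drops of [g] telescope, so the total loss is at most D / n.+1, which tends
   to 0. *)
have step n j : (j <= n.+1)%N ->
    - (M * (b / n.+1%:R) * (g 0 - g (j%:R * (b / n.+1%:R)))) <= Phi (j%:R * (b / n.+1%:R)).
  have h0 : 0 <= b / n.+1%:R by rewrite divr_ge0.
  elim: j => [_|j IH jn]; first by rewrite mul0r Phi0 subrr mulr0 oppr0.
  have {}IH := IH (ltnW jn).
  have := PhiD (j%:R * (b / n.+1%:R)) (j.+1%:R * (b / n.+1%:R)).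
  rewrite mulr_ge0// ler_wpM2r ?ler_nat//.
  have -> : j.+1%:R * (b / n.+1%:R) <= b.
    by rewrite mulrCA ler_piMr// ler_pdivrMr ?ltr0n// mul1r ler_nat.
  move=> /(_ isT isT isT).
  have -> : j.+1%:R * (b / n.+1%:R) - j%:R * (b / n.+1%:R) = b / n.+1%:R.
    by rewrite -mulrBl -natr1 addrAC subrr add0r mul1r.
  move: IH; move: (b / n.+1%:R) => h.
  move: (j%:R * h) (j.+1%:R * h) => u v.
  by move: (Phi u) (Phi v) (g u) (g v) (g 0) => *; lra.
have PhibD n : - (D / n.+1%:R) <= Phi b.
  have := step n n.+1 (leqnn _).
  have -> : n.+1%:R * (b / n.+1%:R) = b by rewrite mulrC divfK ?pnatr_eq0.
  by apply: le_trans; rewrite /D; rewrite le_eqVlt; apply/orP; left; apply/eqP; ring.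
rewrite leNgt; apply/negP => Phineg.
have D0 : 0 <= D by rewrite !mulr_ge0// subr_ge0 gni.
have := PhibD (Num.truncn (D / - Phi b)).
have : D / - Phi b < (Num.truncn (D / - Phi b)).+1%:R.
  exact: truncnS_gt.
set n := (Num.truncn _).+1 => Dn H.
have : D / n%:R < - Phi b.
  rewrite ltr_pdivrMr ?ltr0n//; move: Dn; rewrite ltr_pdivrMr ?oppr_gt0//.
  by rewrite mulrC.
lra.
Qed.

End real_integrals.

(** * Comparison of cosine coefficients of an even function in one dimension *)

Section cosine_modes.
Variable R : realType.
Notation mu := (@lebesgue_measure R).

Lemma RintegralN (D : set R) (f : R -> R) : measurable D ->
  measurable_fun setT f -> mu.-integrable (-%R @^-1` D) (EFin \o (f \o -%R)) ->
  \int[mu]_(x in D) f x = \int[mu]_(x in -%R @^-1` D) f (- x).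
Proof.
move=> mD mf intf; rewrite /Rintegral; congr fine.
have mN : measurable_fun setT (-%R : R -> measurableTypeR R) by exact: oppr_measurable.
have := @integral_pushforward _ _ (measurableTypeR R) (measurableTypeR R) R _ mN mu D (EFin \o
  f) _ _ mD.
move=> <-//; last exact/measurable_EFinP.
by apply: eq_measure_integral => A mA _; apply/esym/lebesgue_measureN.
Qed.

Lemma Rintegral_symmetric (f : R -> R) (a M : R) : 0 <= a ->
  measurable_fun setT f -> (forall x, `|x| <= a -> `|f x| <= M) ->
  \int[mu]_(x in `[- a, a]) f x = \int[mu]_(x in `[0, a]) (f x + f (- x)).
Proof.
move=> a0 mf fM.
have mfN : measurable_fun setT (f \o -%R).
  by apply: measurableT_comp => //; exact: oppr_measurable.
have intf : mu.-integrable `[- a, a] (EFin \o f).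
  apply: (@bounded_itv_integrable _ _ _ (- a) a M) => //; first exact: measurable_funTS.
  by move=> x /=; rewrite in_itv/= -ler_norml => /fM.
have intf0 : mu.-integrable `[0, a] (EFin \o f).
  by apply: integrableS intf => //; apply: subset_itvr; rewrite bnd_simp oppr_le0.
have intfN : mu.-integrable `[0, a] (EFin \o (f \o -%R)).
  apply: (@bounded_itv_integrable _ _ _ 0 a M) => //; first exact: measurable_funTS.
  by move=> x /=; rewrite in_itv/= => /andP[x0 xa]; apply: fM; rewrite normrN ger0_norm.
rewrite RintegralD// (@Rintegral_itv_split _ _ _ _ 0)// ?oppr_le0// addrC; congr (_ + _).
have Nset : -%R @^-1` `[- a, 0]%classic = `[0, a]%classic :> set R.
  by apply/seteqP; split=> x; rewrite /= !in_itv/= oppr_le0 lerN2 andbC.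
by rewrite RintegralN// Nset.
Qed.

Lemma normr_sin_natmul (x : R) (n : nat) : `|sin (n%:R * x)| <= n%:R * `|sin x|.
Proof.
elim: n => [|n IH]; first by rewrite !mul0r sin0 normr0.
rewrite -natr1 mulrDl mul1r sinD mulrDl mul1r (le_trans (ler_normD _ _))//.
rewrite lerD// normrM; last by rewrite ler_piMl// cos_max.
by rewrite (le_trans _ IH)// ler_piMr// cos_max.
Qed.

Lemma measurable_cos_comp d (T : measurableType d) (f : T -> R) : measurable_fun setT f ->
  measurable_fun setT (fun x => cos (f x)).
Proof. by move=> mf; apply: measurableT_comp mf; apply: continuous_measurable_fun;
  exact: continuous_cos. Qed.

Lemma measurable_sin_comp d (T : measurableType d) (f : T -> R) : measurable_fun setT f ->
  measurable_fun setT (fun x => sin (f x)).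
Proof. by move=> mf; apply: measurableT_comp mf; apply: continuous_measurable_fun;
  exact: continuous_sin. Qed.

Lemma is_derive_sin_mul (c x : R) :
  is_derive x 1 (fun y => sin (c * y)) (c * cos (c * x)).
Proof.
rewrite mulrC; apply: is_derive_compf; exact: is_derive_mull.
Qed.

Lemma sin_2pi_int (m : int) : sin (2 * pi * m%:~R / 2 : R) = 0.
Proof.
have -> : 2 * pi * m%:~R / 2 = m%:~R * pi :> R by field.
have nat_case (n : nat) : sin (n%:R * pi : R) = 0.
  elim: n => [|n IH]; first by rewrite mul0r sin0.
  by rewrite -natr1 mulrDl mul1r sinD IH sinpi mul0r mulr0 addr0.
by case: m => n; [exact: nat_case|rewrite NegzE mulrNz mulNr sinN nat_case oppr0].
Qed.

Lemma cos_mode_le (g : R -> R) (m : int) (M : R) : m != 0 ->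
  measurable_fun setT g -> (forall x, g (- x) = g x) ->
  (forall x y, 0 <= x -> x <= y -> g y <= g x) ->
  (forall x, `|x| <= 1 / 2 -> `|g x| <= M) ->
  `|\int[mu]_(x in `[- (1 / 2), 1 / 2]) (g x * cos (2 * pi * m%:~R * x))| <=
  \int[mu]_(x in `[- (1 / 2), 1 / 2]) (g x * cos (2 * pi * x)).
Proof.
move=> m0 mg gN gni gM.
have half0 : 0 <= 1 / 2 :> R by lra.
have mcos (c : R) : measurable_fun setT (fun x => g x * cos (c * x)).
  by apply: measurable_funM => //; apply: measurable_cos_comp; exact: mulrl_measurable.
have bcos (c x : R) : `|x| <= 1 / 2 -> `|g x * cos (c * x)| <= M.
  by move=> xa; rewrite normrM (le_trans _ (gM x xa))// ler_piMr//; exact: cos_max.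
have icos (c : R) : mu.-integrable `[0, 1 / 2] (EFin \o (fun x => g x * cos (c * x))).
  apply: (@bounded_itv_integrable _ _ _ 0 (1/2) M) => //; first exact: measurable_funTS.
  by move=> x /=; rewrite in_itv/= => /andP[x0 xa]; apply: bcos; rewrite ger0_norm.
have half (c : R) : \int[mu]_(x in `[- (1 / 2), 1 / 2]) (g x * cos (c * x)) =
    2 * \int[mu]_(x in `[0, 1 / 2]) (g x * cos (c * x)).
  rewrite (Rintegral_symmetric half0 (mcos c) (@bcos c)) -RintegralZl//.
  by apply: eq_Rintegral => x _; rewrite gN mulrN cosN; ring.
rewrite !half normrM ger0_norm// ler_pM2l// ler_norml.
pose mR : R := m%:~R.
have mR0 : mR != 0 by rewrite intr_eq0.
(* [s] stands for a sign, and the two signs give the two halves of the absolute value bound. The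
   primitive of cos (2 pi x) + s cos (2 pi m x) vanishes at 0 and 1/2; it is nonnegative in between
   because |sin (m y)| <= |m| sin y on [0, pi]. *)
have key (s : R) : s ^+ 2 = 1 ->
    0 <= \int[mu]_(x in `[0, 1 / 2]) (g x * (cos (2 * pi * x) + s * cos (2 * pi * mR * x))).
  move=> s1.
  apply: (@noninc_weighted_ge0 _ g _
    (fun x => (2 * pi)^-1 * sin (2 * pi * x) + s * (2 * pi * mR)^-1 * sin (2 * pi * mR * x))
    _ (1 + `|s|)) => //.
  - move=> x; have dcos (c : R) := is_derive_compf (is_derive_cos (c * x)) (is_derive_mull c
      x).
    exact: is_derive_continuous (is_derive_addf (dcos _) (is_derive_scalef s (dcos _))).
  - move=> x; rewrite (le_trans (ler_normD _ _))// normrM lerD ?ler_piMr//; exact: cos_max.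
  - move=> x; have := is_derive_addf (is_derive_scalef (2 * pi)^-1 (is_derive_sin_mul (2 * pi)
      x))
      (is_derive_scalef (s * (2 * pi * mR)^-1) (is_derive_sin_mul (2 * pi * mR) x)).
    have pi0 := lt0r_neq0 (pi_gt0 R).
    move=> h; apply: (is_derive_eq h); rewrite -/mR.
    move: (cos (_ * x)) (cos (_ * x)) => u v.
    by move: (pi : R) pi0 => p p0; field; rewrite mR0 p0.
  - move=> x /andP[x0 x1].
    have sx : 0 <= sin (2 * pi * x) by apply: sin_ge0_pi; rewrite ?mulr_ge0 ?pi_ge0//=;
      have := pi_ge0 R; nra.
    have s1' : `|s| = 1 by apply/eqP; rewrite -sqrp_eq1// -normrX s1 normr1.
    have : `|s * (2 * pi * mR)^-1 * sin (2 * pi * mR * x)| <= (2 * pi)^-1 * sin (2 * pi * x).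
      have : `|sin (2 * pi * mR * x)| <= `|mR| * sin (2 * pi * x).
        rewrite -[in leRHS](ger0_norm sx) mulrAC mulrC /mR.
        case: (m) => n; first by rewrite normr_nat; exact: normr_sin_natmul.
        by rewrite NegzE mulrNz mulNr sinN !normrN normr_nat; exact: normr_sin_natmul.
      rewrite !normrM s1' mul1r normfV !normrM !(@ger0_norm _ 2)// (ger0_norm (pi_ge0 R)).
      rewrite (invfM (2 * pi)) => sinm.
      rewrite -[leLHS]mulrA ler_pM2l ?invr_gt0 ?mulr_gt0 ?pi_gt0//.
      by rewrite ler_pdivrMl// normr_gt0.
    by rewrite ler_norml => /andP[+ _]; lra.
  - by rewrite !mulr0 sin0 !mulr0 addr0.
  - have := sin_2pi_int 1; rewrite mulr1 mulrA mulr1 => ->.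
    by have := sin_2pi_int m; rewrite [_ * (1/2)]mulrA mulr1 => ->; rewrite !mulr0 addr0.
have expand (s : R) : \int[mu]_(x in `[0, 1 / 2]) (g x * (cos (2 * pi * x) + s * cos (2 * pi *
  mR * x))) =
   \int[mu]_(x in `[0, 1 / 2]) (g x * cos (2 * pi * x)) +
   s * \int[mu]_(x in `[0, 1 / 2]) (g x * cos (2 * pi * mR * x)).
  rewrite -RintegralZl// -RintegralD//.
    by apply: eq_Rintegral => x _; ring.
  have := @integrableZl _ _ _ mu `[0, 1/2] (measurable_itv _) s _ (icos (2 * pi * mR)).
  by apply: eq_integrable.
have := key (-1); have := key 1; rewrite !expand expr1n sqrrN expr1n => /(_ erefl) + /(_
  erefl).
move: (\int[mu]_(x in `[0, 1 / 2]) (g x * cos (2 * pi * x))) => I.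
move: (\int[mu]_(x in `[0, 1 / 2]) (g x * cos (2 * pi * mR * x))) => J H1 H2.
by apply/andP; split; lra.
Qed.

End cosine_modes.

(** * Fubini for bounded functions on rectangles of finite measure *)

Section bounded_Fubini.
Context d1 d2 (T1 : measurableType d1) (T2 : measurableType d2) (R : realType).
Variables (m1 : {sigma_finite_measure set T1 -> \bar R})
          (m2 : {sigma_finite_measure set T2 -> \bar R}).

(** The function is extended by zero from the rectangle to the whole product. Boundedness and finite
    measure make every inner integral finite, so [fine] loses nothing and the iterated integrals may
    be written with real values. *)
Lemma bounded_Fubini (A : set T1) (B : set T2) (F : T1 * T2 -> R) (M : R) :
  measurable A -> measurable B -> (m1 A < +oo)%E -> (m2 B < +oo)%E ->
  measurable_fun setT F -> (forall z, `|F z| <= M) ->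
  [/\ m1.-integrable A (EFin \o (fun x => \int[m2]_(y in B) F (x, y))),
      m2.-integrable B (EFin \o (fun y => \int[m1]_(x in A) F (x, y))),
      \int[(m1 \x m2)%E]_(z in A `*` B) F z =
        \int[m1]_(x in A) \int[m2]_(y in B) F (x, y) &
      \int[(m1 \x m2)%E]_(z in A `*` B) F z =
        \int[m2]_(y in B) \int[m1]_(x in A) F (x, y)].
Proof.
move=> mA mB A_fin B_fin mF FM.
have mAB : measurable (A `*` B) by exact: measurableX.
have mFx x : measurable_fun setT (fun y => F (x, y)) by exact: measurableT_comp.
have mFy y : measurable_fun setT (fun x => F (x, y)) by exact: measurableT_comp.
have ix x : m2.-integrable B (EFin \o (fun y => F (x, y))).
  apply: measurable_bounded_integrable => //; first exact: measurable_funTS.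
  exists M; split; first exact: num_real.
  by move=> r Mr y _; apply: (le_trans (FM _)); exact: ltW.
have iy y : m1.-integrable A (EFin \o (fun x => F (x, y))).
  apply: measurable_bounded_integrable => //; first exact: measurable_funTS.
  exists M; split; first exact: num_real.
  by move=> r Mr x _; apply: (le_trans (FM _)); exact: ltW.
have iF : (m1 \x m2)%E.-integrable (A `*` B) (EFin \o F).
  apply: measurable_bounded_integrable => //.
  - rewrite [X in (X < _)%E]product_measure1E//.
    by rewrite lte_mul_pinfty// ge0_fin_numE.
  - exact: measurable_funTS.
  exists M; split; first exact: num_real.
  by move=> r Mr z _; apply: (le_trans (FM _)); exact: ltW.
have iFT : (m1 \x m2)%E.-integrable setT ((EFin \o F) \_ (A `*` B)).
  exact: (integrable_mkcond _ mAB).1 iF.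
have iG : m2.-integrable setT (fubini_G m1 ((EFin \o F) \_ (A `*` B))).
  apply/integrableP; split; first exact: (measurable_fubini_G iFT).
  have mFT := measurable_int _ iFT.
  apply: le_lt_trans ((integrable21ltyP _ _ mFT).1 iFT); apply: ge0_le_integral => //.
  - by apply: measurableT_comp => //; exact: (measurable_fubini_G iFT).
  - apply: (measurable_fun_fubini_tonelli_G (abse \o _)) => //=; exact: measurableT_comp.
  - move=> y _; apply: le_abse_integral => //; apply: (measurableT_comp mFT).
    exact: pair2_measurable.
have FE : fubini_F m2 ((EFin \o F) \_ (A `*` B)) =
    (EFin \o (fun x => \int[m2]_(y in B) F (x, y))) \_ A.
  apply/funext => x; rewrite /fubini_F [RHS]patchE; case: ifPn => xA.
    rewrite /= fineK; last by apply: integrable_fin_num => //; exact: ix.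
    rewrite [RHS]integral_mkcond; apply: eq_integral => y _; rewrite !patchE.
    by rewrite in_setX/= xA.
  by apply: integral0_eq => y _; rewrite patchE in_setX/= (negbTE xA).
have GE : fubini_G m1 ((EFin \o F) \_ (A `*` B)) =
    (EFin \o (fun y => \int[m1]_(x in A) F (x, y))) \_ B.
  apply/funext => y; rewrite /fubini_G [RHS]patchE; case: ifPn => yB.
    rewrite /= fineK; last by apply: integrable_fin_num => //; exact: iy.
    rewrite [RHS]integral_mkcond; apply: eq_integral => x _; rewrite !patchE.
    by rewrite in_setX/= yB andbT.
  by apply: integral0_eq => x _; rewrite patchE in_setX/= (negbTE yB) andbF.
split.
- by apply/(integrable_mkcond _ _).2 => //; rewrite -FE; exact: integrable_fubini_F.
- by apply/(integrable_mkcond _ _).2 => //; rewrite -GE.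
- rewrite {1}/Rintegral integral_mkcond -integral12_prod_meas1//.
  by rewrite [X in (\int[_]_x X x)%E]FE -integral_mkcond.
- rewrite {1}/Rintegral integral_mkcond -integral21_prod_meas1//.
  by rewrite [X in (\int[_]_x X x)%E]GE -integral_mkcond.
Qed.

End bounded_Fubini.

(** * The cube as a product, and integration over it one coordinate at a time *)

Section cube.
Variable R : realType.
Notation mu := (@lebesgue_measure R).
Notation half := (`[- (1 / 2), 1 / 2]%classic : set (measurableTypeR R)).
Local Notation nd := (@lebesgue_nd R).

Lemma preimage_Omega d : @tuple_cons R d @^-1` @Omega R d.+1 = half `*` @Omega R d.
Proof.
apply/seteqP; split => -[x t] /=.
  move=> H; split; first by have := H ord0; rewrite tnth0/= in_itv/= -ler_norml.
  by move=> i; have := H (lift ord0 i); rewrite tnthS.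
move=> [/= + H]; rewrite in_itv/= -ler_norml => Hx i.
by case: (unliftP ord0 i) => [j ->|->]; rewrite ?tnthS ?tnth0//; exact: H.
Qed.

Lemma measurable_Omega d : measurable (@Omega R d).
Proof.
rewrite (_ : @Omega R d = \bigcap_(i in [set: 'I_d]) [set x | `|tnth x i| <= 1 / 2]);
  last first.
  by apply/seteqP; split=> x /= H i; [move=> _|]; exact: H.
apply: fin_bigcap_measurable => // i _.
rewrite (_ : [set _ | _] = (fun x : d.-tuple R => tnth x i) @^-1` half); last first.
  by apply/seteqP; split => x /=; rewrite in_itv/= ler_norml.
by rewrite -[X in measurable X]setTI; apply: measurable_tnth.
Qed.

Lemma lebesgue_half : mu half = 1%E.
Proof.
have := @lebesgue_measure_itv R `[- (1 / 2), 1 / 2].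
by rewrite /= lte_fin ifT -?EFinB => [->|]; [congr EFin|]; lra.
Qed.

Lemma lebesgue_nd_Omega d : nd d (@Omega R d) = 1%E.
Proof.
elim: d => [|d IH].
  by rewrite /= diracE mem_set// => -[].
rewrite /= /lebesgue_step /pushforward preimage_Omega product_measure1E//;
  last exact: measurable_Omega.
by rewrite [X in (_ * X)%E]IH mule1; exact: lebesgue_half.
Qed.

Lemma bounded_Omega_integrable d (f : d.-tuple R -> R) (M : R) :
  measurable_fun setT f -> (forall x, Omega x -> `|f x| <= M) ->
  (nd d).-integrable (@Omega R d) (EFin \o f).
Proof.
move=> mf fM; apply: measurable_bounded_integrable.
- exact: measurable_Omega.
- by rewrite [X in (X < _)%E]lebesgue_nd_Omega ltry.
- exact: measurable_funTS.
exists M; split; first exact: num_real.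
by move=> r Mr x ix; apply: (le_trans (fM _ ix)); exact: ltW.
Qed.

Lemma Rintegral_Omega_cons d (f : d.+1.-tuple R -> R) (M : R) :
  measurable_fun setT f -> (forall x, `|f x| <= M) ->
  [/\ mu.-integrable half (EFin \o
        (fun x => \int[nd d]_(y in @Omega R d) f (tuple_cons (x, y)))),
      (nd d).-integrable (@Omega R d) (EFin \o
        (fun y => \int[mu]_(x in half) f (tuple_cons (x, y)))),
      \int[nd d.+1]_(x in @Omega R d.+1) f x =
        \int[mu]_(x in half) \int[nd d]_(y in @Omega R d) f (tuple_cons (x, y)) &
      \int[nd d.+1]_(x in @Omega R d.+1) f x =
        \int[nd d]_(y in @Omega R d) \int[mu]_(x in half) f (tuple_cons (x, y))].
Proof.
move=> mf fM; have mO := @measurable_Omega d.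
have mF : measurable_fun setT (f \o @tuple_cons R d).
  by apply: measurableT_comp => //; exact: measurable_tuple_cons.
have fin1 : (mu half < +oo)%E by rewrite [X in (X < _)%E]lebesgue_half ltry.
have fin2 : (nd d (@Omega R d) < +oo)%E by rewrite [X in (X < _)%E]lebesgue_nd_Omega ltry.
have mh : measurable half by [].
have [iF iG intF intG] := bounded_Fubini (m1 := mu) (m2 := nd d) mh mO fin1 fin2 mF (fun z =>
  fM _).
have intE : \int[nd d.+1]_(x in @Omega R d.+1) f x =
    \int[(mu \x nd d)%E]_(z in half `*` @Omega R d) (f \o @tuple_cons R d) z.
  rewrite /Rintegral -preimage_Omega; congr fine.
  apply: (@integral_pushforward _ _ _ _ R _ (@measurable_tuple_cons R d) (mu \x nd d)%E _
    (EFin \o f)).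
  - exact/measurable_EFinP.
  - rewrite preimage_Omega; apply: measurable_bounded_integrable => //.
    + exact: measurableX.
    + rewrite [X in (X < _)%E]product_measure1E//.
      by rewrite lte_mul_pinfty// ge0_fin_numE.
    + exact: measurable_funTS.
    exists M; split; first exact: num_real.
    by move=> r Mr z _; apply: (le_trans (fM _)); exact: ltW.
  - exact: measurable_Omega.
by split=> //; rewrite intE.
Qed.

Lemma Rintegral_odd (h : R -> R) (a M : R) : 0 <= a ->
  measurable_fun `[- a, a] h -> (forall x, `|x| <= a -> `|h x| <= M) ->
  (forall x, h (- x) = - h x) -> \int[mu]_(x in `[- a, a]) h x = 0.
Proof.
(* [Rintegral_symmetric] asks for measurability on the whole line, so [h] is cut off outside the
   interval. *)
move=> a0 mh hM hN; pose h' := h \_ `[- a, a].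
have h'E x : `|x| <= a -> h' x = h x.
  by move=> xa; rewrite /h' patchE mem_set//= in_itv/= -ler_norml.
have -> : \int[mu]_(x in `[- a, a]) h x = \int[mu]_(x in `[- a, a]) h' x.
  apply: eq_Rintegral => x; rewrite inE/= in_itv/= -ler_norml => xa.
  by rewrite h'E.
rewrite (@Rintegral_symmetric _ _ _ M)//.
- rewrite (_ : \int[mu]_(x in _) _ = \int[mu]_(x in `[0, a]) 0).
    by rewrite Rintegral_cst// mul0r.
  apply: eq_Rintegral => x; rewrite inE/= in_itv/= => /andP[x0 xa].
  by rewrite !h'E ?normrN ?ger0_norm// hN subrr.
- exact/(measurable_restrictT _ _).1.
- by move=> x xa; rewrite h'E//; exact: hM.
Qed.

End cube.

(** * Fourier modes of radially nonincreasing profiles on the cube *)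

Section radial_modes.
Variable R : realType.
Notation mu := (@lebesgue_measure R).
Notation half := (`[- (1 / 2), 1 / 2]%classic : set (measurableTypeR R)).
Local Notation nd := (@lebesgue_nd R).

(** The profile is evaluated at the squared norm [dotp x x]. Fixing one coordinate x replaces [w] by
    [fun s => w (x * x + s)], again in this class with the same bound: this stability drives all
    inductions on the dimension. *)
Definition bounded_noninc (M : R) (w : R -> R) :=
  (forall x y, x <= y -> w y <= w x) /\ (forall x, `|w x| <= M).

Definition row_tail d (n : 'rV[int]_d.+1) : 'rV[int]_d := \row_j n 0 (lift ord0 j).

Definition radial_cos d (w : R -> R) (n : 'rV[int]_d) : R :=
  \int[nd d]_(x in @Omega R d) (w (dotp x x) * cos (dotp (wave_vector n) x)).

Definition radial_sin d (w : R -> R) (n : 'rV[int]_d) : R :=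
  \int[nd d]_(x in @Omega R d) (w (dotp x x) * sin (dotp (wave_vector n) x)).

Lemma dotp_cons d (v : d.+1.-tuple R) x (y : d.-tuple R) :
  dotp v (tuple_cons (x, y)) = thead v * x + dotp [tuple of behead v] y.
Proof.
rewrite /dotp big_ord_recl tnth0 /=; congr (_ + _).
by apply: eq_bigr => i _; rewrite tnthS tnth_behead; congr (tnth v _ * _); apply/val_inj;
  rewrite /= inordK//= ltnS.
Qed.

Lemma dotp_consxx d x (y : d.-tuple R) :
  dotp (tuple_cons (x, y)) (tuple_cons (x, y)) = x * x + dotp y y.
Proof.
rewrite dotp_cons /= theadE; congr (_ + dotp _ _); exact/val_inj.
Qed.

Lemma dotp_wave_cons d (n : 'rV[int]_d.+1) x (y : d.-tuple R) :
  dotp (wave_vector n) (tuple_cons (x, y)) =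
  2 * pi * (n 0 ord0)%:~R * x + dotp (wave_vector (row_tail n)) y.
Proof.
rewrite dotp_cons /thead tnth_mktuple; congr (_ + dotp _ _).
by apply: eq_from_tnth => i; rewrite tnth_behead !tnth_mktuple mxE; congr (_ * (n 0 _)%:~R);
  apply/val_inj; rewrite /= inordK//= ltnS.
Qed.

Lemma measurable_dotp d (v : d.-tuple R) : measurable_fun setT (dotp v).
Proof.
apply: measurable_sum => i; apply: measurable_funM => //; exact: measurable_tnth.
Qed.

Lemma measurable_dotpxx d : measurable_fun setT (fun x : d.-tuple R => dotp x x).
Proof.
by apply: measurable_sum => i; apply: measurable_funM; exact: measurable_tnth.
Qed.

Lemma bounded_noninc_shift M w c : bounded_noninc M w ->
  bounded_noninc M (fun s => w (c + s)).
Proof. by move=> [wni wM]; split=> // x y xy; apply: wni; rewrite lerD2l. Qed.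

Lemma measurable_noninc M w : bounded_noninc M w -> measurable_fun setT w.
Proof. by move=> [wni _]; apply: nonincreasing_measurable => // x y _ _; exact: wni. Qed.

Lemma measurable_radial d M w : bounded_noninc M w ->
  measurable_fun setT (fun x : d.-tuple R => w (dotp x x)).
Proof.
by move=> /measurable_noninc mw; apply: measurableT_comp => //; exact: measurable_dotpxx.
Qed.

Lemma norm_mul_cos_le (a b M : R) : `|a| <= M -> `|a * cos b| <= M.
Proof.
by move=> aM; rewrite normrM (le_trans _ aM)// ler_piMr//; exact: cos_max.
Qed.

Lemma norm_mul_sin_le (a b M : R) : `|a| <= M -> `|a * sin b| <= M.
Proof.
by move=> aM; rewrite normrM (le_trans _ aM)// ler_piMr//; exact: sin_max.
Qed.

Section bounded_noninc.
Variables (M : R).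

Lemma measurable_radial_cos d w (n : 'rV[int]_d) : bounded_noninc M w ->
  measurable_fun setT (fun x : d.-tuple R => w (dotp x x) * cos (dotp (wave_vector n) x)).
Proof.
move=> bw; apply: measurable_funM; first exact: measurable_radial bw.
by apply: measurable_cos_comp; exact: measurable_dotp.
Qed.

Lemma measurable_radial_sin d w (n : 'rV[int]_d) : bounded_noninc M w ->
  measurable_fun setT (fun x : d.-tuple R => w (dotp x x) * sin (dotp (wave_vector n) x)).
Proof.
move=> bw; apply: measurable_funM; first exact: measurable_radial bw.
by apply: measurable_sin_comp; exact: measurable_dotp.
Qed.

Lemma integrable_radial_cos d w (n : 'rV[int]_d) : bounded_noninc M w ->
  (nd d).-integrable (@Omega R d)
    (EFin \o (fun x => w (dotp x x) * cos (dotp (wave_vector n) x))).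
Proof.
move=> bw; apply: (bounded_Omega_integrable (M := M)); first exact: measurable_radial_cos.
by move=> x _; apply: norm_mul_cos_le; exact: bw.2.
Qed.

Lemma integrable_radial_sin d w (n : 'rV[int]_d) : bounded_noninc M w ->
  (nd d).-integrable (@Omega R d)
    (EFin \o (fun x => w (dotp x x) * sin (dotp (wave_vector n) x))).
Proof.
move=> bw; apply: (bounded_Omega_integrable (M := M)); first exact: measurable_radial_sin.
by move=> x _; apply: norm_mul_sin_le; exact: bw.2.
Qed.

Lemma norm_radial_cos d w (n : 'rV[int]_d) : bounded_noninc M w ->
  `|radial_cos w n| <= M.
Proof.
move=> bw; have mO := @measurable_Omega R d.
apply: (le_trans (le_normr_Rintegral mO (integrable_radial_cos n bw))).
apply: (@le_trans _ _ (\int[nd d]_(x in @Omega R d) M)).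
  apply: le_Rintegral => //.
  - by have /= := integrable_norm (integrable_radial_cos n bw).
  - apply: (bounded_Omega_integrable (M := M)) => // x _.
    by rewrite ger0_norm// (le_trans _ (bw.2 0)).
  - by move=> x _; apply: norm_mul_cos_le; exact: bw.2.
by rewrite Rintegral_cst// [X in fine X]lebesgue_nd_Omega mulr1.
Qed.

Lemma inner_cos d w (n : 'rV[int]_d) (a : R) x : bounded_noninc M w ->
  \int[nd d]_(y in @Omega R d) (w (x * x + dotp y y) * cos (a + dotp (wave_vector n) y)) =
  cos a * radial_cos (fun s => w (x * x + s)) n
  - sin a * radial_sin (fun s => w (x * x + s)) n.
Proof.
move=> /(@bounded_noninc_shift _ _ (x * x)) bw; have mO := @measurable_Omega R d.
have ic := integrable_radial_cos n bw; have isn := integrable_radial_sin n bw.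
rewrite /radial_cos /radial_sin -!RintegralZl// -RintegralB//.
- by apply: eq_Rintegral => y _; rewrite cosD; ring.
- have := @integrableZl _ _ _ (nd d) _ mO (cos a) _ ic; exact: eq_integrable.
- have := @integrableZl _ _ _ (nd d) _ mO (sin a) _ isn; exact: eq_integrable.
Qed.

Lemma inner_sin d w (n : 'rV[int]_d) (a : R) x : bounded_noninc M w ->
  \int[nd d]_(y in @Omega R d) (w (x * x + dotp y y) * sin (a + dotp (wave_vector n) y)) =
  sin a * radial_cos (fun s => w (x * x + s)) n
  + cos a * radial_sin (fun s => w (x * x + s)) n.
Proof.
move=> /(@bounded_noninc_shift _ _ (x * x)) bw; have mO := @measurable_Omega R d.
have ic := integrable_radial_cos n bw; have isn := integrable_radial_sin n bw.
rewrite /radial_cos /radial_sin -!RintegralZl// -RintegralD//.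
- by apply: eq_Rintegral => y _; rewrite sinD; ring.
- have := @integrableZl _ _ _ (nd d) _ mO (sin a) _ ic; exact: eq_integrable.
- have := @integrableZl _ _ _ (nd d) _ mO (cos a) _ isn; exact: eq_integrable.
Qed.

(** By induction the inner sine integral vanishes. What remains is sin (2 pi n_0 x) times an even
    function of x, which is odd on a symmetric interval. *)
Lemma radial_sin_eq0 d w (n : 'rV[int]_d) : bounded_noninc M w -> radial_sin w n = 0.
Proof.
elim: d w n => [|d IH] w n bw.
  rewrite /radial_sin (_ : (fun x => _) = fun=> 0).
    rewrite Rintegral_cst ?mul0r//; exact: measurable_Omega.
  by apply/funext => x; rewrite [dotp (wave_vector n) x]big_ord0 sin0 mulr0.
have [i1 _ + _] := Rintegral_Omega_cons (measurable_radial_sin n bw)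
  (fun x => norm_mul_sin_le _ (bw.2 _)).
rewrite /radial_sin => ->.
have E x : \int[nd d]_(y in @Omega R d) (w (dotp (tuple_cons (x, y)) (tuple_cons (x, y))) *
    sin (dotp (wave_vector n) (tuple_cons (x, y)))) =
    sin (2 * pi * (n 0 ord0)%:~R * x) * radial_cos (fun s => w (x * x + s)) (row_tail n).
  rewrite -[RHS]addr0 -[in X in _ + X](mulr0 (cos (2 * pi * (n 0 ord0)%:~R * x))).
  rewrite -(IH (fun s => w (x * x + s)) (row_tail n)); last exact: bounded_noninc_shift.
  rewrite -inner_sin//; apply: eq_Rintegral => y _.
  by rewrite dotp_consxx dotp_wave_cons.
apply: (@Rintegral_odd _ _ _ M); first by [].
- by have := measurable_int _ i1 => /measurable_EFinP.
- move=> x _; rewrite E normrM mulrC -normrM; apply: norm_mul_sin_le; apply: norm_radial_cos.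
  exact: bounded_noninc_shift.
- by move=> x; rewrite !E mulrN sinN mulrNN mulNr.
Qed.

Lemma radial_cos_cons d w (n : 'rV[int]_d.+1) : bounded_noninc M w ->
  let J x := cos (2 * pi * (n 0 ord0)%:~R * x) * radial_cos (fun s => w (x * x + s)) (row_tail
    n) in
  mu.-integrable half (EFin \o J) /\ radial_cos w n = \int[mu]_(x in half) J x.
Proof.
move=> bw J.
have [i1 _ + _] := Rintegral_Omega_cons (measurable_radial_cos n bw)
  (fun x => norm_mul_cos_le _ (bw.2 _)).
have E x : \int[nd d]_(y in @Omega R d) (w (dotp (tuple_cons (x, y)) (tuple_cons (x, y))) *
    cos (dotp (wave_vector n) (tuple_cons (x, y)))) = J x.
  rewrite /J -[RHS]subr0 -[in X in _ - X](mulr0 (sin (2 * pi * (n 0 ord0)%:~R * x))).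
  rewrite -(@radial_sin_eq0 _ (fun s => w (x * x + s)) (row_tail n));
    last exact: bounded_noninc_shift.
  rewrite -inner_cos//; apply: eq_Rintegral => y _.
  by rewrite dotp_consxx dotp_wave_cons.
rewrite /radial_cos => ->; split; last by apply: eq_Rintegral => x _; rewrite E.
by apply: eq_integrable i1 => // x _ /=; rewrite E.
Qed.

Definition slice_cos (w : R -> R) (m : int) (r : R) : R :=
  \int[mu]_(x in half) (w (x * x + r) * cos (2 * pi * m%:~R * x)).

Lemma slice_cosE w m (a r : R) : bounded_noninc M w ->
  \int[mu]_(x in half) (w (x * x + r) * cos (2 * pi * m%:~R * x + a)) =
  cos a * slice_cos w m r.
Proof.
move=> bw.
have mw : measurable_fun setT (fun x : R => w (x * x + r)).
  apply: measurableT_comp; first exact: measurable_noninc bw.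
  by apply: measurable_funD => //; exact: measurable_funM.
have ic : mu.-integrable half (EFin \o (fun x => w (x * x + r) * cos (2 * pi * m%:~R * x))).
  apply: (@bounded_itv_integrable _ _ _ (- (1 / 2)) (1 / 2) M) => //.
    apply: measurable_funTS; apply: measurable_funM => //.
    by apply: measurable_cos_comp; exact: mulrl_measurable.
  by move=> x _; apply: norm_mul_cos_le; exact: bw.2.
have isn : mu.-integrable half (EFin \o (fun x => w (x * x + r) * sin (2 * pi * m%:~R * x))).
  apply: (@bounded_itv_integrable _ _ _ (- (1 / 2)) (1 / 2) M) => //.
    apply: measurable_funTS; apply: measurable_funM => //.
    by apply: measurable_sin_comp; exact: mulrl_measurable.
  by move=> x _; apply: norm_mul_sin_le; exact: bw.2.
have odd0 : \int[mu]_(x in half) (w (x * x + r) * sin (2 * pi * m%:~R * x)) = 0.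
  apply: (@Rintegral_odd _ _ _ M) => //.
  - by have := measurable_int _ isn => /measurable_EFinP.
  - by move=> x _; apply: norm_mul_sin_le; exact: bw.2.
  - by move=> x; rewrite mulrNN mulrN sinN mulrN.
have mh : measurable half by [].
rewrite -[RHS]subr0 -[in X in _ - X](mulr0 (sin a)) -odd0 -!RintegralZl// -RintegralB//.
- by apply: eq_Rintegral => x _; rewrite cosD; ring.
- have := @integrableZl _ _ _ mu _ mh (cos a) _ ic; exact: eq_integrable.
- have := @integrableZl _ _ _ mu _ mh (sin a) _ isn; exact: eq_integrable.
Qed.

(** Here the first coordinate is integrated innermost, in [radial_cos_cons] outermost. This order
    serves when the first frequency is nonzero, since the comparison then takes place inside the
    slice; the other order serves the induction when that frequency is zero. *)
Lemma radial_cos_slice d w (n : 'rV[int]_d.+1) : bounded_noninc M w ->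
  let J y := cos (dotp (wave_vector (row_tail n)) y) * slice_cos w (n 0 ord0) (dotp y y) in
  (nd d).-integrable (@Omega R d) (EFin \o J) /\
  radial_cos w n = \int[nd d]_(y in @Omega R d) J y.
Proof.
move=> bw J.
have [_ i2 _ +] := Rintegral_Omega_cons (measurable_radial_cos n bw)
  (fun x => norm_mul_cos_le _ (bw.2 _)).
have E y : \int[mu]_(x in half) (w (dotp (tuple_cons (x, y)) (tuple_cons (x, y))) *
    cos (dotp (wave_vector n) (tuple_cons (x, y)))) = J y.
  rewrite /J -slice_cosE//; apply: eq_Rintegral => x _.
  by rewrite dotp_consxx dotp_wave_cons.
rewrite /radial_cos => ->; split; last by apply: eq_Rintegral => y _; rewrite E.
by apply: eq_integrable i2 => //; [exact: measurable_Omega|move=> y _ /=; rewrite E].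
Qed.

Lemma slice_cos_le w m (u : int) r : bounded_noninc M w -> m != 0 -> u ^+ 2 = 1 ->
  `|slice_cos w m r| <= slice_cos w u r.
Proof.
move=> bw m0 u1.
have -> : slice_cos w u r = \int[mu]_(x in half) (w (x * x + r) * cos (2 * pi * x)).
  apply: eq_Rintegral => x _; congr (_ * _).
  move/eqP: u1; rewrite sqrf_eq1 => /orP[]/eqP ->; first by rewrite mulr1.
  by rewrite mulrN1 mulNr cosN.
apply: (@cos_mode_le _ (fun x => w (x * x + r)) _ M) => //.
- apply: measurableT_comp; first exact: measurable_noninc bw.
  by apply: measurable_funD => //; exact: measurable_funM.
- by move=> x; rewrite mulrNN.
- by move=> x y x0 xy; apply: bw.1; rewrite lerD2r; apply: ler_pM.
- by move=> x _; exact: bw.2.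
Qed.

End bounded_noninc.

Definition unit_mode d (e : 'rV[int]_d) := \sum_i (e 0 i) ^+ 2 = 1.

(** A nonzero integer has square at least 1, so a nonzero first entry exhausts the sum of
    squares. *)
Lemma unit_mode_cons d (e : 'rV[int]_d.+1) : unit_mode e ->
  (e 0 ord0) ^+ 2 = 1 /\ row_tail e = 0 \/ e 0 ord0 = 0 /\ unit_mode (row_tail e).
Proof.
rewrite /unit_mode big_ord_recl => e1.
have tail_ge0 : 0 <= \sum_(i < d) (e 0 (lift ord0 i)) ^+ 2.
  by apply: sumr_ge0 => i _; exact: sqr_ge0.
have [e0|e0] := eqVneq (e 0 ord0) 0.
  right; split=> //; move: e1; rewrite e0 expr0n add0r => <-.
  by apply: eq_bigr => i _; rewrite mxE.
left; have h1 : 1 <= (e 0 ord0) ^+ 2 by rewrite -gtz0_ge1 lt_neqAle sqr_ge0 eq_sym sqrf_eq0 e0.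
have tail0 : \sum_(i < d) (e 0 (lift ord0 i)) ^+ 2 = 0.
  apply/eqP; rewrite eq_le tail_ge0 andbT; move: h1; rewrite -e1 gerDl; exact.
split; first by rewrite -e1 tail0 addr0.
apply/rowP => i; rewrite !mxE; move/eqP: tail0.
rewrite psumr_eq0; last by move=> j _; exact: sqr_ge0.
by move=> /allP /(_ i); rewrite mem_index_enum sqrf_eq0 => /(_ isT) /eqP.
Qed.

Lemma cos_unit (u : int) (x : R) : u ^+ 2 = 1 -> cos (2 * pi * u%:~R * x) = cos (2 * pi * x).
Proof.
move/eqP; rewrite sqrf_eq1 => /orP[]/eqP ->; first by rewrite mulr1.
by rewrite mulrN1 mulNr cosN.
Qed.

Lemma dotp_wave0 d (x : d.-tuple R) : dotp (wave_vector 0) x = 0.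
Proof. by rewrite /dotp big1// => i _; rewrite tnth_mktuple mxE mulr0 mul0r. Qed.

Section radial_cos_compare.
Variable M : R.

Lemma radial_cos0_noninc d w r s : bounded_noninc M w -> r <= s ->
  radial_cos (fun t => w (s + t)) (0 : 'rV[int]_d) <=
  radial_cos (fun t => w (r + t)) (0 : 'rV[int]_d).
Proof.
move=> bw rs; apply: le_Rintegral; first exact: measurable_Omega.
- exact: (integrable_radial_cos 0 (bounded_noninc_shift s bw)).
- exact: (integrable_radial_cos 0 (bounded_noninc_shift r bw)).
- by move=> x _; rewrite dotp_wave0 cos0 !mulr1; apply: bw.1; rewrite lerD2r.
Qed.

(** Integrating out all but two coordinates leaves [H (x * x + y * y)], symmetric in x and y. Fubini
    then exchanges the roles of the two axes. *)
Lemma radial_cos_swap d w (e f : 'rV[int]_d.+2) : bounded_noninc M w ->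
  (e 0 ord0) ^+ 2 = 1 -> row_tail e = 0 ->
  f 0 ord0 = 0 -> (row_tail f 0 ord0) ^+ 2 = 1 -> row_tail (row_tail f) = 0 ->
  radial_cos w e = radial_cos w f.
Proof.
move=> bw e1 e0 f0 f1 ftt0.
pose H r := radial_cos (fun t => w (r + t)) (0 : 'rV[int]_d).
have bH : bounded_noninc M H.
  split=> [x y xy|x]; first exact: radial_cos0_noninc.
  exact: (norm_radial_cos 0 (bounded_noninc_shift x bw)).
have inner x (n : 'rV[int]_d.+1) : row_tail n = 0 ->
    radial_cos (fun s => w (x * x + s)) n =
    \int[mu]_(y in half) (cos (2 * pi * (n 0 ord0)%:~R * y) * H (x * x + y * y)).
  move=> n0; rewrite (radial_cos_cons n (bounded_noninc_shift (x * x) bw)).2 n0.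
  apply: eq_Rintegral => y _; congr (_ * radial_cos _ _); apply/funext => t.
  by rewrite addrA.
rewrite !(radial_cos_cons _ bw).2 e0 f0.
have mh : measurable half by [].
have hfin : (mu half < +oo)%E by rewrite [X in (X < _)%E]lebesgue_half ltry.
have mF : measurable_fun setT (fun z : measurableTypeR R * measurableTypeR R =>
    H (z.1 * z.1 + z.2 * z.2) * cos (2 * pi * z.1) : R).
  apply: measurable_funM.
    apply: (measurableT_comp (measurable_noninc bH)).
    by apply: measurable_funD; apply: measurable_funM.
  by apply: measurable_cos_comp; apply: measurable_funM.
have [_ _ L1 L2] := bounded_Fubini (m1 := mu) (m2 := mu) mh mh hfin hfin mF
  (fun z => norm_mul_cos_le _ (bH.2 _)).
transitivity (\int[mu]_(x in half) \int[mu]_(y in half) (H (x * x + y * y) * cos (2 * pi *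
  x))).
  apply: eq_Rintegral => x _; rewrite inner; last by apply/rowP => i; rewrite !mxE.
  rewrite cos_unit// -RintegralZl//.
    by apply: eq_Rintegral => y _; rewrite mxE mulr0 mul0r cos0 mul1r mulrC.
  apply: (@bounded_itv_integrable _ _ _ (- (1/2)) (1/2) M) => //.
    apply: measurable_funTS; apply: measurable_funM.
      by apply: measurable_cos_comp; exact: mulrl_measurable.
    apply: (measurableT_comp (measurable_noninc bH)).
    by apply: measurable_funD => //; exact: measurable_funM.
  by move=> y _; rewrite mulrC; apply: norm_mul_cos_le; exact: bH.2.
rewrite -[LHS]L1 L2; apply: eq_Rintegral => x _.
rewrite mulr0 mul0r cos0 [RHS]mul1r inner//; apply: eq_Rintegral => y _.
by rewrite cos_unit// mulrC (addrC (x * x)).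
Qed.

Lemma radial_cos_unit d w (e f : 'rV[int]_d) : bounded_noninc M w ->
  unit_mode e -> unit_mode f -> radial_cos w e = radial_cos w f.
Proof.
elim: d w e f => [|d IH] w e f bw; first by rewrite /unit_mode big_ord0.
have first_first (a b : 'rV[int]_d.+1) : (a 0 ord0) ^+ 2 = 1 -> row_tail a = 0 ->
    (b 0 ord0) ^+ 2 = 1 -> row_tail b = 0 -> radial_cos w a = radial_cos w b.
  move=> a1 a0 b1 b0; rewrite !(radial_cos_cons _ bw).2 a0 b0.
  by apply: eq_Rintegral => x _; rewrite !cos_unit.
have first_tail (a b : 'rV[int]_d.+1) : (a 0 ord0) ^+ 2 = 1 -> row_tail a = 0 ->
    b 0 ord0 = 0 -> unit_mode (row_tail b) -> radial_cos w a = radial_cos w b.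
  move=> a1 a0 b0 bu; case: d IH a b a1 a0 b0 bu {e f first_first}.
    by move=> _ a b _ _ _; rewrite /unit_mode big_ord0.
  move=> d IH a b a1 a0 b0 bu.
  (* The mode along the second axis is the bridge: the swap carries [a] to [c], and the induction
     hypothesis carries [c] to [b] within the remaining coordinates. *)
  pose c : 'rV[int]_d.+2 := \row_i (i == lift ord0 ord0)%:R.
  have c0 : c 0 ord0 = 0 by rewrite mxE.
  have c1 : (row_tail c 0 ord0) ^+ 2 = 1 by rewrite !mxE eqxx.
  have ctt0 : row_tail (row_tail c) = 0 by apply/rowP => i; rewrite !mxE.
  have cu : unit_mode (row_tail c).
    rewrite /unit_mode big_ord_recl c1 big1 ?addr0// => i _.
    by have := congr1 (fun r : 'rV[int]_d => r 0 i) ctt0; rewrite mxE => ->;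
      rewrite mxE expr0n.
  rewrite (radial_cos_swap bw a1 a0 c0 c1 ctt0) !(radial_cos_cons _ bw).2 b0 c0.
  by apply: eq_Rintegral => x _; congr (_ * _); apply: IH => //; exact: bounded_noninc_shift.
move=> /unit_mode_cons[[e1 e0]|[e0 eu]] /unit_mode_cons[[f1 f0]|[f0 fu]].
- exact: first_first.
- exact: first_tail.
- exact/esym/first_tail.
- rewrite !(radial_cos_cons _ bw).2 e0 f0; apply: eq_Rintegral => x _; congr (_ * _).
  by apply: IH => //; exact: bounded_noninc_shift.
Qed.

Theorem radial_cos_le d w (n e : 'rV[int]_d) : bounded_noninc M w ->
  n != 0 -> unit_mode e -> `|radial_cos w n| <= radial_cos w e.
Proof.
elim: d w n e => [|d IH] w n e bw n0 eu.
  by move: eu; rewrite /unit_mode big_ord0.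
pose f : 'rV[int]_d.+1 := \row_i (i == ord0)%:R.
have f1 : (f 0 ord0) ^+ 2 = 1 by rewrite mxE eqxx.
have f0 : row_tail f = 0 by apply/rowP => i; rewrite !mxE.
have mO := @measurable_Omega R d.
(* For a nonzero first frequency the comparison mode is the first axis. The cosine in the other
   coordinates is bounded by 1, and the slices are compared pointwise. *)
have [m0|m0] := eqVneq (n 0 ord0) 0; last first.
  have fu : unit_mode f.
    rewrite /unit_mode big_ord_recl f1 big1 ?addr0// => i _.
    by have := congr1 (fun r : 'rV[int]_d => r 0 i) f0; rewrite mxE => ->; rewrite mxE expr0n.
  rewrite (radial_cos_unit bw eu fu).
  have [in_ ->] := radial_cos_slice n bw; have [if_ ->] := radial_cos_slice f bw.
  rewrite f0 in if_ *.
  apply: (le_trans (le_normr_Rintegral mO in_)); apply: le_Rintegral => //.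
    by have /= := integrable_norm in_.
  move=> y _; rewrite dotp_wave0 cos0 mul1r mulrC.
  by apply: norm_mul_cos_le; exact: (slice_cos_le _ bw m0 f1).
have nt0 : row_tail n != 0.
  apply: contra n0 => /eqP nt; apply/eqP/rowP => i; rewrite mxE.
  case: (unliftP ord0 i) => [j ->|->//].
  by have := congr1 (fun r : 'rV[int]_d => r 0 j) nt; rewrite !mxE.
case: d IH n e n0 eu f f1 f0 mO m0 nt0 => [|d] IH n e n0 eu f f1 f0 mO m0 nt0.
  by case/eqP: nt0; exact: thinmx0.
(* With first frequency 0, comparison with the second axis makes both modes constant in the first
   coordinate, so the induction hypothesis applies under the outer integral. *)
pose c : 'rV[int]_d.+2 := \row_i (i == lift ord0 ord0)%:R.
have c0 : c 0 ord0 = 0 by rewrite mxE.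
have ctu : unit_mode (row_tail c).
  rewrite /unit_mode big_ord_recl big1 => [|i _]; first by rewrite !mxE addr0.
  by rewrite !mxE.
have cu : unit_mode c.
  rewrite /unit_mode big_ord_recl c0 expr0n add0r -[RHS]ctu; apply: eq_bigr => i _.
  by rewrite [in RHS]mxE.
rewrite (radial_cos_unit bw eu cu).
have [in_ ->] := radial_cos_cons n bw; have [ic ->] := radial_cos_cons c bw.
have mh : measurable half by [].
apply: (le_trans (le_normr_Rintegral mh in_)); apply: le_Rintegral => //.
  by have /= := integrable_norm in_.
move=> x _; rewrite c0 mulr0 mul0r cos0 mul1r mulrC (le_trans (norm_mul_cos_le _ (lexx _)))//.
by apply: IH => //; exact: bounded_noninc_shift.
Qed.

End radial_cos_compare.

End radial_modes.

(** * From the kernel to radial modes *)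

Section fourier.
Variable R : realType.

Lemma Fourier_coef_radial d (W : d.-tuple R -> R) : torus_kernel W ->
  radially_nonincreasing W ->
  exists M w, bounded_noninc M w /\
    forall n, Fourier_coef W n = (radial_cos w n)%:C.
Proof.
(* The profile [w0] is monotone only on nonnegative radii and may be unbounded below. As [Num.sqrt]
   is 0 on negative numbers, [w] is constant there; the maximum with 0 gives a lower bound and
   changes nothing on the cube, where the kernel is nonnegative. *)
move=> kW [w0 w0ni W_E]; pose w s := Num.max 0 (w0 (Num.sqrt s)).
have w_ge0 s : 0 <= w s by rewrite le_max lexx.
have wni x y : x <= y -> w y <= w x.
  move=> xy; rewrite /w ge_max !le_max lexx/= w0ni ?orbT ?sqrtr_ge0//.
  exact: ler_wsqrtr.
have bw : bounded_noninc (w 0) w.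
  split=> // x; rewrite ger0_norm//; have [x0|x0] := leP 0 x; first exact: wni.
  by rewrite /w !ler0_sqrtr// ltW.
exists (w 0), w; split=> // n; rewrite /Fourier_coef /Cintegral.
have Ww x : Omega x -> W x = w (dotp x x).
  by move=> Ox; rewrite /w -/(enorm x) -W_E// max_r//; exact: kernel_ge0.
transitivity (radial_cos w n +i* (- radial_sin w n)); last first.
  by rewrite (radial_sin_eq0 _ bw) oppr0.
congr (_ +i* _).
  apply: eq_Rintegral => x /set_mem Ox.
  rewrite (Ww _ Ox) /= mul0r subr0 expR0 mul0r subr0 mul1r cosN; done.
have mO := @measurable_Omega R d; have ir := integrable_radial_sin n bw.
rewrite -mulN1r -RintegralZl//.
apply: eq_Rintegral => x /set_mem Ox.
by rewrite (Ww _ Ox) /= expR0 !mul0r !addr0 !mul1r sinN mulN1r mulrN.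
Qed.

Lemma unit_mode_of_enorm d (e : 'rV[int]_d) :
  enorm (of_lattice e : d.-tuple R) = 1 -> unit_mode e.
Proof.
move=> e1; have : dotp (of_lattice e : d.-tuple R) (of_lattice e) = 1.
  have h : 0 <= dotp (of_lattice e : d.-tuple R) (of_lattice e).
    by apply: sumr_ge0 => i _; rewrite -expr2 sqr_ge0.
  by rewrite -(sqr_sqrtr h) -/(enorm _) e1 expr1n.
rewrite /dotp /unit_mode => H; apply/eqP; rewrite -(eqr_int R); apply/eqP.
rewrite -[RHS]H rmorph_sum; apply: eq_bigr => i _.
by rewrite tnth_mktuple -expr2 rmorphXn.
Qed.

Lemma wave_vector_gt0 d (n : 'rV[int]_d) : n != 0 ->
  0 < enorm (wave_vector n : d.-tuple R).
Proof.
move=> n0; rewrite sqrtr_gt0 lt_neqAle; apply/andP; split; last first.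
  by apply: sumr_ge0 => i _; rewrite -expr2 sqr_ge0.
apply: contra n0; rewrite eq_sym psumr_eq0; last by move=> i _; rewrite -expr2 sqr_ge0.
move=> /allP H; apply/eqP/rowP => i; rewrite mxE; have := H i (mem_index_enum _).
rewrite tnth_mktuple -expr2 sqrf_eq0 !mulf_eq0 pnatr_eq0 (gt_eqF (pi_gt0 R))/=.
by rewrite intr_eq0 => /eqP.
Qed.

End fourier.

(** * Second moment of a Gaussian density *)

Section gaussian_moments.
Variable R : realType.
Notation mu := (@lebesgue_measure R).

Lemma is_derive_sqr (x : R) : is_derive x 1 (fun y => y ^+ 2) (2 * x).
Proof.
have := is_derive_mulf (is_derive_idf x) (is_derive_idf x).
rewrite (_ : (fun y => y * y) = (fun y : R => y ^+ 2)) => [h|].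
  by apply: (is_derive_eq h); ring.
by apply/funext => y; rewrite expr2.
Qed.

Lemma is_derive_gauss (c x : R) :
  is_derive x 1 (fun y => expR (- c * y ^+ 2)) (- (2 * c * x) * expR (- c * x ^+ 2)).
Proof.
have h := is_derive_scalef (- c) (is_derive_sqr x).
apply: (is_derive_eq (is_derive_compf (is_derive_expR _) h)); ring.
Qed.

Lemma continuous_gauss (c : R) : continuous (fun y : R => expR (- c * y ^+ 2)).
Proof. by move=> x; exact: is_derive_continuous (is_derive_gauss c x). Qed.

(** Integrating (x phi)' = phi - 2 c x^2 phi over [-n, n] expresses the second moment through the
    total mass up to a boundary term. Monotone convergence handles both integrals. The total mass
    [I] is left abstract so that its value can be read off the normalization of the normal
    density. *)
Lemma integral_gauss_moment2 (c I : R) : 0 < c ->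
  (\int[mu]_x (expR (- c * x ^+ 2))%:E = I%:E)%E ->
  (\int[mu]_x (x ^+ 2 * expR (- c * x ^+ 2))%:E = (I / (2 * c))%:E)%E.
Proof.
move=> c0 II; pose phi x := expR (- c * x ^+ 2).
have cphi := @continuous_gauss c.
pose D n := [set` `[- n%:R, n%:R] : interval R].
have UD : \bigcup_n D n = setT.
  apply/seteqP; split=> // x _; exists (Num.truncn `|x|).+1 => //.
  by rewrite /D /= in_itv/= -ler_norml ltW// truncnS_gt.
have ndD : nondecreasing_seq D.
  move=> m n mn; apply/subsetPset => x; rewrite /D /= !in_itv/= => /andP[h1 h2].
  by rewrite (le_trans _ h1) ?lerN2 ?ler_nat// (le_trans h2)// ler_nat.
have mD i : measurable (D i) by exact: measurable_itv.
have conv (f : R -> R) : continuous f -> (forall x, 0 <= f x) ->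
    (\int[mu]_(x in D i) (f x)%:E @[i --> \oo] --> \int[mu]_x (f x)%:E)%E.
  move=> cf f0; rewrite -UD; apply: ge0_nondecreasing_set_cvg_integral => //.
  - by move=> i; apply/measurable_EFinP/measurable_funTS; exact: continuous_measurable_fun.
  - by move=> i x _; rewrite lee_fin.
have cx2 : continuous (fun x : R => x ^+ 2 * phi x).
  by move=> x; exact: is_derive_continuous (is_derive_mulf (is_derive_sqr x) (is_derive_gauss
    c x)).
have step n : (\int[mu]_(x in D n) (x ^+ 2 * phi x)%:E =
    ((2 * c)^-1)%:E * (\int[mu]_(x in D n) (phi x)%:E) - (n%:R * phi n%:R / c)%:E)%E.
  have n0 : - n%:R <= n%:R :> R by rewrite (@le_trans _ _ 0)// ?oppr_le0.
  have E1 (f : R -> R) : continuous f -> (\int[mu]_(x in D n) (f x)%:E = (\int[mu]_(x in D n)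
    f x)%:E)%E.
    by move=> cf; rewrite /Rintegral fineK//; apply: integrable_fin_num;
      [exact: mD|exact: (@continuous_itv_integrable _ f _ _ cf)].
  rewrite !E1// -EFinM -EFinB; congr EFin.
  have dF (x : R) : is_derive x 1 (fun y => y * phi y) (phi x - 2 * c * (x ^+ 2 * phi x)).
    by apply: (is_derive_eq (is_derive_mulf (is_derive_idf x) (is_derive_gauss c x)));
      rewrite -/(phi x); ring.
  have := @Rintegral_FTC2 _ (fun y => y * phi y) _ _ _ n0 (fun x _ => dF x).
  have i2 : mu.-integrable (D n) (EFin \o (fun x => 2 * c * (x ^+ 2 * phi x))).
    apply: continuous_itv_integrable => x.
    exact: is_derive_continuous (is_derive_scalef _ (is_derive_mulf (is_derive_sqr x)
      (is_derive_gauss c x))).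
  have i1 : mu.-integrable (D n) (EFin \o phi) := continuous_itv_integrable _ _ cphi.
  have i3 : mu.-integrable (D n) (EFin \o (fun x => x ^+ 2 * phi x)) :=
    continuous_itv_integrable _ _ cx2.
  rewrite RintegralB// RintegralZl//.
  have -> : phi (- n%:R) = phi n%:R by rewrite /phi sqrrN.
  rewrite -/(D n).
  move: (\int[mu]_(x in D n) phi x) (\int[mu]_(x in D n) (x ^+ 2 * phi x)) => A B H.
  have {}H : A - 2 * c * B = n%:R * phi n%:R - - n%:R * phi n%:R.
    apply: H => x.
    apply: is_derive_continuous (is_derive_subf (is_derive_gauss c x)
      (is_derive_scalef _ (is_derive_mulf (is_derive_sqr x) (is_derive_gauss c x)))).
  have c2 : 2 * c != 0 by rewrite mulf_neq0// lt0r_neq0.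
  apply: (mulfI c2); rewrite mulrBr mulVKf// (_ : 2 * c * B = A - 2 * (n%:R * phi n%:R)).
    by congr (_ - _); field; exact: lt0r_neq0.
  by rewrite mulNr opprK in H; lra.
(* The boundary term is of order 1 / n, already by exp y >= 1 + y. *)
have lim0 : (n%:R * phi n%:R / c @[n --> \oo] --> (0:R)).
  apply/(@cvgr0Pnorm_lt R) => eps eps0.
  near=> n.
  have n0 : 0 < n%:R :> R by rewrite ltr0n; near: n; exact: nbhs_infty_gt.
  rewrite ger0_norm; last by rewrite divr_ge0 ?mulr_ge0 ?expR_ge0 ?ltW.
  have : 1 + c * n%:R ^+ 2 <= expR (c * n%:R ^+ 2) by exact: expR_ge1Dx.
  have phiE : phi n%:R = (expR (c * n%:R ^+ 2))^-1 by rewrite /phi mulNr expRN.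
  rewrite phiE => H.
  have E0 := expR_gt0 (c * n%:R ^+ 2).
  rewrite ltr_pdivrMr// ltr_pdivrMr//.
  have nbig : (eps * c * c)^-1 < n%:R by near: n; exact: nbhs_infty_gtr.
  have : 1 < eps * c * c * n%:R by rewrite -ltr_pdivrMl ?mulr1// !mulr_gt0.
  move=> h1; apply: (@lt_le_trans _ _ (eps * c * (c * n%:R ^+ 2))).
    rewrite expr2 !mulrA; rewrite -[ltLHS]mul1r ltr_pM2r//.
  by rewrite ler_pM2l ?mulr_gt0//; lra.
have L1 : (\int[mu]_(x in D i) (x ^+ 2 * phi x)%:E @[i --> \oo] -->
    \int[mu]_x (x ^+ 2 * phi x)%:E)%E.
  by apply: conv => // x; rewrite mulr_ge0 ?sqr_ge0 ?expR_ge0.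
have L2 := conv _ cphi (fun x => expR_ge0 _).
apply: (cvg_unique _ L1) => //.
rewrite II in L2; rewrite (funext step).
rewrite (_ : I / (2 * c) = (2 * c)^-1 * I - 0); last by rewrite subr0 mulrC.
rewrite EFinB EFinM; apply: cvgeB => //.
  by apply: cvgeZl.
by apply: cvg_EFin; [exact: nearW|exact: lim0].
Unshelve. all: by end_near. Qed.

End gaussian_moments.

(** * Moments and symmetry of the normal law *)

Section normal_moments.
Variable R : realType.
Notation mu := (@lebesgue_measure R).

(** The Radon-Nikodym derivative of the law and the explicit density have the same integral over
    every measurable set, hence agree almost everywhere. *)
Lemma ge0_integral_normal_prob (m s : R) (f : R -> \bar R) :
  (forall x, 0 <= f x)%E -> measurable_fun setT f ->
  (\int[normal_prob m s]_x f x = \int[mu]_x (f x * (normal_pdf m s x)%:E))%E.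
Proof.
move=> f0 mf.
have dom := normal_prob_dominates m s.
rewrite -(Radon_Nikodym_SigmaFinite.change_of_variables dom f0 measurableT mf).
have mRN := measurable_int _ (Radon_Nikodym_SigmaFinite.f_integrable dom).
have mpdf : measurable_fun setT (fun x => (normal_pdf m s x)%:E).
  by apply/measurable_EFinP; exact: measurable_normal_pdf.
apply: ae_eq_integral => //.
- exact: emeasurable_funM.
- exact: emeasurable_funM.
- apply: ae_eqe_mul2l; apply: integral_ae_eq => //.
  + exact: Radon_Nikodym_SigmaFinite.f_integrable.
  + by move=> A _ mA; rewrite -Radon_Nikodym_SigmaFinite.f_integral.
Qed.

Lemma normal_moment2 (s : R) : 0 < s ->
  (\int[normal_prob 0 s]_x (x ^+ 2)%:E = (s ^+ 2)%:E)%E.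
Proof.
move=> s0; have s_neq0 := lt0r_neq0 s0.
have c0 : 0 < (s ^+ 2 *+ 2)^-1 by rewrite invr_gt0 pmulrn_lgt0// exprn_gt0.
have pk0 := normal_peak_gt0 s_neq0.
have nE x : normal_fun 0 s x = expR (- (s ^+ 2 *+ 2)^-1 * x ^+ 2).
  by rewrite /normal_fun subr0 mulNr mulrC mulNr.
have mphi : measurable_fun setT (fun x : R => expR (- (s ^+ 2 *+ 2)^-1 * x ^+ 2)).
  by apply: continuous_measurable_fun; exact: continuous_gauss.
have I1 : (\int[mu]_x (expR (- (s ^+ 2 *+ 2)^-1 * x ^+ 2))%:E = ((normal_peak s)^-1)%:E)%E.
  have := integral_normal_pdf 0 s.
  under eq_integral do rewrite normal_pdfE// nE EFinM.
  rewrite ge0_integralZl//.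
  - move=> /(congr1 (fun z => ((normal_peak s)^-1)%:E * z)%E).
    by rewrite muleA -EFinM mulVf ?lt0r_neq0// mul1e mule1.
  - exact/measurable_EFinP.
  - by rewrite lee_fin ltW.
rewrite ge0_integral_normal_prob.
- under eq_integral do rewrite normal_pdfE// nE -EFinM mulrCA EFinM.
  rewrite ge0_integralZl//.
  + rewrite (integral_gauss_moment2 c0 I1) -EFinM; congr EFin.
    by field; rewrite s_neq0 lt0r_neq0.
  + apply/measurable_EFinP; apply: measurable_funM => //; exact: exprn_measurable.
  + by move=> x _; rewrite lee_fin mulr_ge0 ?sqr_ge0 ?expR_ge0.
  + by rewrite lee_fin ltW.
- by move=> x; rewrite lee_fin sqr_ge0.
- by apply/measurable_EFinP; exact: exprn_measurable.
Qed.

Lemma normal_probN (s : R) (A : set R) : measurable A -> s != 0 ->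
  normal_prob 0 s (-%R @^-1` A) = normal_prob 0 s A.
Proof.
move=> mA s0; rewrite /normal_prob.
have mN : measurable_fun setT (-%R : R -> measurableTypeR R) by exact: oppr_measurable.
have mpdf : measurable_fun setT (fun x => (normal_pdf 0 s x)%:E).
  by apply/measurable_EFinP; exact: measurable_normal_pdf.
have H := @ge0_integral_pushforward _ _ (measurableTypeR R) (measurableTypeR R) R _ mN mu A
  (fun x => (normal_pdf 0 s x)%:E) mA (measurable_funTS mpdf).
transitivity (\int[pushforward mu (-%R : _ -> measurableTypeR R)]_(x in A) (normal_pdf 0 s
  x)%:E)%E.
  rewrite H; last by move=> x _; rewrite lee_fin normal_pdf_ge0.
  apply: eq_integral => x _; rewrite /= !normal_pdfE//.
  by rewrite /normal_fun !subr0 sqrrN.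
by apply: eq_measure_integral => B mB _; exact: lebesgue_measureN.
Qed.

End normal_moments.

(** * Moments of a random variable with a possibly degenerate Gaussian law *)

Section gaussian_law.
Context d (T : measurableType d) (R : realType) (P : probability T R).

Lemma gaussian_moment2 (X : T -> R) (v : R) : measurable_fun setT X -> 0 <= v ->
  has_law P X (gaussian 0 v) -> (\int[P]_x (X x ^+ 2)%:E = v%:E)%E.
Proof.
move=> mX v0 lawX.
have m2 : measurable_fun setT (fun y : R => (y ^+ 2)%:E).
  by apply/measurable_EFinP; exact: exprn_measurable.
have := @ge0_integral_pushforward _ _ T (measurableTypeR R) R X mX P setT (fun y => (y ^+
  2)%:E) measurableT m2.
rewrite preimage_setT => <-; last by move=> y _; rewrite lee_fin sqr_ge0.
have [vE|vne] := eqVneq v 0.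
  rewrite (eq_measure_integral (\d_(0 : measurableTypeR R))); last first.
    by move=> A mA _; have := lawX A mA; rewrite /gaussian vE eqxx.
  by rewrite integral_dirac// diracT mul1e vE expr0n.
rewrite -[in RHS](sqr_sqrtr v0) -normal_moment2;
  last by rewrite sqrtr_gt0 lt_neqAle eq_sym vne.
apply: eq_measure_integral => A mA _; have := lawX A mA.
by rewrite /gaussian (negbTE vne).
Qed.

Lemma gaussianN (v : R) (A : set R) : 0 <= v -> measurable A ->
  gaussian 0 v (-%R @^-1` A) = gaussian 0 v A.
Proof.
move=> v0 mA; rewrite /gaussian; case: eqVneq => [_|vne].
  rewrite !diracE (_ : (0 \in -%R @^-1` A) = (0 \in A))//.
  by apply/idP/idP; rewrite !inE /= oppr0.
by rewrite normal_probN// sqrtr_eq0 -ltNge lt_neqAle eq_sym vne.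
Qed.

(** [X] and its opposite have the same law, so the mean equals its own opposite. *)
Lemma gaussian_mean (X : T -> R) (v : R) : measurable_fun setT X -> 0 <= v ->
  has_law P X (gaussian 0 v) -> P.-integrable setT (EFin \o X) ->
  \int[P]_x X x = 0.
Proof.
move=> mX v0 lawX iX.
have mNX : measurable_fun setT (fun x => - X x) by exact: measurableT_comp.
have iNX : P.-integrable setT (EFin \o (fun x => - X x)).
  by have := integrableN iX; apply: eq_integrable.
suff : \int[P]_x X x = \int[P]_x (- X x).
  rewrite (_ : \int[P]_x (- X x) = - \int[P]_x X x); first by lra.
  rewrite -mulN1r -RintegralZl//; apply: eq_Rintegral => x _; by rewrite mulN1r.
have mid : measurable_fun setT (fun y : R => y%:E) by exact: EFin_measurable.
rewrite /Rintegral; congr fine.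
have := @integral_pushforward _ _ T (measurableTypeR R) R X mX P setT (fun y => y%:E) mid.
rewrite preimage_setT => /(_ iX measurableT) <-.
have := @integral_pushforward _ _ T (measurableTypeR R) R _ mNX P setT (fun y => y%:E) mid.
rewrite preimage_setT => /(_ iNX measurableT) <-.
apply: eq_measure_integral => A mA _.
rewrite /pushforward.
have mNA : measurable (-%R @^-1` A : set R).
  by rewrite -[X in measurable X]setTI; exact: oppr_measurable.
apply: (etrans (lawX A mA)); apply/esym; apply: (etrans (lawX _ mNA)).
exact: gaussianN.
Qed.

End gaussian_law.

(** * Discarding a null set without measurability of the integrand *)

Section integral_off_null_set.
Context d (T : measurableType d) (R : realType).
Variable mu : {measure set T -> \bar R}.
Import HBNNSimple.
Local Open Scope ereal_scope.

Local Notation nnintegral f := (ereal_sup [set sintegral mu h |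
  h in [set h : {nnsfun T >-> R} | forall x, (h x)%:E <= f x]]).

(** A simple function below [f], multiplied by the indicator of [G], keeps its integral and lies
    below [g]: on [G] the two functions agree, and off [G] it is 0. *)
Let le_nnintegral_off (G : set T) (f g : T -> \bar R) : measurable G ->
  mu (~` G) = 0 -> (forall x, 0 <= g x) -> {in G, f =1 g} ->
  nnintegral f <= nnintegral g.
Proof.
move=> mG G0 g0 fg; apply: ge_ereal_sup => _ [h hf <-].
have mC : measurable (~` G) by exact: measurableC.
apply: (@le_trans _ _ (sintegral mu (proj_nnsfun h mG))).
  rewrite -!integralT_nnsfun le_eqVlt; apply/orP; left; apply/eqP.
  apply: ae_eq_integral => //.
  - exact/measurable_EFinP.
  - exact/measurable_EFinP.
  - exists (~` G); split=> // x /= /not_implyP[_ H] Gx; apply: H.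
    by rewrite mindicE mem_set// mulr1.
apply: ereal_sup_ubound; exists (proj_nnsfun h mG) => //= x.
rewrite mindicE; case: (boolP (x \in G)) => xG.
  by rewrite mulr1 -fg//; exact: hf.
by rewrite mulr0.
Qed.

(* No measurability of f is assumed, so it applies to random variables that
are only almost surely defined on a probability space that is not complete. *)
Lemma integral_full_set (G : set T) (f : T -> \bar R) : measurable G ->
  mu (~` G) = 0 -> \int[mu]_x f x = \int[mu]_(x in G) f x.
Proof.
move=> mG G0; rewrite /integral patch_setT.
have fG : {in G, f =1 f \_ G} by move=> x xG; rewrite patchE xG.
have pE : {in G, f^\+ =1 (f \_ G)^\+} by move=> x xG; rewrite !funeposE fG.
have nE : {in G, f^\- =1 (f \_ G)^\-} by move=> x xG; rewrite !funenegE fG.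
congr (_ - _); apply/eqP; rewrite eq_le; apply/andP; split;
  apply: (le_nnintegral_off mG G0) => [//|x xG]; by rewrite ?pE ?nE.
Qed.

End integral_off_null_set.

(** * Square integrable functions on a set of finite measure *)

Section square_integrable.
Context d (T : measurableType d) (R : realType).
Variables (mu : {measure set T -> \bar R}) (D : set T).
Hypotheses (mD : measurable D) (fD : (mu D < +oo)%E).
Implicit Types X Y : T -> R.

Definition sqint X :=
  measurable_fun D X /\ mu.-integrable D (EFin \o (fun x => X x ^+ 2)).

Lemma sqint_mul X Y : sqint X -> sqint Y ->
  mu.-integrable D (EFin \o (fun x => X x * Y x)).
Proof.
move=> [mX iX] [mY iY].
apply: (@le_integrable _ _ _ _ _ _ _ (EFin \o (fun x => X x ^+ 2 + Y x ^+ 2))) => //.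
- by apply/measurable_EFinP; exact: measurable_funM.
- move=> x _; rewrite lee_fin (ger0_norm (addr_ge0 (sqr_ge0 _) (sqr_ge0 _))).
  rewrite ler_norml; have := sqr_ge0 (X x + Y x); have := sqr_ge0 (X x - Y x).
  move=> h1 h2.
  by apply/andP; split; have := sqr_ge0 (X x); have := sqr_ge0 (Y x); lra.
- by have := integrableD mD iX iY; apply: eq_integrable.
Qed.

Lemma sqint1 : sqint (fun=> 1).
Proof.
split=> //; apply: (measurable_bounded_integrable mD fD) => //.
exists 1; split; first exact: num_real.
by move=> r r1 x _; rewrite expr1n normr1 ltW.
Qed.

Lemma sqint_integrable X : sqint X -> mu.-integrable D (EFin \o X).
Proof.
move=> sX; have := sqint_mul sX sqint1; apply: eq_integrable => // x _ /=.
by rewrite mulr1.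
Qed.

Lemma sqintD X Y : sqint X -> sqint Y -> sqint (fun x => X x + Y x).
Proof.
move=> sX sY; have iXY := sqint_mul sX sY.
case: (sX) (sY) => mX iX [mY iY]; split; first exact: measurable_funD.
have := integrableD mD (integrableD mD iX iY) (integrableZl mD 2 iXY).
apply: eq_integrable => // x _ /=; rewrite -EFinM -!EFinD; congr EFin; ring.
Qed.

Lemma sqintZ c X : sqint X -> sqint (fun x => c * X x).
Proof.
move=> [mX iX]; split; first exact: measurable_funM.
have := integrableZl mD (c ^+ 2) iX; apply: eq_integrable => // x _ /=.
by rewrite -EFinM exprMn.
Qed.

Lemma sqintB X Y : sqint X -> sqint Y -> sqint (fun x => X x - Y x).
Proof.
move=> sX sY; rewrite (_ : (fun x => _) = (fun x => X x + -1 * Y x)).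
  by apply: sqintD => //; exact: sqintZ.
by apply/funext => x; rewrite mulN1r.
Qed.

Lemma sqint_sum (I : Type) (s : seq I) (X : I -> T -> R) :
  (forall i, sqint (X i)) -> sqint (fun x => \sum_(i <- s) X i x).
Proof.
move=> sX; elim: s => [|i s IH].
  under eq_fun do rewrite big_nil.
  rewrite (_ : (fun=> 0) = (fun=> 0 * 1)); first exact/sqintZ/sqint1.
  by apply/funext => x; rewrite mul0r.
by under eq_fun do rewrite big_cons; exact: sqintD.
Qed.

Lemma Rintegral_sum (I : Type) (s : seq I) (f : I -> T -> R) :
  (forall i, mu.-integrable D (EFin \o f i)) ->
  \int[mu]_(x in D) (\sum_(i <- s) f i x) = \sum_(i <- s) \int[mu]_(x in D) f i x.
Proof.
move=> If; elim: s => [|i s IH].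
  rewrite big_nil; under eq_Rintegral do rewrite big_nil.
  by rewrite Rintegral_cst// mul0r.
rewrite big_cons -IH -RintegralD//.
  by apply: eq_Rintegral => x _; rewrite big_cons.
have := @integrable_sum _ _ _ mu D mD _ s xpredT _ (fun i _ => If i);
  apply: eq_integrable => // x _ /=.
by rewrite sumEFin.
Qed.

Lemma Rintegral_sqr_sum (I : finType) (a : I -> R) (X : I -> T -> R) :
  (forall i, sqint (X i)) ->
  \int[mu]_(x in D) (\sum_i a i * X i x) ^+ 2 =
  \sum_i \sum_j a i * a j * \int[mu]_(x in D) (X i x * X j x).
Proof.
move=> sX.
have iXX i j : mu.-integrable D (EFin \o (fun x => a i * a j * (X i x * X j x))).
  have := integrableZl mD (a i * a j) (sqint_mul (sX i) (sX j)).
  by apply: eq_integrable => // x _ /=; rewrite -EFinM.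
transitivity (\int[mu]_(x in D) (\sum_i \sum_j a i * a j * (X i x * X j x))).
  apply: eq_Rintegral => x _; rewrite expr2 big_distrlr /=.
  by apply: eq_bigr => i _; apply: eq_bigr => j _; ring.
rewrite Rintegral_sum; last first.
  move=> i; have := @integrable_sum _ _ _ mu D mD _ (index_enum I) xpredT _ (fun j _ => iXX i
    j).
  by apply: eq_integrable => // x _ /=; rewrite sumEFin.
apply: eq_bigr => i _; rewrite Rintegral_sum//; apply: eq_bigr => j _.
by rewrite RintegralZl//; exact: sqint_mul.
Qed.

End square_integrable.

(** * Expectation of a product of independent variables *)

Section independence.
Context d (T : measurableType d) (R : realType) (P : probability T R).

(** The law of the pair agrees with the product of the two laws on rectangles, hence everywhere by
    uniqueness of the product measure; Fubini then factors the integral of the product. *)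
Lemma expectation_mul_independent (X Y : T -> R) :
  sqint P setT X -> sqint P setT Y ->
  (forall A B : set R, measurable A -> measurable B ->
    P (X @^-1` A `&` Y @^-1` B) = P (X @^-1` A) * P (Y @^-1` B))%E ->
  \int[P]_x (X x * Y x) = (\int[P]_x X x) * (\int[P]_x Y x).
Proof.
move=> sX sY XY.
have PT : (P setT < +oo)%E by rewrite probability_setT ltry.
have mX := sX.1; have mY := sY.1.
have iX := sqint_integrable measurableT PT sX; have iY := sqint_integrable measurableT PT sY.
have iXY := sqint_mul measurableT sX sY.
pose X' : {mfun T >-> R} := HB.pack X (isMeasurableFun.Build _ _ _ _ X mX).
pose Y' : {mfun T >-> R} := HB.pack Y (isMeasurableFun.Build _ _ _ _ Y mY).
pose m1 : probability R R := distribution P X'.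
pose m2 : probability R R := distribution P Y'.
pose J x : R * R := (X x, Y x).
have mJ : measurable_fun setT J by apply/measurable_fun_pair.
have mid : measurable_fun setT (fun y : R => y%:E) by exact: EFin_measurable.
have mprod : measurable_fun setT (fun z : R * R => (z.1 * z.2)%:E).
  by apply/measurable_EFinP; apply: measurable_funM.
have prodE A : measurable A -> (m1 \x m2)%E A = pushforward P J A.
  move=> mA; apply: product_measure_unique => [B C mB mC|//].
  exact: (XY B C mB mC).
have i1 : m1.-integrable setT (fun y : R => y%:E).
  by apply: integrable_pushforward => //.
have i2 : m2.-integrable setT (fun y : R => y%:E).
  by apply: integrable_pushforward => //.
have E1 : \int[m1]_y y = \int[P]_x X x.
  by rewrite /Rintegral (integral_pushforward mX mid).
have E2 : \int[m2]_y y = \int[P]_x Y x.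
  by rewrite /Rintegral (integral_pushforward mY mid).
have iprod : (m1 \x m2)%E.-integrable setT (fun z : R * R => (z.1 * z.2)%:E).
  have := @integrable_pushforward _ _ _ _ R J mJ P setT _ mprod iXY measurableT.
  move=> /integrableP[m fin]; apply/integrableP; split=> //.
  apply: le_lt_trans fin; rewrite le_eqVlt; apply/orP; left; apply/eqP.
  by apply: eq_measure_integral => A mA _; exact: prodE.
rewrite -E1 -E2 {1}/Rintegral.
have := @integral_pushforward _ _ _ _ R J mJ P setT _ mprod iXY measurableT.
rewrite preimage_setT => <-.
rewrite -(_ : \int[m1 \x m2]_z (z.1 * z.2)%:E = \int[pushforward P J]_z (z.1 * z.2)%:E)%E;
  last first.
  by apply: eq_measure_integral => A mA _; exact: prodE.
rewrite -(integral12_prod_meas1 iprod) /fubini_F /=.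
transitivity (fine (\int[m1]_x (x * \int[m2]_y y)%:E)%E).
  congr fine; apply: eq_integral => x _.
  under eq_integral do rewrite EFinM.
  rewrite integralZl// EFinM; congr (_ * _)%E.
  by rewrite /Rintegral fineK// integrable_fin_num.
have := @RintegralZr _ _ _ m1 setT (fun y : R => y) (\int[m2]_y y) measurableT i1.
by rewrite {1}/Rintegral => ->.
Qed.

End independence.

(** * Variance of an almost sure limit *)

Section L2_limit.
Context d (T : measurableType d) (R : realType) (P : probability T R).

Lemma sqr_Rintegral_le (G : set T) (X : T -> R) : measurable G -> P G = 1%E ->
  sqint P G X -> (\int[P]_(x in G) X x) ^+ 2 <= \int[P]_(x in G) (X x ^+ 2).
Proof.
move=> mG G1 sX.
have fG : (P G < +oo)%E by rewrite G1 ltry.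
have iX := sqint_integrable mG fG sX.
set c := \int[P]_(x in G) X x.
have : 0 <= \int[P]_(x in G) ((X x - c) ^+ 2) by apply: Rintegral_ge0 => x _; exact: sqr_ge0.
have i2X : P.-integrable G (EFin \o (fun x => 2 * c * X x)).
  by have := integrableZl mG (2 * c) iX; apply: eq_integrable.
have icst : P.-integrable G (EFin \o (fun x => c ^+ 2)).
  by apply: finite_measure_integrable_cst.
rewrite (_ : \int[P]_(x in G) ((X x - c) ^+ 2) =
    \int[P]_(x in G) (X x ^+ 2 - 2 * c * X x + c ^+ 2)); last first.
  by apply: eq_Rintegral => x _; ring.
have iX2 := sX.2.
have i1 : P.-integrable G (EFin \o (fun x => X x ^+ 2 - 2 * c * X x)).
  by have := integrableB mG iX2 i2X; apply: eq_integrable.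
rewrite RintegralD// RintegralB//.
rewrite RintegralZl// Rintegral_cst// [X in fine X]G1 -/c /=.
by move: (\int[P]_(x in G) (X x ^+ 2)) (c) => a c'; lra.
Qed.

(** [Z] is known only on the full set [G], where it is a pointwise limit and therefore measurable.
    Fatou turns the Cauchy bound into an L2 distance from [Zn n] to [Z], and the mean and second
    moment pass to the limit. *)
Lemma variance_L2_limit (Z : T -> R) (Zn : nat -> T -> R) (G : set T)
    (v : R) (dl : nat -> R) :
  measurable G -> P (~` G) = 0%E -> (forall n, sqint P setT (Zn n)) ->
  (forall x, G x -> Zn n x @[n --> \oo] --> Z x) ->
  (forall n m, (n <= m)%N -> \int[P]_x ((Zn n x - Zn m x) ^+ 2) <= dl n) ->
  dl n @[n --> \oo] --> 0 -> (forall n, \int[P]_x Zn n x = 0) ->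
  \int[P]_x (Zn n x ^+ 2) @[n --> \oo] --> v ->
  'V_P[Z] = v%:E.
Proof.
move=> mG G0 sZn ZnZ dlP dl0 Zn0 Znv.
have G1 : P G = 1%E.
  have := probability_setC P (measurableC mG).
  by rewrite setCK [X in (_ - X)%E]G0 sube0.
have fG : (P G < +oo)%E by rewrite G1 ltry.
have onG (f : T -> R) : \int[P]_x f x = \int[P]_(x in G) f x.
  by rewrite /Rintegral (integral_full_set _ mG G0).
have sZnG n : sqint P G (Zn n).
  split; first exact: measurable_funTS (sZn n).1.
  exact: integrableS (sZn n).2.
have mZ : measurable_fun G Z.
  by apply: (measurable_fun_cvg (h := Zn)) => // n; exact: (sZnG n).1.
have mW n : measurable_fun G (fun x => (Z x - Zn n x) ^+ 2).
  by apply: measurable_funX; apply: measurable_funB => //; exact: (sZnG n).1.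
have fatW n : (\int[P]_(x in G) ((Z x - Zn n x) ^+ 2)%:E <= (dl n)%:E)%E.
  have mWn m : measurable_fun G (fun x => ((Zn m x - Zn n x) ^+ 2)%:E).
    apply/measurable_EFinP; apply: measurable_funX; apply: measurable_funB.
      exact: (sZnG m).1.
    exact: (sZnG n).1.
  have W0 m x : G x -> (0 <= ((Zn m x - Zn n x) ^+ 2)%:E)%E by rewrite lee_fin sqr_ge0.
  apply: (@le_trans _ _ (limn_einf (fun m => \int[P]_(x in G) ((Zn m x - Zn n x) ^+ 2)%:E))%E).
    apply: le_trans (fatou P mG mWn W0).
    rewrite le_eqVlt; apply/orP; left; apply/eqP.
    apply: eq_integral => x /set_mem Gx.
    have cv : ((Zn m x - Zn n x) ^+ 2)%:E @[m --> \oo] --> ((Z x - Zn n x) ^+ 2)%:E.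
      apply: cvg_EFin; first exact: nearW.
      have cW : Zn m x - Zn n x @[m --> \oo] --> Z x - Zn n x.
        by apply: cvgB; [exact: ZnZ|exact: cvg_cst].
      exact: (cvgM cW cW).
    rewrite is_cvg_limn_einfE; first exact/esym/cvg_lim.
    by apply/cvg_ex; eexists; exact: cv.
  have bnd m : (n <= m)%N -> (\int[P]_(x in G) ((Zn m x - Zn n x) ^+ 2)%:E <= (dl n)%:E)%E.
    move=> nm; have := dlP n m nm; rewrite onG -lee_fin /Rintegral fineK.
      by apply: le_trans; rewrite le_eqVlt; apply/orP; left; apply/eqP;
        apply: eq_integral => x _; congr EFin; ring.
    by apply: integrable_fin_num => //; exact: (sqintB mG (sZnG n) (sZnG m)).2.
  rewrite limn_einf_lim; apply: lime_le.
    by apply/cvg_ex; eexists; exact/ereal_nondecreasing_cvgn/nondecreasing_einfs.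
  (* The infimum over indices from k on is at most the term at [maxn n k], an index to which the
     Cauchy bound applies. *)
  near=> k; apply: (@le_trans _ _ (\int[P]_(x in G) ((Zn (maxn n k) x - Zn n x) ^+ 2)%:E)%E).
    by apply: ereal_inf_lbound; exists (maxn n k) => //=; exact: leq_maxr.
  by apply: bnd; exact: leq_maxl.
have sW n : sqint P G (fun x => Z x - Zn n x).
  split; first by apply: measurable_funB => //; exact: (sZnG n).1.
  apply/integrableP; split; first exact/measurable_EFinP.
  apply: (le_lt_trans _ (ltry (dl n))); apply: le_trans (fatW n).
  apply: ge0_le_integral => //.
  - by apply/measurable_EFinP; apply: measurableT_comp => //; exact: mW.
  - exact/measurable_EFinP.
  - by move=> x _; rewrite /= ger0_norm// sqr_ge0.
have W2 n : \int[P]_(x in G) ((Z x - Zn n x) ^+ 2) <= dl n.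
  rewrite -lee_fin /Rintegral fineK; first exact: fatW.
  by apply: integrable_fin_num => //; exact: (sW n).2.
have sZ : sqint P G Z.
  have := sqintD mG (sW 0%N) (sZnG 0%N).
  by congr sqint; apply/funext => x; rewrite subrK.
have iW n := sqint_integrable mG fG (sW n).
have iZn n := sqint_integrable mG fG (sZnG n).
have iZ := sqint_integrable mG fG sZ.
have EZ : \int[P]_(x in G) Z x = 0.
  have sq n : (\int[P]_(x in G) Z x) ^+ 2 <= dl n.
    rewrite -(subr0 (\int[P]_(x in G) Z x)) -(Zn0 n) onG -RintegralB//.
    exact: le_trans (sqr_Rintegral_le mG G1 (sW n)) (W2 n).
  apply/eqP; rewrite -sqrf_eq0 eq_le sqr_ge0 andbT.
  by apply: (ler_cvg_to (cvg_cst _) dl0); exact: nearW.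
have EZ2 : \int[P]_(x in G) (Z x ^+ 2) = v.
  pose vn n := \int[P]_x (Zn n x ^+ 2).
  (* From |2 a w| <= eta a^2 + w^2 / eta with w = Z - Zn: the error is a small multiple of the
     second moment plus a large multiple of a vanishing distance. *)
  have key (eta : R) : 0 < eta -> `|\int[P]_(x in G) (Z x ^+ 2) - v| <= eta * v.
    move=> eta0.
    have bn n : `|\int[P]_(x in G) (Z x ^+ 2) - vn n| <= eta * vn n + (1 + eta^-1) * dl n.
      have iZW := sqint_mul mG (sZnG n) (sW n).
      have i2 : P.-integrable G (EFin \o (fun x => 2 * (Zn n x * (Z x - Zn n x)))).
        by have := integrableZl mG 2 iZW; apply: eq_integrable.
      have iW2 := (sW n).2; have iZn2 := (sZnG n).2; have iZ2 := sZ.2.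
      have iE : P.-integrable G (EFin \o (fun x => eta * Zn n x ^+ 2)).
        by have := integrableZl mG eta iZn2; apply: eq_integrable.
      have iF : P.-integrable G (EFin \o (fun x => (1 + eta^-1) * (Z x - Zn n x) ^+ 2)).
        by have := integrableZl mG (1 + eta^-1) iW2; apply: eq_integrable.
      have iD : P.-integrable G (EFin \o (fun x => Z x ^+ 2 - Zn n x ^+ 2)).
        by have := integrableB mG iZ2 iZn2; apply: eq_integrable.
      have iEF : P.-integrable G (EFin \o (fun x => eta * Zn n x ^+ 2 + (1 + eta^-1) * (Z x -
        Zn n x) ^+ 2)).
        by have := integrableD mG iE iF; apply: eq_integrable.
      rewrite /vn onG -RintegralB//; apply: (le_trans (le_normr_Rintegral mG iD)).
      apply: (@le_trans _ _ (\int[P]_(x in G) (eta * Zn n x ^+ 2 + (1 + eta^-1) * (Z x - Zn n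
        x) ^+ 2))).
        apply: le_Rintegral => //; first by have /= := integrable_norm iD.
        move=> x _; set a := Zn n x; set w := Z x - a.
        have -> : Z x ^+ 2 - a ^+ 2 = 2 * (a * w) + w ^+ 2 by rewrite /w; ring.
        apply: (le_trans (ler_normD _ _)); rewrite (ger0_norm (sqr_ge0 w)).
        rewrite (_ : eta * a ^+ 2 + _ = eta * a ^+ 2 + eta^-1 * w ^+ 2 + w ^+ 2); last by ring.
        rewrite lerD2r.
        have e1 := sqr_ge0 (eta * a + w); have e2 := sqr_ge0 (eta * a - w).
        rewrite ler_norml; apply/andP; split.
          rewrite -subr_ge0 (_ : _ - _ = eta^-1 * (eta * a + w) ^+ 2); last by field;
            exact: lt0r_neq0.
          by rewrite mulr_ge0// invr_ge0 ltW.
        rewrite -subr_ge0 (_ : _ - _ = eta^-1 * (eta * a - w) ^+ 2); last by field;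
          exact: lt0r_neq0.
        by rewrite mulr_ge0// invr_ge0 ltW.
      rewrite RintegralD// !RintegralZl// lerD2l ler_pM2l; first exact: W2.
      by rewrite addr_gt0// invr_gt0.
    have c1 : `|\int[P]_(x in G) (Z x ^+ 2) - vn n| @[n --> \oo] -->
        `|\int[P]_(x in G) (Z x ^+ 2) - v|.
      by apply: cvg_norm; apply: cvgB; [exact: cvg_cst|exact: Znv].
    have c2 : eta * vn n + (1 + eta^-1) * dl n @[n --> \oo] --> eta * v.
      rewrite (_ : eta * v = eta * v + (1 + eta^-1) * 0); last by rewrite mulr0 addr0.
      by apply: cvgD; apply: cvgM; [exact: cvg_cst|exact: Znv|exact: cvg_cst|exact: dl0].
    by apply: (ler_cvg_to c1 c2); exact: nearW.
  apply/eqP; rewrite -subr_eq0 -normr_eq0 eq_le normr_ge0 andbT leNgt; apply/negP => a0.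
  move: key; move: (`|_|) a0 => a a0 key.
  have v0 : 0 < v.
    by have := key 1 ltr01; rewrite mul1r; exact: lt_le_trans.
  (* For this [eta] the bound reads a <= a / 2, impossible for a > 0. *)
  have := key (a / (2 * v)) (divr_gt0 a0 (mulr_gt0 (ltr0Sn _ 1) v0)).
  rewrite (_ : a / (2 * v) * v = a / 2); first by lra.
  by field; exact: lt0r_neq0.
have EZT : \int[P]_x Z x = 0 by rewrite onG.
rewrite /variance covariance.unlock !expectation.unlock.
rewrite [fine _]EZT.
rewrite (integral_full_set _ mG G0) -EZ2 /Rintegral fineK; last exact: integrable_fin_num sZ.2.
by apply: eq_integral => x _; rewrite !fctE /= !subr0 -expr2.
Unshelve. all: by end_near. Qed.

End L2_limit.

(** * Riemann-Stieltjes sums for a convolution integral *)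

Section step_approximation.
Variable R : realType.
Notation mu := (@lebesgue_measure R).
Implicit Types (b C phi : R -> R) (t L : R) (n i : nat).

Lemma uniform_continuity_segment b (a c : R) : continuous b -> forall eps, 0 < eps ->
  exists2 delta, 0 < delta &
    forall x y, a <= x <= c -> `|x - y| < delta -> `|b x - b y| < eps.
Proof.
move=> cb eps eps0.
have [near_cover _] := compact_near_coveringP (`[a, c]%classic : set R).
have H : forall x, `[a, c]%classic x -> \forall x' \near x & delta \near 0^'+,
    forall y, `|x' - y| < delta -> `|b x' - b y| < eps.
  move=> x _; have /(@cvgr_dist_lt _ R^o) := cb x => /(_ (eps / 2)).
  rewrite divr_gt0// => /(_ isT) /nbhs_ballP[r /= r0 rb].
  exists (ball x (r / 2), [set delta | 0 < delta < r / 2]) => /=.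
    split; first by apply: nbhsx_ballx; rewrite divr_gt0.
    near=> delta; apply/andP; split; near: delta; first exact: nbhs_right_gt.
    by apply: nbhs_right_lt; rewrite divr_gt0.
  move=> [x' delta] /= [xx' /andP[d0 dr]] y x'y.
  rewrite -ball_normE /= in xx'.
  have h1 : `|b x - b x'| < eps / 2.
    by apply: rb; rewrite -ball_normE /=; lra.
  have h2 : `|b x - b y| < eps / 2.
    apply: rb; rewrite -ball_normE /=.
    by have := ler_distD x' x y; lra.
  by have := ler_distD (b x) (b x') (b y); rewrite (distrC (b x') (b x)); lra.
have near_delta := near_cover (@segment_compact _ a c) R (0^'+)
  (fun delta x => forall y, `|x - y| < delta -> `|b x - b y| < eps) _ H.
have FF : Filter (0 : R)^'+ by exact _.
have near_d := near_delta FF.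
near (0 : R)^'+ => delta; exists delta; first by near: delta; exact: nbhs_right_gt.
move=> x y xac; apply: (near near_d delta) => //; by rewrite /= in_itv.
Unshelve. all: by end_near. Qed.

Definition node t n i : R := t * i%:R / n.+1%:R.

(** When [phi] is the derivative of [C], this is the integral of phi (t - s) over the i-th cell of
    the grid. *)
Definition incr C t n i : R := C (t - node t n i) - C (t - node t n i.+1).

Lemma node0 t n : node t n 0 = 0.
Proof. by rewrite /node mulr0 mul0r. Qed.

Lemma node_last t n : node t n n.+1 = t.
Proof. by rewrite /node mulfK// pnatr_eq0. Qed.

Lemma nodeS t n i : node t n i.+1 = node t n i + t / n.+1%:R.
Proof. by rewrite /node -natr1 mulrDr mulr1 mulrDl. Qed.

Lemma node_le t n i j : 0 <= t -> (i <= j)%N -> node t n i <= node t n j.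
Proof. by move=> t0 ij; rewrite /node ler_wpM2r// ler_wpM2l// ler_nat. Qed.

Lemma incr_le C phi t L n i : 0 <= t -> (forall x : R, is_derive x 1 C (phi x)) ->
  (forall x, 0 <= x <= t -> `|phi x| <= L) ->
  forall u, node t n i <= u -> u <= node t n i.+1 -> (i < n.+1)%N ->
  `|C (t - node t n i) - C (t - u)| <= L * (t / n.+1%:R).
Proof.
move=> t0 dC phiL u iu ui iN.
have n0 : 0 <= node t n i by rewrite -(node0 t n) node_le.
have nt : node t n i.+1 <= t by rewrite -[leRHS](node_last t n) node_le.
have tu : t - u <= t - node t n i by lra.
have cC : {within `[t - u, t - node t n i], continuous C}.
  by apply: continuous_subspaceT => x; exact: is_derive_continuous (dC x).
have [z zin ->] := MVT_segment tu (fun x _ => dC x) cC.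
move: zin; rewrite in_itv/= => /andP[z1 z2].
rewrite normrM; apply: ler_pM => //; first by apply: phiL; apply/andP; split; lra.
by move: ui; rewrite nodeS; move: (t / n.+1%:R) => h ui; rewrite ger0_norm; lra.
Qed.

(** The error is a sum over cells of the integral of phi (t - s) (b s - b (right endpoint)), small
    by uniform continuity of [b]. *)
Lemma stieltjes_sum_cvg C phi b t L : 0 <= t -> (forall x : R, is_derive x 1 C (phi x)) ->
  continuous phi -> (forall x, 0 <= x <= t -> `|phi x| <= L) -> continuous b ->
  \sum_(i < n.+1) incr C t n i * b (node t n i.+1) @[n --> \oo] -->
  \int[mu]_(s in `[0, t]) (phi (t - s) * b s).
Proof.
move=> t0 dC cphi phiL cb.
have cphit : continuous (fun s => phi (t - s)).
  by move=> x; apply: continuous_comp; [apply: cvgB;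
    [exact: cvg_cst|exact: cvg_id]|exact: cphi].
have cf : continuous (fun s => phi (t - s) * b s).
  by move=> x; apply: cvgM; [exact: cphit|exact: cb].
pose F y := \int[mu]_(s in `[-1, y]) (phi (t - s) * b s).
have dF (x : R) : -1 < x -> is_derive x 1 F (phi (t - x) * b x) by exact: is_derive_Rintegral.
have IE : \int[mu]_(s in `[0, t]) (phi (t - s) * b s) = F t - F 0.
  apply: Rintegral_FTC2 => // x /andP[x0 _]; apply: dF; lra.
rewrite IE; apply/(@cvgrPdist_le R R^o) => eps eps0.
have L0 : 0 <= L by apply: le_trans (phiL 0 _); rewrite ?lexx.
(* The cell errors add up to L * t times this modulus; the added 1 keeps the denominator
   positive. *)
have e1 : 0 < eps / (L * t + 1) by rewrite divr_gt0// ltr_wpDl// mulr_ge0.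
have [delta d0 bd] := @uniform_continuity_segment b 0 t cb _ e1.
near=> n.
have hd : t / n.+1%:R < delta.
  rewrite ltr_pdivrMr ?ltr0n//.
  have : t / delta < n%:R by near: n; exact: nbhs_infty_gtr.
  by rewrite ltr_pdivrMr// -natr1; lra.
have tele : F t - F 0 = \sum_(i < n.+1) (F (node t n i.+1) - F (node t n i)).
  by rewrite -(big_mkord xpredT (fun i => F (node t n i.+1) - F (node t n i)))
    telescope_sumr// node_last node0.
rewrite tele -sumrB.
apply: (@le_trans _ _ (\sum_(i < n.+1) (L * (eps / (L * t + 1)) * (t / n.+1%:R)))).
  apply: (le_trans (ler_norm_sum _ _ _)); apply: ler_sum => i _.
  (* The increment of [g] over the cell is exactly the cell error, so the mean value theorem bounds
     it by the derivative phi (t - s) (b s - b (right endpoint)). *)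
  pose g s := F s + C (t - s) * b (node t n i.+1).
  have n0 : 0 <= node t n i by rewrite -(node0 t n) node_le.
  have nt : node t n i.+1 <= t by rewrite -[leRHS](node_last t n) node_le.
  have nn : node t n i <= node t n i.+1 by rewrite node_le.
  have dg (x : R) : -1 < x -> is_derive x 1 g (phi (t - x) * (b x - b (node t n i.+1))).
    move=> x1; have h := is_derive_addf (dF x x1) (is_derive_mulf
      (@is_derive_compf R C (fun y => t - y) x _ _ (dC (t - x)) (is_derive_csubl t x))
        (is_derive_cstf (b (node t n i.+1)) x)).
    by apply: (is_derive_eq h); ring.
  have -> : F (node t n i.+1) - F (node t n i) - incr C t n i * b (node t n i.+1) =
     g (node t n i.+1) - g (node t n i) by rewrite /g /incr; ring.
  have dgi x : x \in `]node t n i, node t n i.+1[ ->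
      is_derive x 1 g (phi (t - x) * (b x - b (node t n i.+1))).
    by rewrite in_itv/= => /andP[x0 _]; apply: dg; lra.
  have cg : {within `[node t n i, node t n i.+1], continuous g}.
    apply: continuous_in_subspaceT => x; rewrite inE /= in_itv/= => /andP[x0 _].
    by apply: is_derive_continuous (dg x _); lra.
  have [z zin ->] := MVT_segment nn dgi cg.
  move: zin; rewrite in_itv/= => /andP[z1 z2].
  rewrite 2!normrM; apply: ler_pM => //;
    last by rewrite nodeS addrAC subrr add0r ger0_norm// divr_ge0.
  apply: ler_pM => //; first by apply: phiL; lra.
  apply/ltW/bd; first lra.
  by rewrite distrC ger0_norm ?subr_ge0//; move: hd z2; rewrite nodeS;
    move: (t / n.+1%:R) => h; lra.
rewrite sumr_const card_ord -[leLHS]mulr_natr.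
have Lt1 : 0 < L * t + 1 by rewrite ltr_wpDl ?mulr_ge0.
have E : L * (eps / (L * t + 1)) * (t / n.+1%:R) * n.+1%:R = eps * (L * t / (L * t + 1)).
  by field; rewrite lt0r_neq0//= pnatr_eq0.
rewrite [leLHS]E; apply: ler_piMr; first exact: ltW.
by rewrite ler_pdivrMr// mul1r; move: (L * t) => z; lra.
Unshelve. all: by end_near. Qed.

End step_approximation.

(** * Step functions approximating the time-reversed kernel *)

Section step_functions.
Variable R : realType.
Notation mu := (@lebesgue_measure R).

(** The deterministic counterpart of a sum of values of Brownian motion: B at time s corresponds to
    the indicator of [0, s]. *)
Definition step_fun (C : R -> R) t n (u : R) : R :=
  \sum_(i < n.+1) incr C t n i * \1_`[0, node t n i.+1] u.

(** At u the indicators keep the cells ending at or after u. Their increments telescope to C (t -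
    node j), where node j starts the cell containing u, because C 0 = 0. *)
Lemma step_fun_near C phi t L n u : 0 <= t ->
  (forall x : R, is_derive x 1 C (phi x)) ->
  (forall x, 0 <= x <= t -> `|phi x| <= L) -> C 0 = 0 -> 0 <= u <= t ->
  `|step_fun C t n u - C (t - u)| <= L * (t / n.+1%:R).
Proof.
move=> t0 dC phiL C0 /andP[u0 ut].
pose S j := \sum_(0 <= i < j) incr C t n i * (u <= node t n i.+1)%R%:R.
have L0 : 0 <= L by apply: le_trans (phiL 0 _); rewrite ?lexx.
have h0 : 0 <= L * (t / n.+1%:R) by rewrite mulr_ge0// divr_ge0.
have key j : (j <= n.+1)%N ->
    (node t n j < u -> S j = 0) /\
    (u <= node t n j -> `|S j - (C (t - u) - C (t - node t n j))| <= L * (t / n.+1%:R)).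
  elim: j => [_|j IH jn].
    rewrite /S big_geq// node0; split=> // uN0.
    by rewrite (_ : u = 0) ?subrr ?subr0 ?normr0//; apply/eqP; rewrite eq_le uN0.
  have [IH1 IH2] := IH (ltnW jn).
  have SS : S j.+1 = S j + incr C t n j * (u <= node t n j.+1)%R%:R by rewrite /S big_nat_recr.
  have nn : node t n j <= node t n j.+1 by rewrite node_le.
  rewrite SS; split=> uj.
    by rewrite IH1 ?(le_lt_trans nn)// leNgt uj mulr0 addr0.
  rewrite uj mulr1; have [uj'|uj'] := leP u (node t n j).
    by rewrite (_ : _ - _ = S j - (C (t - u) - C (t - node t n j)))//;
      [exact: IH2|rewrite /incr; ring].
  rewrite IH1// add0r (_ : _ - _ = C (t - node t n j) - C (t - u)); last by rewrite /incr;
    ring.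
  by apply: (incr_le t0 dC phiL) => //; exact: ltW.
have [_] := key n.+1 (leqnn _).
rewrite node_last ut => /(_ isT); rewrite subrr C0 subr0.
rewrite /S big_mkord (_ : \sum_(i < n.+1) _ = step_fun C t n u)//.
apply: eq_bigr => i _; rewrite indicE; congr (_ * (nat_of_bool _)%:R).
by apply/idP/idP; rewrite inE /= in_itv/= u0.
Qed.

End step_functions.

(** * Covariance of Brownian motion and the isometry for finite sums *)

Section brownian.
Context d (T : measurableType d) (R : realType) (P : probability T R).
Variable B : R -> T -> R.
Hypothesis BM : brownian_motion P B.
Notation mu := (@lebesgue_measure R).

Let PT : (P setT < +oo)%E. Proof. by rewrite probability_setT ltry. Qed.

Let mBt t : 0 <= t -> measurable_fun setT (B t).
Proof. exact: (bm_measurable BM). Qed.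

Lemma bm_increment_moment2 s t : 0 <= s -> s <= t ->
  (\int[P]_x ((B t x - B s x) ^+ 2)%:E = (t - s)%:E)%E.
Proof.
move=> s0 st; apply: (gaussian_moment2 (X := fun x => B t x - B s x)).
- by apply: measurable_funB; apply: mBt => //; exact: le_trans st.
- by rewrite subr_ge0.
- exact: (bm_gaussian BM s0 st).
Qed.

Lemma bm_moment2 t : 0 <= t -> (\int[P]_x (B t x ^+ 2)%:E = t%:E)%E.
Proof.
move=> t0; rewrite -[in RHS](subr0 t) -bm_increment_moment2//.
have m2 (X : T -> R) : measurable_fun setT X -> measurable_fun setT (fun x => (X x ^+ 2)%:E).
  by move=> mX; apply/measurable_EFinP; exact: measurable_funX.
apply: ae_eq_integral => //.
- exact/m2/mBt.
- by apply: m2; apply: measurable_funB; exact: mBt.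
- by apply: filterS (bm_start BM) => x B0 _; rewrite B0 subr0.
Qed.

Lemma bm_sqint t : 0 <= t -> sqint P setT (B t).
Proof.
move=> t0; split; first exact: mBt.
apply/integrableP; split; first by apply/measurable_EFinP/measurable_funX/mBt.
under eq_integral do rewrite /= ger0_norm ?sqr_ge0//.
by rewrite bm_moment2// ltry.
Qed.

Lemma bm_mean t : 0 <= t -> \int[P]_x B t x = 0.
Proof.
move=> t0; have s0 := bm_sqint (lexx 0); have st := bm_sqint t0.
have sD := sqintB measurableT st s0.
rewrite -(@gaussian_mean _ _ _ P (fun x => B t x - B 0 x) t sD.1 t0).
- rewrite /Rintegral; congr fine; apply: ae_eq_integral => //.
  + by apply/measurable_EFinP; exact: mBt.
  + by apply/measurable_EFinP; exact: sD.1.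
  + by apply: filterS (bm_start BM) => x B0 _; rewrite B0 subr0.
- by have := bm_gaussian BM (lexx 0) t0; rewrite subr0.
- exact: (sqint_integrable measurableT PT sD).
Qed.

(** By polarization, since B s, B t and their difference have known second moments. *)
Lemma bm_covariance s t : 0 <= s -> 0 <= t ->
  \int[P]_x (B s x * B t x) = Num.min s t.
Proof.
wlog st : s t / s <= t => [hw s0 t0|s0 t0].
  have [st|/ltW ts] := leP s t; first by rewrite hw// min_l.
  rewrite -[RHS](min_l ts) -hw//; apply: eq_Rintegral => x _; exact: mulrC.
rewrite min_l//.
have ss := bm_sqint s0; have stt := bm_sqint t0.
have E1 : \int[P]_x (B s x ^+ 2) = s by rewrite /Rintegral bm_moment2.
have E2 : \int[P]_x (B t x ^+ 2) = t by rewrite /Rintegral bm_moment2.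
have E3 : \int[P]_x ((B t x - B s x) ^+ 2) = t - s by rewrite /Rintegral bm_increment_moment2.
have i2 := (sqintB measurableT stt ss).2; have is1 := ss.2; have it := stt.2.
have iD : P.-integrable setT (EFin \o (fun x => B s x ^+ 2 + B t x ^+ 2)).
  by have := integrableD measurableT is1 it; apply: eq_integrable.
have iDD : P.-integrable setT (EFin \o (fun x => B s x ^+ 2 + B t x ^+ 2 - (B t x - B s x) ^+
  2)).
  by have := integrableB measurableT iD i2; apply: eq_integrable.
transitivity (2^-1 * (\int[P]_x (B s x ^+ 2) + \int[P]_x (B t x ^+ 2)
    - \int[P]_x ((B t x - B s x) ^+ 2))); last by rewrite E1 E2 E3; field.
rewrite -RintegralD// -RintegralB// -RintegralZl//.
by apply: eq_Rintegral => x _; field.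
Qed.

Lemma Rintegral_indic_mul (s r t : R) : 0 <= s <= t -> 0 <= r <= t ->
  \int[mu]_(u in `[0, t]) (\1_`[0, s] u * \1_`[0, r] u) = Num.min s r.
Proof.
move=> /andP[s0 st] /andP[r0 rt].
transitivity (\int[mu]_(u in `[0, t]) (\1_`[0, Num.min s r] u) : R).
  apply: eq_Rintegral => u _; rewrite !indicE -natrM mulnb; congr ((nat_of_bool _)%:R).
  have memE (z : R) : (u \in `[0, z]%classic) = (0 <= u <= z).
    by apply/idP/idP; rewrite inE /= in_itv.
  by rewrite !memE le_min; case: (0 <= u).
rewrite /Rintegral integral_indic//.
rewrite (_ : `[0, Num.min s r] `&` `[0, t] = `[0, Num.min s r]%classic); last first.
  apply/seteqP; split=> u /=; first by move=> [].
  rewrite !in_itv/= => /andP[u0 ur]; split; first by rewrite u0.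
  by rewrite u0 (le_trans ur)// ge_min st.
rewrite /= lebesgue_measure_itv/= lte_fin; case: ltP => /= [_|h]; first by rewrite subr0.
by apply/esym/eqP; rewrite eq_le h le_min s0 r0.
Qed.

(** Both sides are the same quadratic form in [a]: values of B at the times s_i and indicators of
    [0, s_i] share the Gram matrix min(s_i, s_j). *)
Lemma bm_isometry (I : finType) (a s : I -> R) t :
  (forall i, 0 <= s i <= t) ->
  \int[P]_x ((\sum_i a i * B (s i) x) ^+ 2) =
  \int[mu]_(u in `[0, t]) ((\sum_i a i * \1_`[0, s i] u) ^+ 2).
Proof.
move=> st; have s0 i : 0 <= s i by have /andP[] := st i.
rewrite (Rintegral_sqr_sum measurableT a (fun i => bm_sqint (s0 i))).
have mt : measurable (`[0, t]%classic : set R) by exact: measurable_itv.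
rewrite Rintegral_sqr_sum//; last first.
  move=> i; split; first exact: measurable_indic.
  apply: (@bounded_itv_integrable _ _ _ 0 t 1) => //.
    by apply: measurable_funTS; apply: measurable_funX; exact: measurable_indic.
  by move=> u _; rewrite indicE; case: (_ \in _); rewrite ?expr1n ?expr0n ?normr1 ?normr0.
by apply: eq_bigr => i _; apply: eq_bigr => j _; rewrite bm_covariance// Rintegral_indic_mul.
Qed.

End brownian.

(** * The kernel C_K in closed form *)

Section memory_kernel.
Variables (R : realType) (alpha : R).
Hypothesis alpha_gt0 : 0 < alpha.
Notation mu := (@lebesgue_measure R).

Definition erlang k (u : R) : R := k`!%:R^-1 * u ^+ k * expR (- alpha * u).

(** The primitive of [erlang k] vanishing at 0, so that C_K is [erlang_int] at index K - 1. The
    recursion integrates the identity erlang_{k+1}' = erlang_k - alpha erlang_{k+1}; unlike the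
    integral, the closed form is differentiable on the whole line. *)
Fixpoint erlang_int k (u : R) : R :=
  if k is k'.+1 then (erlang_int k' u - erlang k u) / alpha
  else (1 - erlang 0 u) / alpha.

Lemma is_derive_expn k (x : R) : is_derive x 1 (fun y : R => y ^+ k) (k%:R * x ^+ k.-1).
Proof.
elim: k => [|k IH]; first by rewrite mul0r; exact: is_derive_cstf.
have h := is_derive_mulf (is_derive_idf x) IH.
rewrite (_ : (fun y => y ^+ k.+1) = (fun y : R => y * y ^+ k)); last first.
  by apply/funext => y; rewrite exprS.
apply: (is_derive_eq h); rewrite mulr1 /= mulrCA -[k.+1%:R]natr1 mulrDl mul1r.
by case: k {IH h} => [|k]; rewrite ?mul0r// -exprS.
Qed.

Lemma is_derive_erlang k (u : R) :
  is_derive u 1 (erlang k) ((if k is k'.+1 then erlang k' u else 0) - alpha * erlang k u).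
Proof.
have dexp := is_derive_compf (is_derive_expR (- alpha * u)) (is_derive_mull (- alpha) u).
have h := is_derive_mulf (is_derive_scalef k`!%:R^-1 (is_derive_expn k u)) dexp.
apply: (is_derive_eq h); rewrite /erlang; case: k {h} => [|k] /=; first by ring.
rewrite factS natrM invfM.
have k0 : k.+1%:R != 0 :> R by rewrite pnatr_eq0.
have kf : k`!%:R != 0 :> R by rewrite pnatr_eq0 -lt0n fact_gt0.
by field; rewrite kf nat1r k0.
Qed.

Lemma is_derive_erlang_int k (u : R) : is_derive u 1 (erlang_int k) (erlang k u).
Proof.
have a0 := lt0r_neq0 alpha_gt0.
elim: k => [|k IH] /=.
  have h := is_derive_mulf (is_derive_subf (is_derive_cstf 1 u) (is_derive_erlang 0 u))
    (is_derive_cstf alpha^-1 u).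
  by apply: (is_derive_eq h); field.
have h := is_derive_mulf (is_derive_subf IH (is_derive_erlang k.+1 u)) (is_derive_cstf
  alpha^-1 u).
by apply: (is_derive_eq h); field.
Qed.

Lemma erlang_int0 k : erlang_int k 0 = 0.
Proof.
elim: k => [|k IH] /=; first by rewrite /erlang fact0 invr1 mulr0 expR0 expr0 !mulr1 subrr
  mul0r.
by rewrite IH /erlang expr0n mulr0 mul0r subrr mul0r.
Qed.

Lemma continuous_erlang k : continuous (erlang k).
Proof. by move=> x; exact: is_derive_continuous (is_derive_erlang k x). Qed.

Lemma continuous_erlang_int k : continuous (erlang_int k).
Proof. by move=> x; exact: is_derive_continuous (is_derive_erlang_int k x). Qed.

Lemma erlang_ge0 k u : 0 <= u -> 0 <= erlang k u.
Proof. by move=> u0; rewrite /erlang !mulr_ge0 ?expR_ge0 ?exprn_ge0// invr_ge0. Qed.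

Lemma erlang_intE k t : 0 <= t ->
  \int[mu]_(u in `[0, t]) erlang k u = erlang_int k t.
Proof.
move=> t0; rewrite (Rintegral_FTC2 t0 (fun x _ => is_derive_erlang_int k x)).
  by rewrite erlang_int0 subr0.
exact: continuous_erlang.
Qed.

Lemma gain_erlang k t : 0 <= t -> gain k.+1 alpha t = erlang_int k t.
Proof.
move=> t0; rewrite -erlang_intE// /gain /= -RintegralZl//.
  by apply: eq_Rintegral => u _; rewrite /erlang -mulrA (mulrC (u ^+ k)).
apply: continuous_itv_integrable => x; apply: is_derive_continuous.
exact: (is_derive_mulf (is_derive_compf (is_derive_expR (- alpha * x)) (is_derive_mull (-
  alpha) x))
  (is_derive_expn k x)).
Qed.

Lemma erlang_int_le k s t : 0 <= s -> s <= t -> erlang_int k s <= erlang_int k t.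
Proof.
move=> s0 st; rewrite -subr_ge0 -(Rintegral_FTC2 st (fun x _ => is_derive_erlang_int k x)).
  apply: Rintegral_ge0 => x; rewrite /= in_itv/= => /andP[sx _].
  by apply: erlang_ge0; exact: le_trans sx.
exact: continuous_erlang.
Qed.

Lemma erlang_int_ge0 k t : 0 <= t -> 0 <= erlang_int k t.
Proof. by move=> t0; rewrite -(erlang_int0 k) erlang_int_le. Qed.

Lemma erlang_int_gt0 k t : 0 < t -> 0 < erlang_int k t.
Proof.
move=> t0; have [||z zin] := @MVT R (erlang_int k) (erlang k) 0 t t0.
- by move=> x _; exact: is_derive_erlang_int.
- by apply: continuous_subspaceT; exact: continuous_erlang_int.
rewrite erlang_int0 !subr0 => ->; move: zin; rewrite in_itv/= => /andP[z0 _].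
by rewrite /erlang !mulr_gt0 ?expR_gt0 ?exprn_gt0// invr_gt0 ltr0n fact_gt0.
Qed.

(** The row c(t) = e_1^T int_0^t exp(sA) ds that multiplies Y_0. *)
Definition erlang_row K (u : R) : 'rV[R]_K := \row_(k < K) erlang_int k u.

(** This is the adjoint equation c A = c' - e_1^T, which cancels the drift in the variation of
    constants. *)
Lemma erlang_row_drift K (u : R) (k : 'I_K) :
  (erlang_row K u *m drift K alpha) 0 k = erlang k u - (k == 0%N :> nat)%:R.
Proof.
have a0 := lt0r_neq0 alpha_gt0.
rewrite mxE; under eq_bigr do rewrite !mxE.
rewrite (bigD1 k)//= eqxx.
have step : \sum_(j < K | j != k) erlang_int j u *
    (if j == k then - alpha else if k == j.+1 :> nat then 1 else 0) =
    if (k : nat) is k'.+1 then erlang_int k' u else 0.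
  case: k => -[|k] kK /=.
    by apply: big1 => j /negbTE ->; rewrite mulr0.
  rewrite (bigD1 (Ordinal (ltnW kK)))/=; last by rewrite -val_eqE/= neq_ltn ltnSn.
  rewrite ifF; last by rewrite -val_eqE/= ltn_eqF.
  rewrite eqxx mulr1 big1 ?addr0// => j /andP[/negbTE -> jk].
  by rewrite ifF ?mulr0//; apply: contra_neqF jk => /eqP[h]; exact/val_inj.
rewrite step; case: (k : nat) => [|k'] /=; last by field.
by rewrite addr0; field.
Qed.

End memory_kernel.

(** * Variation of constants along a single path *)

Section pathwise.
Variable R : realType.
Notation mu := (@lebesgue_measure R).

(** Freezing a path at its initial value for negative times gives the two-sided continuity that the
    differentiation lemmas ask for. *)
Lemma continuous_extend0 (f : R -> R) : {within `[0, +oo[, continuous f} ->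
  continuous (fun x : R => f (Num.max x 0)).
Proof.
move=> /continuous_within_itvcyP[cf f0] x.
have [x0|x0|x0] := ltgtP x (0 : R).
- apply: (@near_cst_continuous _ _ (f 0)); near=> y.
  by rewrite max_r//; apply/ltW; near: y; exact: lt_nbhsl.
- apply/(@cvgrPdist_lt R R^o) => eps eps0; rewrite max_l; last exact: ltW.
  near=> y; rewrite max_l; last by apply/ltW; near: y; exact: lt_nbhsr.
  near: y; have xI : x \in `]0, +oo[ by rewrite in_itv/= x0.
  by have /(@cvgrPdist_lt R R^o) := cf x xI; apply.
- rewrite x0; apply/left_right_continuousP; rewrite maxxx; split.
  + apply/(@cvgrPdist_lt R R^o) => eps eps0; near=> y.
    by rewrite max_r ?subrr ?normr0//; near: y; exact: nbhs_left_le.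
  + apply/(@cvgrPdist_lt R R^o) => eps eps0; near=> y.
    rewrite max_l; last by near: y; exact: nbhs_right_ge.
    by near: y; have /(@cvgrPdist_lt R R^o) := f0; apply.
Unshelve. all: by end_near. Qed.

(** The product F(s) = c(t - s) (y(s) - g0 b(s) e_K) is differentiable although the path is not. By
    the adjoint equation F' = g0 phi(t - s) b(s) - y_1(s) with phi = C_K', and F(t) = 0, F(0) = c(t)
    y(0). *)
Lemma linear_sde_path K (alpha g0 : R) (K_gt0 : (0 < K)%N)
    (y : R -> 'cV[R]_K) (b : R -> R) (t : R) : 0 < alpha -> 0 <= t ->
  (forall k, continuous (fun s => y s k 0)) -> continuous b -> b 0 = 0 ->
  (forall s, 0 <= s -> y s = y 0
     + \col_k \int[mu]_(r in `[0, s]) (drift K alpha *m y r) k 0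
     + (g0 * b s) *: e_last R K) ->
  \int[mu]_(s in `[0, t]) y s (Ordinal K_gt0) 0 =
  (erlang_row alpha K t *m y 0) 0 0
  + g0 * \int[mu]_(s in `[0, t]) (erlang alpha K.-1 (t - s) * b s).
Proof.
move=> a0 t0 cy cb b0 yE.
have clast : (K.-1 < K)%N by rewrite prednK.
pose D k s := (drift K alpha *m y s) k 0.
have DE k s : D k s = \sum_j drift K alpha k j * y s j 0 by rewrite /D mxE.
have cD k : continuous (D k).
  rewrite (_ : D k = fun s => \sum_j drift K alpha k j * y s j 0); last exact/funext/DE.
  by apply: continuous_sumf => j s; apply: cvgM; [exact: cvg_cst|exact: cy].
(* The path without its noise term; starting the integral at -1 makes it differentiable at 0. *)
pose M k s := \int[mu]_(r in `[-1, s]) D k r - \int[mu]_(r in `[-1, 0]) D k r + y 0 k 0.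
have dM k (s : R) : -1 < s -> is_derive s 1 (M k) (D k s).
  move=> s1; have h := is_derive_addf (is_derive_subf (is_derive_Rintegral (cD k) s1)
    (is_derive_cstf (\int[mu]_(r in `[-1, 0]) D k r) s)) (is_derive_cstf (y 0 k 0) s).
  by apply: (is_derive_eq h); rewrite subr0 addr0.
have ME k s : 0 <= s -> M k s = y s k 0 - g0 * b s * e_last R K k 0.
  move=> s0; rewrite (yE s s0) !mxE /M (@Rintegral_itv_split _ _ _ _ 0)//.
  - by rewrite -/(D k); ring.
  - exact: continuous_itv_integrable.
pose c := erlang_row alpha K.
pose F s := \sum_(k < K) erlang_int alpha k (t - s) * M k s.
have dF (s : R) : 0 <= s -> is_derive s 1 F
    (\sum_(k < K) (erlang_int alpha k (t - s) * D k s - erlang alpha k (t - s) * M k s)).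
  move=> s0; have s1 : -1 < s by lra.
  have h := is_derive_sum (fun k : 'I_K => (is_derive_mulf
    (@is_derive_compf R (erlang_int alpha k) (fun s => t - s) s _ _
      (is_derive_erlang_int a0 k (t - s)) (is_derive_csubl t s)) (dM k s s1))).
  rewrite (_ : F = \sum_(k < K) (fun s => erlang_int alpha k (t - s) * M k s)).
    by apply: (is_derive_eq h); apply: eq_bigr => k _; ring.
  by apply/funext => u; rewrite fct_sumE.
pose last := Ordinal clast.
have integrandE s : 0 <= s ->
    \sum_(k < K) (erlang_int alpha k (t - s) * D k s - erlang alpha k (t - s) * M k s) =
    g0 * (erlang alpha K.-1 (t - s) * b s) - y s (Ordinal K_gt0) 0.
  move=> s0; rewrite sumrB.
  have -> : \sum_(k < K) erlang_int alpha k (t - s) * D k s =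
      \sum_(k < K) (erlang alpha k (t - s) - (k == 0%N :> nat)%:R) * y s k 0.
    transitivity ((c (t - s) *m (drift K alpha *m y s)) 0 0).
      by rewrite [RHS]mxE; apply: eq_bigr => k _; rewrite mxE.
    rewrite mulmxA [LHS]mxE; apply: eq_bigr => k _.
    by rewrite -erlang_row_drift.
  rewrite -sumrB.
  transitivity (\sum_(k < K) ((g0 * (erlang alpha k (t - s) * b s)) * (k == last)%:R -
      y s k 0 * (k == Ordinal K_gt0)%:R)).
    apply: eq_bigr => k _; rewrite ME// mxE.
    have -> : (k.+1 == K) = (k == last).
      by rewrite -val_eqE/= -(eqSS k) prednK.
    have -> : (k == 0%N :> nat) = (k == Ordinal K_gt0) by [].
    ring.
  rewrite sumrB; congr (_ - _).
    by rewrite (bigD1 last)//= ?eqxx mulr1 big1 ?addr0// => k /negbTE ->; rewrite mulr0.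
  by rewrite (bigD1 (Ordinal K_gt0))//= ?eqxx mulr1 big1 ?addr0// => k /negbTE ->;
    rewrite mulr0.
have cer : continuous (fun s => erlang alpha K.-1 (t - s) * b s).
  move=> s; apply: cvgM; last exact: cb.
  have ds := @is_derive_compf R (erlang alpha K.-1) (fun s => t - s) s _ _
    (is_derive_erlang alpha K.-1 (t - s)) (is_derive_csubl t s).
  exact: is_derive_continuous ds.
have FTC : \int[mu]_(s in `[0, t]) (g0 * (erlang alpha K.-1 (t - s) * b s) - y s (Ordinal
  K_gt0) 0) =
    F t - F 0.
  apply: Rintegral_FTC2 => //.
    by move=> s /andP[s0 _]; rewrite -integrandE//; exact: dF.
  by move=> s; apply: cvgB; [apply: cvgM; [exact: cvg_cst|exact: cer]|exact: cy].
have Ft : F t = 0 by rewrite /F subrr; apply: big1 => k _; rewrite erlang_int0 mul0r.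
have F0 : F 0 = (c t *m y 0) 0 0.
  rewrite /F subr0 mxE; apply: eq_bigr => k _; rewrite ME// b0 mulr0 mul0r subr0.
  by rewrite mxE.
move: FTC; rewrite Ft F0 RintegralB//; last 2 first.
- apply: continuous_itv_integrable => s; apply: cvgM; [exact: cvg_cst|exact: cer].
- exact: continuous_itv_integrable.
rewrite RintegralZl//; last exact: continuous_itv_integrable.
move: (\int[mu]_(s in `[0, t]) (erlang alpha K.-1 (t - s) * b s)) (\int[mu]_(s in `[0, t]) y s
  _ 0) ((c t *m y 0) 0 0).
by move=> u v w; lra.
Qed.

End pathwise.

(** * The invariant covariance, and positivity of the contribution of Y_0 *)

Section stationary_covariance.
Variables (R : realType) (K : nat) (alpha g0 : R).
Hypothesis alpha_gt0 : 0 < alpha.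
Notation mu := (@lebesgue_measure R).

(** The sum has one term, or none in the last row; this form avoids a case distinction on [i]. *)
Lemma drift_mulE (v : 'cV[R]_K) (i : 'I_K) :
  (drift K alpha *m v) i 0 = - alpha * v i 0 +
    \sum_(j < K | val j == (val i).+1) v j 0.
Proof.
rewrite mxE (bigD1 i)//= mxE eqxx; congr (_ + _).
rewrite [RHS](bigID (fun j => j == i))/= [X in _ = X + _]big1 ?add0r; last first.
  by move=> j /andP[/eqP ij /eqP ji]; move: ij; rewrite ji => /n_Sn.
rewrite [RHS]big_mkcond/= big_mkcond/=; apply: eq_bigr => j _.
rewrite mxE (eq_sym i j); case: (j == i); first by rewrite andbF.
by rewrite andbT /=; case: ifP => _; rewrite ?mul1r ?mul0r.
Qed.

(** Binomial expansion of (-alpha + N)^k with N the shift: only the power K - 1 - i of N reaches the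
    last column from row i. The induction is Pascal's rule, and for small k the truncated exponent
    is harmless because the binomial coefficient is 0. *)
Lemma drift_power (t : R) k (i l : 'I_K) : val l = K.-1 ->
  ((t *: drift K alpha) ^+ k) i l =
  'C(k, K.-1 - i)%:R * (- alpha) ^+ (k - (K.-1 - i)) * t ^+ k.
Proof.
move=> lK; have K0 : (0 < K)%N by exact: (leq_ltn_trans (leq0n l) (ltn_ord l)).
have iK (j : 'I_K) : (j <= K.-1)%N by rewrite -ltnS prednK.
elim: k i => [|k IH] i.
  rewrite !expr0 !mulr1 mxE bin0n; congr ((nat_of_bool _)%:R).
  by rewrite subn_eq0 -val_eqE/= lK eqn_leq iK/=.
have -> : ((t *: drift K alpha) ^+ k.+1) i l =
    t * (drift K alpha *m col l ((t *: drift K alpha) ^+ k)) i 0.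
  rewrite exprS -mulmxE -scalemxAl mxE; congr (_ * _).
  rewrite [LHS]mxE [RHS]mxE; apply: eq_bigr => j _; congr (_ * _).
  by rewrite [RHS]mxE.
rewrite drift_mulE mxE IH.
have [m0|m0] := leqP K.-1 i.
  rewrite big1 ?addr0; last first.
    by move=> j /eqP ji; move: (iK j); rewrite ji ltnNge m0.
  rewrite (_ : (K.-1 - i)%N = 0%N) ?bin0 ?subn0; last by apply/eqP; rewrite subn_eq0.
  by rewrite !exprS; ring.
have iK1 : (i.+1 < K)%N by rewrite -[ltnRHS]prednK.
rewrite (big_pred1 (Ordinal iK1)); last by move=> j; rewrite /= -val_eqE.
rewrite mxE IH /= subnS; move: (K.-1 - i)%N (subn_gt0 i K.-1) => m; rewrite m0.
case: m => // m _ /=; rewrite binS natrD subSS.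
have [km|km] := ltnP m k; last first.
  rewrite bin_small ?ltnS// mul0r add0r !mul0r mulr0 add0r.
  by rewrite exprS; ring.
by rewrite -(subnSK km) !exprS; ring.
Qed.

(** The first m = K - 1 - i terms of the series vanish; after an index shift, the remaining ones are
    t^m / m! times the exponential series of -alpha t. *)
Lemma mexp_drift_last (t : R) (i l : 'I_K) : val l = K.-1 ->
  mexp (t *: drift K alpha) i l = erlang alpha (K.-1 - i) t.
Proof.
move=> lK; rewrite mxE; set m := (K.-1 - i)%N.
apply/cvg_lim => //; rewrite -(cvg_shiftn m).
have E n : series (fun k => ((t *: drift K alpha) ^+ k) i l / k`!%:R) (n + m)%N =
    m`!%:R^-1 * t ^+ m * series (exp_coeff (- alpha * t)) n.
  rewrite /series /= addnC (@big_cat_nat _ _ _ m)//=; last exact: leq_addr.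
  rewrite big1_seq ?add0r; last first.
    move=> k; rewrite mem_index_iota => /andP[_ km].
    by rewrite drift_power// bin_small// !mul0r.
  rewrite -{1}[m]add0n big_addn addKn mulr_sumr.
  apply: eq_bigr => k _; rewrite drift_power// -/m addnK /exp_coeff /= exprMn exprD.
  have := bin_fact (leq_addl k m); rewrite addnK => /(congr1 (fun x => x%:R : R)).
  rewrite !natrM.
  have f0 (n' : nat) : n'`!%:R != 0 :> R by rewrite pnatr_eq0 -lt0n fact_gt0.
  move=> H; rewrite -H; field.
  by rewrite !f0 pnatr_eq0 -lt0n bin_gt0 leq_addl.
under eq_fun do rewrite E.
rewrite /erlang; apply: cvgM; first exact: cvg_cst.
exact: is_cvg_series_exp_coeff.
Qed.

Lemma trmx_exp (M : 'M[R]_K) k : M^T ^+ k = (M ^+ k)^T.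
Proof.
elim: k => [|k IH]; first by rewrite !expr0 trmx1.
by rewrite exprS exprSr IH -!mulmxE trmx_mul.
Qed.

Lemma mexp_tr (M : 'M[R]_K) : mexp M^T = (mexp M)^T.
Proof.
apply/matrixP => i j; rewrite !mxE; congr (limn (series _)).
by apply/funext => k; rewrite trmx_exp mxE.
Qed.

Hypothesis K_gt0 : (0 < K)%N.
Let last : 'I_K := Ordinal (eq_leq (prednK K_gt0)).

Lemma mulmx_e_last (M : 'M[R]_K) i : (M *m e_last R K) i 0 = M i last.
Proof.
rewrite mxE (bigD1 last)//= mxE /= prednK// eqxx mulr1 big1 ?addr0// => j jl.
rewrite mxE (_ : (j.+1 == K) = false) ?mulr0//; apply: contraNF jl => /eqP jK.
apply/eqP/val_inj => /=; by rewrite -[val j]/(val j).+1.-1 jK.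
Qed.

Lemma invariant_covE i j : invariant_cov K alpha g0 i j =
  g0 ^+ 2 * \int[mu]_(t in `[0, +oo[) (erlang alpha (K.-1 - i) t * erlang alpha (K.-1 - j) t).
Proof.
rewrite /invariant_cov 2!mxE; congr (_ * _); apply: eq_Rintegral => t _.
have -> : t *: (drift K alpha)^T = (t *: drift K alpha)^T by rewrite linearZ.
rewrite mexp_tr -mulmxA -trmx_mul mxE big_ord1 [X in _ * X]mxE.
by rewrite !mulmx_e_last !mexp_drift_last.
Qed.

Lemma invariant_cov_ge0 i j : 0 <= invariant_cov K alpha g0 i j.
Proof.
rewrite invariant_covE mulr_ge0 ?sqr_ge0//; apply: Rintegral_ge0 => t.
by rewrite /= in_itv/= andbT => t0; rewrite mulr_ge0// erlang_ge0.
Qed.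

(** The corner entry is g0^2 times the integral of exp(-2 alpha t), that is g0^2 / (2 alpha). *)
Lemma invariant_cov_last_gt0 : g0 != 0 -> 0 < invariant_cov K alpha g0 last last.
Proof.
move=> g00; rewrite invariant_covE /= subnn mulr_gt0//.
  by rewrite lt_neqAle sqr_ge0 eq_sym sqrf_eq0 g00.
have E t : erlang alpha 0 t * erlang alpha 0 t = expR (- (2 * alpha) * t).
  by rewrite /erlang fact0 invr1 expr0 !mul1r -expRD; congr expR; ring.
under eq_Rintegral do rewrite E.
have a2 : 0 < 2 * alpha by rewrite mulr_gt0.
have dF (x : R) : is_derive x 1 (fun t => - (2 * alpha)^-1 * expR (- (2 * alpha) * t))
    (expR (- (2 * alpha) * x)).
  have h := is_derive_scalef (- (2 * alpha)^-1)
    (is_derive_compf (is_derive_expR (- (2 * alpha) * x)) (is_derive_mull (- (2 * alpha)) x)).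
  by apply: (is_derive_eq h); field; exact: lt0r_neq0.
have cexp : continuous (fun t : R => expR (- (2 * alpha) * t)).
  move=> x; exact: is_derive_continuous
    (is_derive_compf (is_derive_expR (- (2 * alpha) * x)) (is_derive_mull (- (2 * alpha)) x)).
rewrite (@Rintegral_ge0_continuous_FTC2y _ _
  (fun t => - (2 * alpha)^-1 * expR (- (2 * alpha) * t)) 0 0).
- by rewrite mulr0 expR0 mulr1 sub0r opprK invr_gt0.
- by move=> x _; exact: expR_ge0.
- exact: continuous_subspaceT.
- rewrite -[X in _ --> X](mulr0 (- (2 * alpha)^-1)); apply: cvgM; first exact: cvg_cst.
  rewrite (_ : (fun x => expR _) = (fun x => expR (- x)) \o (fun x => 2 * alpha * x));
    last first.
    by apply/funext => x /=; rewrite mulNr.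
  apply: cvg_comp (@cvgr_expR R); apply: gt0_cvgMry => //.
- by move=> x _; have [] := dF x.
- by apply: cvg_at_right_filter; exact: is_derive_continuous (dF 0).
- by move=> x _; rewrite derive1E; have [] := dF x.
Qed.

(** All entries of the row and of the covariance are nonnegative, so the quadratic form is at least
    its corner term; positivity of that one term replaces positive definiteness. *)
Lemma erlang_cov_gt0 t : g0 != 0 -> 0 < t ->
  0 < (erlang_row alpha K t *m invariant_cov K alpha g0 *m (erlang_row alpha K t)^T) 0 0.
Proof.
move=> g00 t0; rewrite mxE.
have ge0 i : 0 <= (erlang_row alpha K t *m invariant_cov K alpha g0) 0 i.
  rewrite mxE; apply: sumr_ge0 => j _; rewrite mxE mulr_ge0 ?invariant_cov_ge0//.
  by apply: erlang_int_ge0 => //; exact: ltW.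
rewrite (bigD1 last)//= ltr_pwDl//; last first.
  apply: sumr_ge0 => i _; rewrite [X in _ * X]mxE [X in _ * X]mxE mulr_ge0//.
  by apply: erlang_int_ge0 => //; exact: ltW.
rewrite [X in _ * X]mxE [X in _ * X]mxE mulr_gt0 ?erlang_int_gt0//.
rewrite mxE (bigD1 last)//= ltr_pwDl//.
  by rewrite mxE mulr_gt0 ?erlang_int_gt0 ?invariant_cov_last_gt0.
apply: sumr_ge0 => j _; rewrite mxE mulr_ge0 ?invariant_cov_ge0//.
by apply: erlang_int_ge0 => //; exact: ltW.
Qed.

Lemma erlang_row0 : erlang_row alpha K 0 = 0.
Proof. by apply/rowP => k; rewrite !mxE erlang_int0. Qed.

End stationary_covariance.

(** * Finite sums approximating the Wiener integral of C(t - s) *)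

Section wiener_sums.
Context d (T : measurableType d) (R : realType) (P : probability T R).
Variable B : R -> T -> R.
Hypothesis BM : brownian_motion P B.
Notation mu := (@lebesgue_measure R).
Variables (C phi : R -> R) (t L : R).
Hypotheses (t_ge0 : 0 <= t) (dC : forall x : R, is_derive x 1 C (phi x))
  (phi_le : forall x, 0 <= x <= t -> `|phi x| <= L) (C0 : C 0 = 0).

(** By Abel summation, with C 0 = 0 and B 0 = 0, this is the left-endpoint sum of C(t - s_i)
    (B(s_{i+1}) - B(s_i)). The present form involves values of B only, and is also a
    Riemann-Stieltjes sum for the path integral of phi(t - s) B_s. *)
Definition wiener_sum n (x : T) : R :=
  \sum_(i < n.+1) incr C t n i * B (node t n i.+1) x.

Let node_itv n (i : 'I_n.+1) : 0 <= node t n i.+1 <= t.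
Proof.
apply/andP; split; first by rewrite -(node0 t n) node_le.
by rewrite -[leRHS](node_last t n) node_le.
Qed.

Let PT : (P setT < +oo)%E. Proof. by rewrite probability_setT ltry. Qed.

Let mt : measurable (`[0, t]%classic : set (measurableTypeR R)). Proof. exact: measurable_itv.
  Qed.

Let mu_t : (mu `[0%R, t] < +oo)%E.
Proof. by rewrite /= lebesgue_measure_itv/=; case: ifP => // _; rewrite -EFinB ltry. Qed.

Lemma sqint_step_fun n : sqint mu `[0, t] (step_fun C t n).
Proof.
apply: sqint_sum => // i; apply: sqintZ => //; split; first exact: measurable_indic.
apply: (@bounded_itv_integrable _ _ _ 0 t 1) => //.
  by apply: measurable_funTS; apply: measurable_funX; exact: measurable_indic.
by move=> u _; rewrite indicE; case: (_ \in _); rewrite ?expr1n ?expr0n ?normr1 ?normr0.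
Qed.

Lemma sqint_wiener_sum n : sqint P setT (wiener_sum n).
Proof.
apply: sqint_sum => // i; apply: sqintZ => //; apply: (bm_sqint BM).
by have /andP[] := node_itv i.
Qed.

Lemma wiener_sum_mean n : \int[P]_x wiener_sum n x = 0.
Proof.
have s0 (i : 'I_n.+1) : 0 <= node t n i.+1 by have /andP[] := node_itv i.
have iB (i : 'I_n.+1) := sqint_integrable measurableT PT (bm_sqint BM (s0 i)).
rewrite /wiener_sum Rintegral_sum//.
  by apply: big1 => i _; rewrite RintegralZl// (bm_mean BM)// mulr0.
move=> i; have := integrableZl measurableT (incr C t n i) (iB i).
exact: eq_integrable.
Qed.

Lemma wiener_sum_moment2 n :
  \int[P]_x (wiener_sum n x ^+ 2) = \int[mu]_(u in `[0, t]) (step_fun C t n u ^+ 2).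
Proof.
exact: (@bm_isometry _ _ _ _ _ BM 'I_n.+1 (fun i => incr C t n i)
  (fun i => node t n i.+1) t (@node_itv n)).
Qed.

(** The difference is a single finite sum over the disjoint union of the two grids, with opposite
    coefficients on the second, so the isometry applies once. *)
Lemma wiener_sum_dist n m :
  \int[P]_x ((wiener_sum n x - wiener_sum m x) ^+ 2) =
  \int[mu]_(u in `[0, t]) ((step_fun C t n u - step_fun C t m u) ^+ 2).
Proof.
pose a (z : 'I_n.+1 + 'I_m.+1) :=
  match z with inl i => incr C t n i | inr j => - incr C t m j end.
pose s (z : 'I_n.+1 + 'I_m.+1) :=
  match z with inl i => node t n i.+1 | inr j => node t m j.+1 end.
have st z : 0 <= s z <= t by case: z => i; exact: node_itv.
have := bm_isometry BM a st.
rewrite (_ : (fun x => (\sum_i a i * B (s i) x) ^+ 2) =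
    (fun x => (wiener_sum n x - wiener_sum m x) ^+ 2)); last first.
  apply/funext => x; rewrite big_sumType/= /wiener_sum -sumrN; congr ((_ + _) ^+ 2).
  by apply: eq_bigr => i _; rewrite mulNr.
rewrite (_ : (fun u => (\sum_i a i * \1_`[0, s i] u) ^+ 2) =
    (fun u => (step_fun C t n u - step_fun C t m u) ^+ 2))//.
apply/funext => u; rewrite big_sumType/= /step_fun -sumrN; congr ((_ + _) ^+ 2).
by apply: eq_bigr => i _; rewrite mulNr.
Qed.

Let h n := L * (t / n.+1%:R).

Let near_C n u : 0 <= u <= t -> `|step_fun C t n u - C (t - u)| <= h n.
Proof. exact: step_fun_near. Qed.

Let L_ge0 : 0 <= L.
Proof. by apply: le_trans (phi_le (x := 0) _); rewrite ?lexx. Qed.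

(** Both step functions lie within [h n] of the same function C (t - u) on an interval of length
    t. *)
Lemma wiener_sum_cauchy n m : (n <= m)%N ->
  \int[P]_x ((wiener_sum n x - wiener_sum m x) ^+ 2) <= (2 * h n) ^+ 2 * t.
Proof.
move=> nm; rewrite wiener_sum_dist.
have sB := sqintB mt (sqint_step_fun n) (sqint_step_fun m).
apply: (@le_trans _ _ (\int[mu]_(u in `[0, t]) ((2 * h n) ^+ 2))).
  apply: le_Rintegral => //; first exact: sB.2.
    exact/continuous_itv_integrable/cst_continuous.
  move=> u; rewrite /= in_itv/= => ut.
  have h1 := near_C n ut; have h2 := near_C m ut.
  have hh : h m <= h n.
    rewrite /h ler_wpM2l// ler_wpM2l// lef_pV2 ?posrE ?ltr0n// ler_nat.
    by rewrite ltnS.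
  rewrite -[leLHS](real_normK (num_real _)); apply: lerXn2r; rewrite ?nnegrE//.
    by rewrite mulr_ge0// (le_trans _ h1).
  have := ler_distD (C (t - u)) (step_fun C t n u) (step_fun C t m u).
  rewrite (distrC (C (t - u)) (step_fun C t m u)); lra.
rewrite Rintegral_cst//= lebesgue_measure_itv/= lte_fin.
by case: ltP => h0 /=; rewrite ?subr0// mulr0 mulr_ge0// sqr_ge0.
Qed.

Lemma wiener_sum_moment2_cvg :
  \int[P]_x (wiener_sum n x ^+ 2) @[n --> \oo] -->
  \int[mu]_(u in `[0, t]) (C (t - u) ^+ 2).
Proof.
have cC : continuous (fun u => C (t - u)).
  move=> u; have du := @is_derive_compf R C (fun s => t - s) u _ _ (dC (t - u))
    (is_derive_csubl t u).
  exact: is_derive_continuous du.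
have cC2 : continuous (fun u => C (t - u) ^+ 2).
  by move=> u; apply: (cvgM (cC u) (cC u)).
have sC : sqint mu `[0, t] (fun u => C (t - u)).
  split; first by apply: measurable_funTS; exact: continuous_measurable_fun.
  exact: continuous_itv_integrable.
have [z _ zmax] := EVT_max t_ge0 (continuous_subspaceT cC2).
(* A bound for 2 |C (t - u)|, by |a| <= a^2 + 1. *)
pose M := 2 * (C (t - z) ^+ 2 + 1).
have bound n : `|\int[P]_x (wiener_sum n x ^+ 2) - \int[mu]_(u in `[0, t]) (C (t - u) ^+ 2)| <=
    (h n * M + h n ^+ 2) * t.
  have sf := sqint_step_fun n.
  have i1 := sf.2; have i2 := sC.2.
  have iD : mu.-integrable `[0, t] (EFin \o (fun u => step_fun C t n u ^+ 2 - C (t - u) ^+ 2)).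
    by have := integrableB mt i1 i2; apply: eq_integrable.
  rewrite wiener_sum_moment2 -RintegralB//.
  apply: (le_trans (le_normr_Rintegral mt iD)).
  apply: (@le_trans _ _ (\int[mu]_(u in `[0, t]) (h n * M + h n ^+ 2))).
    apply: le_Rintegral => //.
    - by have /= := integrable_norm iD.
    - exact/continuous_itv_integrable/cst_continuous.
    move=> u; rewrite /= in_itv/= => ut; have h1 := near_C n ut.
    have Cz : C (t - u) ^+ 2 <= C (t - z) ^+ 2 by apply: zmax; rewrite in_itv.
    have h0 : 0 <= h n by exact: le_trans h1.
    set a := C (t - u) in h1 Cz *; set w := step_fun C t n u - a in h1.
    have -> : step_fun C t n u ^+ 2 - a ^+ 2 = w * (2 * a) + w ^+ 2 by rewrite /w; ring.
    apply: (le_trans (ler_normD _ _)); apply: lerD.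
      rewrite normrM; apply: ler_pM => //.
      rewrite normrM ger0_norm// /M ler_pM2l//.
      apply: (@le_trans _ _ (a ^+ 2 + 1)); last by rewrite lerD2r.
      rewrite -(real_normK (num_real a)).
      by have := sqr_ge0 (`|a| - 1); have := normr_ge0 a; move: `|a| => v; lra.
    by rewrite normrX; apply: lerXn2r; rewrite ?nnegrE.
  rewrite Rintegral_cst//= lebesgue_measure_itv/= lte_fin.
  case: ltP => t0 /=; first by rewrite subr0.
  by rewrite mulr0 (_ : t = 0) ?mulr0//; apply/eqP; rewrite eq_le t0.
have h_cvg : h n @[n --> \oo] --> 0.
  rewrite /h -[X in _ --> X](mulr0 L); apply: cvgM; first exact: cvg_cst.
  rewrite -[X in _ --> X](mulr0 t); apply: cvgM; first exact: cvg_cst.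
  exact: cvg_harmonic.
have bound_cvg : (h n * M + h n ^+ 2) * t @[n --> \oo] --> 0.
  rewrite (_ : 0 = (0 * M + 0 * 0) * t); last by rewrite !mul0r addr0 mul0r.
  apply: cvgM; last exact: cvg_cst.
  by apply: cvgD; [apply: cvgM => //; exact: cvg_cst|exact: (cvgM h_cvg h_cvg)].
apply/(@cvgrPdist_le R R^o) => eps eps0.
near=> n; rewrite distrC; apply: (le_trans (bound n)); apply: (le_trans (ler_norm _)).
rewrite -normrN -sub0r; near: n.
by have /(@cvgrPdist_le R R^o) := bound_cvg; apply.
Unshelve. all: by end_near. Qed.

Lemma wiener_sum_rate_cvg : (2 * h n) ^+ 2 * t @[n --> \oo] --> 0.
Proof.
have h_cvg : 2 * h n @[n --> \oo] --> 0.
  rewrite -[X in _ --> X](mulr0 2); apply: cvgM; first exact: cvg_cst.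
  rewrite /h -[X in _ --> X](mulr0 L); apply: cvgM; first exact: cvg_cst.
  rewrite -[X in _ --> X](mulr0 t); apply: cvgM; first exact: cvg_cst.
  exact: cvg_harmonic.
rewrite (_ : 0 = 0 * 0 * t); last by rewrite !mul0r.
by apply: cvgM; [exact: (cvgM h_cvg h_cvg)|exact: cvg_cst].
Qed.

End wiener_sums.

(** * The variance of the time integral of the first coordinate *)

Section ou_variance.
Context (R : realType) (K : nat) (dT : measure_display) (T : measurableType dT).
Variables (P : probability T R) (alpha g0 : R) (B : R -> T -> R) (Y : R -> T -> 'cV[R]_K).
Hypotheses (alpha_gt0 : 0 < alpha) (g0_neq0 : g0 != 0) (K_gt0 : (0 < K)%N).
Hypothesis OU : stationary_OU P alpha g0 B Y.
Notation mu := (@lebesgue_measure R).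
Let S := invariant_cov K alpha g0.
Let BM := ou_brownian OU.
Let PT : (P setT < +oo)%E. Proof. by rewrite probability_setT ltry. Qed.

Lemma row_mean_law (u : 'rV[R]_K) :
  has_law P (fun x => (u *m Y 0 x) 0 0) (gaussian 0 ((u *m S *m u^T) 0 0)).
Proof. by have := ou_initial OU u; rewrite mulmx0 mxE. Qed.

Lemma measurable_row (u : 'rV[R]_K) : measurable_fun setT (fun x => (u *m Y 0 x) 0 0).
Proof.
under eq_fun do rewrite mxE.
apply: measurable_sum => k; apply: measurable_funM => //.
exact: (ou_measurable OU).
Qed.

(** Nonnegativity of the variance is assumed here; each use derives it from the nonnegative entries
    of [S]. *)
Lemma row_sqint (u : 'rV[R]_K) : 0 <= (u *m S *m u^T) 0 0 ->
  sqint P setT (fun x => (u *m Y 0 x) 0 0).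
Proof.
move=> u0; have mu_ := measurable_row u; split=> //.
apply/integrableP; split; first by apply/measurable_EFinP; exact: measurable_funX.
under eq_integral do rewrite /= ger0_norm ?sqr_ge0//.
by rewrite (gaussian_moment2 mu_ u0 (row_mean_law u)) ltry.
Qed.

Lemma coord_sqint k : sqint P setT (fun x => Y 0 x k 0).
Proof.
have := @row_sqint (delta_mx 0 k).
rewrite (_ : (fun x => _) = (fun x => Y 0 x k 0)); last first.
  apply/funext => x; rewrite mxE (bigD1 k)//= mxE !eqxx mul1r big1 ?addr0// => j jk.
  by rewrite mxE (negbTE jk) andbF mul0r.
apply; rewrite mxE (bigD1 k)//= big1 ?addr0 => [|j jk]; last first.
  by rewrite [X in _ * X]mxE [X in _ * X]mxE (negbTE jk) andbF mulr0.
rewrite [X in _ * X]mxE [X in _ * X]mxE !eqxx mulr1 mxE; apply: sumr_ge0 => j _.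
by rewrite mxE mulr_ge0// (invariant_cov_ge0 _ _ K_gt0).
Qed.

Lemma coord_noise_cov k s : 0 <= s -> \int[P]_x (Y 0 x k 0 * B s x) = 0.
Proof.
move=> s0; rewrite (expectation_mul_independent (coord_sqint k) (bm_sqint BM s0)).
  by rewrite (bm_mean BM)// mulr0.
move=> A D mA mD; apply: (ou_independent OU); apply: sub_sigma_algebra.
  by exists k, A; split.
by exists s, D; split.
Qed.

Variable t : R.
Hypothesis t_ge0 : 0 <= t.
Let c := erlang_row alpha K t.
Let C := erlang_int alpha K.-1.
Let phi := erlang alpha K.-1.
Let W := wiener_sum B C t.
Let Z0 x := (c *m Y 0 x) 0 0.

Lemma erlang_cov_ge0 : 0 <= (c *m S *m c^T) 0 0.
Proof.
move: t_ge0; rewrite le_eqVlt => /predU1P[t0|t0].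
  by rewrite /c -t0 erlang_row0 !mul0mx mxE.
by apply/ltW; exact: erlang_cov_gt0.
Qed.

Lemma row_noise_cov n : \int[P]_x (Z0 x * W n x) = 0.
Proof.
have s0 (i : 'I_n.+1) : 0 <= node t n i.+1 by rewrite -(node0 t n) node_le.
have iYB k (i : 'I_n.+1) := sqint_mul measurableT (coord_sqint k) (bm_sqint BM (s0 i)).
have iY2 k (i : 'I_n.+1) : P.-integrable setT (EFin \o (fun x =>
    c 0 k * incr C t n i * (Y 0 x k 0 * B (node t n i.+1) x))).
  have := integrableZl measurableT (c 0 k * incr C t n i) (iYB k i).
  by apply: eq_integrable => // x _ /=; rewrite -EFinM.
transitivity (\int[P]_x (\sum_k \sum_(i < n.+1)
    c 0 k * incr C t n i * (Y 0 x k 0 * B (node t n i.+1) x))).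
  apply: eq_Rintegral => x _; rewrite /Z0 /W /wiener_sum mxE big_distrlr/=.
  by apply: eq_bigr => k _; apply: eq_bigr => i _; ring.
rewrite Rintegral_sum//; last first.
  move=> k; have := @integrable_sum _ _ _ P setT measurableT _ (index_enum 'I_n.+1) xpredT _
    (fun i _ => iY2 k i).
  by apply: eq_integrable => // x _ /=; rewrite sumEFin.
apply: big1 => k _; rewrite Rintegral_sum//; apply: big1 => i _.
by rewrite RintegralZl// coord_noise_cov// mulr0.
Qed.

Let dC (x : R) : is_derive x 1 C (phi x).
Proof. exact: is_derive_erlang_int. Qed.

Lemma ou_path : exists G : set T, [/\ measurable G, P (~` G) = 0%E &
  forall x, G x ->
    Z0 x + g0 * W n x @[n --> \oo] -->
    \int[mu]_(s in `[0, t]) Y s x (Ordinal K_gt0) 0].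
Proof.
have : {ae P, forall x, [/\ (forall k, {within `[0, +oo[, continuous (fun t => Y t x k 0)}),
    (forall t, 0 <= t -> Y t x = Y 0 x
      + \col_k \int[mu]_(s in `[0, t]) (drift K alpha *m Y s x) k 0
      + (g0 * B t x) *: e_last R K), B 0 x = 0 &
    {within `[0, +oo[, continuous (fun t => B t x)}]}.
  have h1 := ou_continuous OU; have h2 := ou_equation OU.
  have h3 := bm_start BM; have h4 := bm_continuous BM.
  near=> x; split; near: x => //.
move=> [N [mN N0 sub]]; exists (~` N); split.
- exact: measurableC.
- by rewrite setCK.
move=> x Nx.
have [cY eqY B0 cB] : [/\ (forall k, {within `[0, +oo[, continuous (fun t => Y t x k 0)}),
    (forall t, 0 <= t -> Y t x = Y 0 x
      + \col_k \int[mu]_(s in `[0, t]) (drift K alpha *m Y s x) k 0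
      + (g0 * B t x) *: e_last R K), B 0 x = 0 &
    {within `[0, +oo[, continuous (fun t => B t x)}].
  by apply: contrapT => H; apply: Nx; exact: sub.
pose y s := Y (Num.max s 0) x; pose b s := B (Num.max s 0) x.
have yY s : 0 <= s -> y s = Y s x by move=> s0; rewrite /y max_l.
have bB s : 0 <= s -> b s = B s x by move=> s0; rewrite /b max_l.
have cy k : continuous (fun s => y s k 0) by exact: (continuous_extend0 (f := fun s => Y s x k
  0) (cY k)).
have cb : continuous b by exact: (continuous_extend0 (f := B ^~ x) cB).
have b0 : b 0 = 0 by rewrite bB.
have yE s : 0 <= s -> y s = y 0
     + \col_k \int[mu]_(r in `[0, s]) (drift K alpha *m y r) k 0
     + (g0 * b s) *: e_last R K.
  move=> s0; rewrite bB// !yY// {1}eqY//; congr (_ + _ + _).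
  apply/colP => k; rewrite !mxE; apply: eq_Rintegral => r.
  by rewrite inE/= in_itv/= => /andP[r0 _]; rewrite yY.
have -> : \int[mu]_(s in `[0, t]) Y s x (Ordinal K_gt0) 0 =
    \int[mu]_(s in `[0, t]) y s (Ordinal K_gt0) 0.
  by apply: eq_Rintegral => s; rewrite inE/= in_itv/= => /andP[s0 _]; rewrite yY.
rewrite (linear_sde_path K_gt0 alpha_gt0 t_ge0 cy cb b0 yE) yY// -/(Z0 x).
have cphi : continuous phi by exact: continuous_erlang.
have [z _ zmax] := EVT_max t_ge0 (continuous_subspaceT cphi).
have phi_le u : 0 <= u <= t -> `|phi u| <= phi z.
  move=> ut; rewrite ger0_norm; first by apply: zmax; rewrite in_itv.
  by apply: erlang_ge0; case/andP: ut.
have S_cvg := stieltjes_sum_cvg t_ge0 dC cphi phi_le cb.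
apply: cvgD; first exact: cvg_cst.
apply: cvgM; first exact: cvg_cst.
rewrite (_ : (fun n => W n x) = (fun n => \sum_(i < n.+1) incr C t n i * b (node t n i.+1)))//.
apply/funext => n; apply: eq_bigr => i _; congr (_ * _); rewrite bB//.
by rewrite -(node0 t n) node_le.
Unshelve. all: by end_near. Qed.

(** The approximations split into a part from Y_0 and a noise part. The cross term vanishes by
    independence, and the isometry gives the limit of the noise part. *)
Lemma OU_varianceE : OU_variance K_gt0 P Y t =
  (c *m S *m c^T) 0 0 + g0 ^+ 2 * \int[mu]_(u in `[0, t]) (C u ^+ 2).
Proof.
have cphi : continuous phi by exact: continuous_erlang.
have C0 : C 0 = 0 by exact: erlang_int0.
have [z _ zmax] := EVT_max t_ge0 (continuous_subspaceT cphi).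
have phi_le u : 0 <= u <= t -> `|phi u| <= phi z.
  move=> ut; rewrite ger0_norm; first by apply: zmax; rewrite in_itv.
  by apply: erlang_ge0; case/andP: ut.
have [G [mG G0 Gcvg]] := ou_path.
have sZ0 : sqint P setT Z0 by apply: row_sqint; exact: erlang_cov_ge0.
have sW n : sqint P setT (W n) by exact: sqint_wiener_sum.
have iZ0 := sqint_integrable measurableT PT sZ0.
have iW n : P.-integrable setT (EFin \o (fun x => g0 * W n x)).
  have := integrableZl measurableT g0 (sqint_integrable measurableT PT (sW n)).
  exact: eq_integrable.
have sZn n : sqint P setT (fun x => Z0 x + g0 * W n x).
  by apply: sqintD => //; exact: sqintZ.
have mean n : \int[P]_x (Z0 x + g0 * W n x) = 0.
  rewrite RintegralD// (gaussian_mean (measurable_row c) erlang_cov_ge0 (row_mean_law c) iZ0).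
  rewrite RintegralZl//; last exact: (sqint_integrable measurableT PT (sW n)).
  by rewrite wiener_sum_mean// mulr0 addr0.
have mom2 n : \int[P]_x ((Z0 x + g0 * W n x) ^+ 2) =
    (c *m S *m c^T) 0 0 + g0 ^+ 2 * \int[P]_x (W n x ^+ 2).
  have iZZ := sZ0.2; have iWW := (sW n).2; have iZW := sqint_mul measurableT sZ0 (sW n).
  have i1 : P.-integrable setT (EFin \o (fun x => 2 * g0 * (Z0 x * W n x))).
    by have := integrableZl measurableT (2 * g0) iZW; apply: eq_integrable.
  have i2 : P.-integrable setT (EFin \o (fun x => g0 ^+ 2 * W n x ^+ 2)).
    by have := integrableZl measurableT (g0 ^+ 2) iWW; apply: eq_integrable.
  have i3 : P.-integrable setT (EFin \o (fun x => Z0 x ^+ 2 + 2 * g0 * (Z0 x * W n x))).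
    by have := integrableD measurableT iZZ i1; apply: eq_integrable.
  transitivity (\int[P]_x (Z0 x ^+ 2 + 2 * g0 * (Z0 x * W n x) + g0 ^+ 2 * W n x ^+ 2)).
    by apply: eq_Rintegral => x _; ring.
  rewrite RintegralD// RintegralD// RintegralZl// RintegralZl// row_noise_cov mulr0 addr0.
  congr (_ + _); rewrite /Rintegral.
  by rewrite (gaussian_moment2 (measurable_row c) erlang_cov_ge0 (row_mean_law c)).
have dist n m : (n <= m)%N ->
    \int[P]_x ((Z0 x + g0 * W n x - (Z0 x + g0 * W m x)) ^+ 2) <=
    g0 ^+ 2 * ((2 * (phi z * (t / n.+1%:R))) ^+ 2 * t).
  move=> nm; apply: le_trans (ler_wpM2l (sqr_ge0 g0) (wiener_sum_cauchy BM t_ge0 dC phi_le C0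
    nm)).
  have iWW := (sqintB measurableT (sW n) (sW m)).2.
  rewrite -RintegralZl// le_eqVlt; apply/orP; left; apply/eqP.
  by apply: eq_Rintegral => x _; rewrite -/W; ring.
have rate : g0 ^+ 2 * ((2 * (phi z * (t / n.+1%:R))) ^+ 2 * t) @[n --> \oo] --> 0.
  rewrite -[X in _ --> X](mulr0 (g0 ^+ 2)); apply: cvgM; first exact: cvg_cst.
  exact: wiener_sum_rate_cvg.
have lim2 : \int[P]_x ((Z0 x + g0 * W n x) ^+ 2) @[n --> \oo] -->
    (c *m S *m c^T) 0 0 + g0 ^+ 2 * \int[mu]_(u in `[0, t]) (C (t - u) ^+ 2).
  rewrite (funext mom2); apply: cvgD; first exact: cvg_cst.
  apply: cvgM; first exact: cvg_cst.
  exact: (wiener_sum_moment2_cvg BM t_ge0 dC phi_le C0).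
rewrite /OU_variance (variance_L2_limit mG G0 sZn Gcvg dist rate mean lim2) /=.
congr (_ + _ * _).
(* The isometry yields C (t - u); the substitution u -> t - u is carried out on primitives. *)
have cC2 : continuous (fun u => C u ^+ 2).
  by move=> u; have cu := is_derive_continuous (dC u); exact: (cvgM cu cu).
pose F y := \int[mu]_(u in `[-1, y]) (C u ^+ 2).
have dF (x : R) : -1 < x -> is_derive x 1 F (C x ^+ 2) by exact: is_derive_Rintegral.
transitivity (F t - F 0).
  have dG (x : R) : 0 <= x <= t -> is_derive x 1 (fun u => - F (t - u)) (C (t - x) ^+ 2).
    move=> /andP[x0 xt]; have tx : -1 < t - x by lra.
    have h := is_derive_scalef (-1) (@is_derive_compf R F (fun s => t - s) x _ _ (dF _ tx)
      (is_derive_csubl t x)).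
    rewrite (_ : (fun u => - F (t - u)) = (fun u => -1 * F (t - u))).
      by apply: (is_derive_eq h); ring.
    by apply/funext => u; rewrite mulN1r.
  rewrite (Rintegral_FTC2 t_ge0 dG).
    by rewrite subrr subr0 opprK addrC.
  move=> u; have cu : {for u, continuous (fun s => C (t - s))}.
    exact: is_derive_continuous (@is_derive_compf R C (fun s => t - s) u _ _ (dC _)
      (is_derive_csubl t u)).
  exact: (cvgM cu cu).
apply/esym; apply: Rintegral_FTC2 => // x /andP[x0 _]; apply: dF; lra.
Qed.

End ou_variance.

(** * The strict bound on the damped integral *)

Section response_bound.
Variable R : realType.
Notation mu := (@lebesgue_measure R).
Let D : set R := `[0, +oo[%classic.

(** With U the integral of C^2, the majorant h = C^2 exp(- kappa gam U) has primitive - exp(- kappa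
    gam U) / (kappa gam), so its integral is exactly the bound. Positivity of [A] then makes the
    inequality strict. *)
Lemma damped_integral_lt (C A r : R -> R) (kappa gam : R) :
  0 < kappa -> 0 < gam -> continuous C -> continuous A ->
  (forall s t, 0 <= s -> s <= t -> C s <= C t) ->
  (forall t, 0 < t -> 0 < C t) -> (forall t, 0 <= t -> 0 <= A t) ->
  (forall t, 0 < t -> 0 < A t) -> measurable_fun D r ->
  (forall t, 0 <= t -> `|r t| <=
     C t ^+ 2 * expR (- kappa * (A t + gam * \int[mu]_(u in `[0, t]) (C u ^+ 2)))) ->
  `|\int[mu]_(t in D) r t| < (kappa * gam)^-1.
Proof.
move=> k0 g0 cC cA Cmono Cpos A0 Apos mr rle.
have cC2 : continuous (fun u => C u ^+ 2) by move=> u; exact: (cvgM (cC u) (cC u)).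
pose U y := \int[mu]_(u in `[-1, y]) (C u ^+ 2) - \int[mu]_(u in `[-1, 0]) (C u ^+ 2).
have dU (x : R) : -1 < x -> is_derive x 1 U (C x ^+ 2).
  move=> x1; have h := is_derive_subf (is_derive_Rintegral cC2 x1)
    (is_derive_cstf (\int[mu]_(u in `[-1, 0]) (C u ^+ 2)) x).
  by apply: (is_derive_eq h); rewrite subr0.
have UE t : 0 <= t -> U t = \int[mu]_(u in `[0, t]) (C u ^+ 2).
  move=> t0; have dUt (x : R) : 0 <= x <= t -> is_derive x 1 U (C x ^+ 2).
    by move=> /andP[x0 _]; apply: dU; lra.
  by rewrite (Rintegral_FTC2 t0 dUt cC2) /U subrr subr0.
have U0 : U 0 = 0 by rewrite /U subrr.
pose E t := expR (- (kappa * gam) * U t).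
pose I0 := (kappa * gam)^-1.
have kg : 0 < kappa * gam by rewrite mulr_gt0.
have I0_gt0 : 0 < I0 by rewrite invr_gt0.
have dE (x : R) : -1 < x -> is_derive x 1 (fun t => - I0 * E t) (C x ^+ 2 * E x).
  move=> x1; have h := is_derive_scalef (- I0) (@is_derive_compf R expR (fun t => - (kappa *
    gam) * U t) x _ _
    (is_derive_expR _) (is_derive_scalef (- (kappa * gam)) (dU x x1))).
  apply: (is_derive_eq h); rewrite /I0 -/(E x); move: (U x) (E x) (C x) => u e c.
  by field; rewrite !lt0r_neq0.
have cEx (x : R) : -1 < x -> {for x, continuous E}.
  move=> x1; exact: is_derive_continuous (@is_derive_compf R expR (fun t => - (kappa * gam) *
    U t) x _ _
    (is_derive_expR _) (is_derive_scalef (- (kappa * gam)) (dU x x1))).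
pose h t := C t ^+ 2 * E t.
have chx (x : R) : -1 < x -> {for x, continuous h} by move=> x1; apply: cvgM;
  [exact: cC2|exact: cEx].
have ch : {within D, continuous h}.
  apply: continuous_in_subspaceT => x; rewrite inE /D /= in_itv/= andbT => x0; apply: chx; lra.
have h_ge0 t : 0 <= h t by rewrite /h mulr_ge0 ?sqr_ge0 ?expR_ge0.
(* Since [C] is nondecreasing and positive at 1, [U] grows at least linearly after time 1, so the
   primitive vanishes at infinity. *)
have U_lb t : 1 <= t -> C 1 ^+ 2 * (t - 1) <= U t.
  move=> t1.
  have [z] : exists2 c, c \in `[1, t]%R & U t - U 1 = C c ^+ 2 * (t - 1).
    apply: MVT_segment => //.
      by move=> x; rewrite in_itv/= => /andP[x1 _]; apply: dU; lra.
    apply: continuous_in_subspaceT => x; rewrite inE /= in_itv/= => /andP[x1 _].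
    by apply: is_derive_continuous (dU x _); lra.
  rewrite in_itv/= => /andP[z1 _] UU.
  have U1 : 0 <= U 1 by rewrite UE//; apply: Rintegral_ge0 => u _; exact: sqr_ge0.
  have : C 1 ^+ 2 * (t - 1) <= C z ^+ 2 * (t - 1).
    apply: ler_wpM2r; first by rewrite subr_ge0.
    have C1z : C 1 <= C z by exact: Cmono.
    have C1 : 0 < C 1 by exact: Cpos.
    by apply: lerXn2r => //; rewrite nnegrE ltW//; exact: lt_le_trans C1z.
  lra.
have Fcvg : - I0 * E t @[t --> +oo] --> 0.
  rewrite -[X in _ --> X](mulr0 (- I0)); apply: cvgM; first exact: cvg_cst.
  rewrite /E (_ : (fun t => expR _) = (fun x => expR (- x)) \o (fun t => kappa * gam * U t));
    last first.
    by apply/funext => x /=; rewrite mulNr.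
  apply: cvg_comp (@cvgr_expR R); apply: gt0_cvgMry => //.
  have c1 : 0 < C 1 ^+ 2 by rewrite exprn_gt0// Cpos.
  apply/cvgryPge => B; near=> t.
  apply: (le_trans _ (U_lb t _)).
    rewrite -ler_pdivrMl// lerBrDr; near: t; exact: nbhs_pinfty_ge.
  by near: t; exact: nbhs_pinfty_ge.
have dF (x : R) : 0 < x -> derivable (fun t => - I0 * E t) x 1.
  by move=> x0; have [] := dE x (lt_trans (ltrN10 R) x0).
have F0 : - I0 * E x @[x --> 0^'+] --> - I0 * E 0.
  by apply: cvg_at_right_filter; exact: is_derive_continuous (dE 0 (ltrN10 R)).
have F'E : {in `]0, +oo[, derive1 (fun t => - I0 * E t) =1 h}.
  move=> x; rewrite in_itv/= andbT => x0; rewrite derive1E.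
  by have [] := dE x (lt_trans (ltrN10 R) x0).
have h_ge0' (x : R) : 0 <= x -> 0 <= h x by [].
have E0 : 0 - - I0 * E 0 = I0 by rewrite sub0r /E U0 mulr0 expR0 mulr1 opprK.
have dh0 : \int[mu]_(t in D) h t = I0.
  by rewrite -[RHS]E0; exact: Rintegral_ge0_continuous_FTC2y h_ge0' ch Fcvg dF F0 F'E.
pose f t := C t ^+ 2 * expR (- kappa * (A t + gam * U t)).
have fE t : f t = h t * expR (- kappa * A t).
  by rewrite /f /h /E -mulrA -expRD; congr (_ * expR _); ring.
have f_le t : 0 <= t -> f t <= h t.
  move=> t0; rewrite fE ler_piMr// -expR0 ler_expR mulNr oppr_le0.
  by apply: mulr_ge0; [exact: ltW|exact: A0].
have cf (x : R) : -1 < x -> {for x, continuous f}.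
  move=> x1; rewrite (funext fE); apply: cvgM; first exact: chx.
  apply: continuous_comp; last exact: continuous_expR.
  by apply: cvgM; [exact: cvg_cst|exact: cA].
(* To turn the pointwise gap into a gap between integrals, h - f is minimized over [1, 2], a compact
   interval away from 0, where the gap may close. The positive minimum is then subtracted from [h]
   there. *)
have c12 : {within `[1, 2], continuous (fun t => h t - f t)}.
  apply: continuous_in_subspaceT => x; rewrite inE /= in_itv/= => /andP[x1 _].
  by apply: cvgB; [apply: chx|apply: cf]; lra.
have [z zin zmin] := EVT_min (ler1n R 2) c12.
have z0 : 0 < z by move: zin; rewrite in_itv/= => /andP[z1 _]; lra.
pose m := h z - f z.
have m_gt0 : 0 < m.
  rewrite /m fE -{1}[h z]mulr1 -mulrBr mulr_gt0//.
    by rewrite /h mulr_gt0 ?expR_gt0// exprn_gt0// Cpos.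
  by rewrite subr_gt0 -expR0 ltr_expR mulNr oppr_lt0 mulr_gt0// Apos.
have mD : measurable (D : set (measurableTypeR R)) by exact: measurable_itv.
have mh : measurable_fun D h by exact: subspace_continuous_measurable_fun.
have ih : mu.-integrable D (EFin \o h).
  apply/integrableP; split; first exact/measurable_EFinP.
  under eq_integral do rewrite /= ger0_norm//.
  by rewrite (ge0_continuous_FTC2y h_ge0' ch Fcvg dF F0 F'E) -EFinD ltry.
have i1 : mu.-integrable D (EFin \o \1_`[1, 2]).
  by apply: integrableS (integrable_indic_itv 1 2 true false); rewrite //; exact: measurableT.
have iind : mu.-integrable D (EFin \o (fun t => m * \1_`[1, 2] t)).
  by have := integrableZl mD m i1; apply: eq_integrable.
have ig : mu.-integrable D (EFin \o (fun t => h t - m * \1_`[1, 2] t)).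
  by have := integrableB mD ih iind; apply: eq_integrable.
have r_le t : D t -> `|r t| <= h t - m * \1_`[1, 2] t.
  rewrite /D /= in_itv/= andbT => t0; have rf : `|r t| <= f t by rewrite /f UE//; exact: rle.
  rewrite indicE; have [t12|t12] := boolP (t \in _).
    rewrite mulr1; move: t12; rewrite inE /= => t12.
    by rewrite (le_trans rf)// lerBrDr addrC -lerBrDr; exact: zmin.
  by rewrite mulr0 subr0 (le_trans rf)// f_le.
have ir : mu.-integrable D (EFin \o r).
  apply: (le_integrable mD _ _ ig); first exact/measurable_EFinP.
  move=> t Dt; rewrite /= lee_fin [leRHS]ger0_norm; first exact: r_le.
  exact: le_trans (r_le t Dt).
apply: (le_lt_trans (le_normr_Rintegral mD ir)).
apply: (@le_lt_trans _ _ (\int[mu]_(t in D) (h t - m * \1_`[1, 2] t))).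
  apply: le_Rintegral => //; first by have /= := integrable_norm ir.
rewrite RintegralB// dh0 -/I0 ltrBlDr ltrDl.
rewrite RintegralZl// mulr_gt0// /Rintegral integral_indic//.
rewrite (_ : `[1, 2] `&` D = `[1, 2]%classic); last first.
  apply/seteqP; split=> u /=; first by move=> [].
  by rewrite /D /= !in_itv/= => /andP[u1 u2]; rewrite u1 u2 andbT; split=> //; lra.
rewrite /= lebesgue_measure_itv/= lte_fin ifT -?EFinB/=; lra.
Unshelve. all: by end_near. Qed.

End response_bound.

(** * The bound for the response integral of the process *)

Section response.
Context (R : realType) (K : nat) (dT : measure_display) (T : measurableType dT).
Variables (P : probability T R) (alpha g0 : R) (B : R -> T -> R) (Y : R -> T -> 'cV[R]_K).
Hypotheses (alpha_gt0 : 0 < alpha) (g0_gt0 : 0 < g0) (K_gt0 : (0 < K)%N).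
Hypothesis OU : stationary_OU P alpha g0 B Y.
Notation mu := (@lebesgue_measure R).

(** The factor exp(-lambda t) has real part of absolute value at most 1 when Re lambda >= 0. The
    damping lemma is applied with kappa = q2 / 2 and gam = g0^2. *)
Lemma Re_response_lt (q2 : R) (lambda : R[i]) : 0 < q2 -> 0 <= complex.Re lambda ->
  `|complex.Re (response_integral K alpha q2 (OU_variance K_gt0 P Y) lambda)| <
  2 / (q2 * g0 ^+ 2).
Proof.
move=> q0 lam0.
pose C := erlang_int alpha K.-1.
pose A t := (erlang_row alpha K t *m invariant_cov K alpha g0 *m (erlang_row alpha K t)^T) 0 0.
pose U t := \int[mu]_(u in `[0, t]) (C u ^+ 2).
have cC : continuous C by exact: continuous_erlang_int.
have cA : continuous A.
  have AE t : A t = \sum_(j < K) (\sum_(i < K) erlang_int alpha i t * invariant_cov K alpha g0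
    i j) *
      erlang_int alpha j t.
    rewrite /A mxE; apply: eq_bigr => j _; rewrite [X in _ * X]mxE [X in _ * X]mxE mxE.
    by congr (_ * _); apply: eq_bigr => i _; rewrite mxE.
  have cE k : continuous (erlang_int alpha k) by exact: continuous_erlang_int.
  have cS (j : 'I_K) : continuous (fun t =>
      \sum_(i < K) erlang_int alpha i t * invariant_cov K alpha g0 i j).
    by apply: continuous_sumf => i t; exact: cvgM (cE i t) (cvg_cst _).
  by rewrite (funext AE); apply: continuous_sumf => j t; exact: cvgM (cS j t) (cE j t).
have VE (t : R) : 0 <= t -> OU_variance K_gt0 P Y t = A t + g0 ^+ 2 * U t.
  by move=> t0; rewrite (OU_varianceE alpha_gt0 (lt0r_neq0 g0_gt0) K_gt0 OU t0).
have gE (t : R) : 0 <= t -> gain K alpha t = C t.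
  by move=> t0; rewrite -[in LHS](prednK K_gt0) gain_erlang.
pose r (t : R) := expR (- complex.Re lambda * t) * cos (- complex.Im lambda * t) *
  (C t ^+ 2 * expR (- (q2 / 2) * (A t + g0 ^+ 2 * U t))).
have -> : complex.Re (response_integral K alpha q2 (OU_variance K_gt0 P Y) lambda) =
    \int[mu]_(t in `[0, +oo[) r t.
  rewrite /response_integral /Cintegral /=; apply: eq_Rintegral => t.
  rewrite inE /= in_itv/= andbT => t0; rewrite gE// VE// /r; case: (lambda) => a b /=.
  by rewrite !(mulr0, mul0r, subr0, add0r).
have -> : 2 / (q2 * g0 ^+ 2) = (q2 / 2 * g0 ^+ 2)^-1 by field; rewrite !lt0r_neq0.
apply: (@damped_integral_lt _ C A) => //.
- by rewrite divr_gt0.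
- by rewrite exprn_gt0.
- by move=> s t s0 st; exact: erlang_int_le.
- by move=> t t0; exact: erlang_int_gt0.
- move=> t; rewrite le_eqVlt => /predU1P[<-|t0].
    by rewrite /A erlang_row0 !mul0mx mxE.
  by apply/ltW/erlang_cov_gt0 => //; exact: lt0r_neq0.
- by move=> t t0; apply: erlang_cov_gt0 => //; exact: lt0r_neq0.
(* [U] is measurable because it is nondecreasing; for negative times it is an integral over an empty
   interval, hence 0. *)
- have mU : measurable_fun setT U.
    apply: nondecreasing_measurable => // s t st.
    have U_ge0 y : 0 <= U y by apply: Rintegral_ge0 => u _; exact: sqr_ge0.
    have [s0|s0] := ltP s 0; first by rewrite {1}/U set_itv_ge ?Rintegral_set0// bnd_simp
      -ltNge.
    have cC2 : continuous (fun u => C u ^+ 2) by move=> u; exact: (cvgM (cC u) (cC u)).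
    rewrite /U (Rintegral_itv_split s0 st); last exact: continuous_itv_integrable.
    by rewrite lerDl; apply: Rintegral_ge0 => u _; exact: sqr_ge0.
  have mC : measurable_fun setT C by exact: continuous_measurable_fun.
  have mA : measurable_fun setT A by exact: continuous_measurable_fun.
  have mexp (f : R -> R) : measurable_fun setT f -> measurable_fun setT (fun t => expR (f t)).
    by move=> mf; apply: measurableT_comp => //; exact: measurable_expR.
  have mlin (a : R) : measurable_fun setT (fun t : R => a * t) by exact: mulrl_measurable.
  have mAU : measurable_fun setT (fun t => - (q2 / 2) * (A t + g0 ^+ 2 * U t)).
    apply: measurable_funM; first exact: measurable_cst.
    by apply: measurable_funD => //; apply: measurable_funM => //; exact: measurable_cst.
  apply: measurable_funTS; apply: measurable_funM; apply: measurable_funM.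
  + exact: (mexp _ (mlin _)).
  + exact: (measurable_cos_comp (mlin _)).
  + exact: measurable_funX.
  + exact: (mexp _ mAU).
- move=> t t0; rewrite /r -/(U t) normrM -[leRHS]mul1r; apply: ler_pM => //.
    rewrite normrM -[leRHS]mulr1; apply: ler_pM => //; last exact: cos_max.
    by rewrite ger0_norm ?expR_ge0// -expR0 ler_expR mulNr oppr_le0 mulr_ge0.
  by rewrite ger0_norm// mulr_ge0 ?sqr_ge0 ?expR_ge0.
Qed.

End response.

Unset Implicit Arguments.

Theorem lemma6 (R : realType) (d : nat) (d_gt0 : (0 < d)%N)
    (rho0 : R) (rho0_gt0 : 0 < rho0)
    (G : R -> R)
    (G_gt0 : forall r : R, 0 <= r -> 0 < G r)
    (G_bounded : exists M, forall r : R, 0 <= r -> G r <= M)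
    (G_decreasing : forall r s : R, 0 <= r -> r <= s -> G s <= G r)
    (G_derivable : derivable G rho0 1)
    (G'_lt0 : derive1 G rho0 < 0)
    (W : d.-tuple R -> R) (W_kernel : torus_kernel W)
    (W_radial : radially_nonincreasing W)
    (K : nat) (K_gt0 : (0 < K)%N) (alpha : R) (alpha_gt0 : 0 < alpha)
    (n : 'rV[int]_d) (n_neq0 : n != 0)
    (dT : measure_display) (T : measurableType dT) (P : probability T R)
    (B : R -> T -> R) (Y : R -> T -> 'cV[R]_K)
    (Y_OU : stationary_OU P alpha (G rho0) B Y)
    (lambda : R[i]) (Re_lambda_ge0 : 0 <= complex.Re lambda)
    (dispersion :
       let q2 := enorm (wave_vector n) ^+ 2 in
       (- rho0 * G rho0 * derive1 G rho0)%:C * Fourier_coef W n * q2%:C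
         * response_integral K alpha q2 (OU_variance K_gt0 P Y) lambda = 1)
    (e : 'rV[int]_d) (e_unit : enorm (of_lattice e : d.-tuple R) = 1) :
  1 < (- 2 * rho0 * (derive1 G rho0 / G rho0))%:C * Fourier_coef W e.
Proof.
have [M [w [bw FE]]] := Fourier_coef_radial W_kernel W_radial.
have modes_le := radial_cos_le bw n_neq0 (unit_mode_of_enorm e_unit).
move: dispersion; cbv zeta; rewrite !FE -rmorphM; set q2 := enorm _ ^+ 2 => disp.
have q2_gt0 : 0 < q2 by rewrite exprn_gt0// wave_vector_gt0.
have g0_gt0 : 0 < G rho0 by apply: G_gt0; exact: ltW.
have := Re_response_lt alpha_gt0 g0_gt0 K_gt0 Y_OU q2_gt0 Re_lambda_ge0.
move: disp; set I := response_integral _ _ _ _ _.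
move: (derive1 G rho0) (G rho0) G'_lt0 g0_gt0 modes_le => g1 g0 g1_lt0 g0_gt0.
move: (radial_cos w n) (radial_cos w e) => wn we wn_le disp I_lt.
(* All factors other than [I] are real, so the real part of the relation involves only the real part
   of [I]. *)
have {}disp : - rho0 * g0 * g1 * wn * q2 * complex.Re I = 1.
  have := congr1 (@complex.Re R) disp; case: (I) => a b /=.
  by rewrite !(mul0r, mulr0, addr0, subr0).
move: (complex.Re I) disp I_lt => ReI disp I_lt; clear I; clearbody q2.
have [a aE] : exists a, a = - rho0 * g0 * g1 by eexists.
rewrite -aE in disp.
have a_gt0 : 0 < a.
  by rewrite aE -mulrA mulNr -mulrN mulr_gt0// -mulrN mulr_gt0// oppr_gt0.
have wn_gt0 : 0 < `|wn|.
  rewrite normr_gt0; apply/eqP => wn0; move: disp; rewrite wn0 mulr0 !mul0r => /eqP.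
  by rewrite eq_sym oner_eq0.
(* Only the product of [wn] and [ReI] is known to be positive; taking absolute values lets both
   bounds be used. *)
have n1 : a * `|wn| * q2 * `|ReI| = 1.
  by rewrite -[RHS]normr1 -disp !normrM (gtr0_norm a_gt0) (gtr0_norm q2_gt0).
have : 1 < a * `|wn| * q2 * (2 / (q2 * g0 ^+ 2)).
  by rewrite -[ltLHS]n1 ltr_pM2l// !mulr_gt0.
(* Here [q2] cancels, which leaves a condition on n through [wn] alone. *)
rewrite (_ : _ * (2 / _) = 2 * a / g0 ^+ 2 * `|wn|); last first.
  by field; rewrite !lt0r_neq0.
move=> lt1; rewrite -rmorphM -[X in X < _]/(1%:C) ltcR.
apply: (lt_le_trans lt1).
rewrite (_ : - 2 * rho0 * (g1 / g0) * we = 2 * a / g0 ^+ 2 * we); last first.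
  by rewrite aE; field; rewrite lt0r_neq0.
by rewrite ler_pM2l// !mulr_gt0// invr_gt0 exprn_gt0.
Qed.
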